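(* Let $R\in\mathbb{C}(t)$ with $R(0)=0$, $R\neq0$, such that no iterate $R^{\circ n}$ ($n\geq1$) is the identity. Let $\mathbb{F}$ be the field defined in the context, and suppose there exists $\Psi\in\mathbb{F}$ with $\Phi_R(\Psi)=R'\Psi$ such that $\Psi$ is differentially transcendental over $\mathbb{C}(t)$ with respect to $\frac{d}{dt}$. Let $a\in\mathbb{C}(t)$ and let $z\in\mathbb{C}((t))$ satisfy $z(R(t))=a(t)z(t)$. Then either $z$ is algebraic over $\mathbb{C}(t)$ and there exists a positive integer $N$ such that $z^N\in\mathbb{C}(t)$, or $z$ is differentially transcendental over $\mathbb{C}(t)$.
   Context: $\Phi_R$ denotes the endomorphism $f=\sum_n f_nt^n\mapsto f(R(t))=\sum_nf_nR(t)^n$ of $\mathbb{C}((t))$; rational functions are identified with their expansions. Write $R(t)=r_dt^d(1+u(t))$ with $d\geq1$, $r_d\neq0$, $u\in t\mathbb{C}[[t]]$. If $d=1$, $\mathbb{F}=\mathbb{C}((t))$. If $d\geq2$, $\mathbb{F}=\mathbb{C}((t))(\log t)$: the purely transcendental extension $\mathbb{C}((t))(\ell)$ with derivation extending $\frac{d}{dt}$ by $\ell'=1/t$, and $\Phi_R$ extended by $\Phi_R(\ell)=\lambda+d\ell+\sum_{k\geq1}(-1)^{k+1}u^k/k$, with $\lambda$ a fixed logarithm of $r_d$. On $\mathbb{F}$ the chain rule $(\Phi_R(g))'=R'\,\Phi_R(g')$ holds and the $\Phi_R$-fixed elements are exactly $\mathbb{C}$. Differential transcendence over $\mathbb{C}(t)$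 means satisfying no nontrivial polynomial relation $P(g,g',\dots,g^{(n)})=0$ with coefficients in $\mathbb{C}(t)$. *)

(* Defs.v *)
From HB Require Import structures.
From mathcomp Require Import all_boot all_order all_algebra.
From mathcomp Require Import generic_quotient fraction complex ring.
From mathcomp Require Import -(notations) mpoly.
From mathcomp Require Import boolp reals sequences trigo.

Set Implicit Arguments.
Unset Strict Implicit.
Unset Printing Implicit Defensive.

Import GRing.Theory.
Local Open Scope ring_scope.

Notation "x %:F" := (@FracField.tofrac _ x) : ring_scope.

Record fps (F : fieldType) := Fps { fps_coef :> nat -> F }.
Arguments Fps {F} _.

HB.instance Definition _ (F : fieldType) := gen_eqMixin (fps F).
HB.instance Definition _ (F : fieldType) := gen_choiceMixin (fps F).

Section PowerSeriesRing.
Variable F : fieldType.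
Implicit Types f g h : fps F.

Lemma fps_eq f g : f =1 g -> f = g.
Proof. by case: f g => [f] [g] /= /funext ->. Qed.

Definition fps_const (c : F) : fps F := Fps (fun n => if n is 0%N then c else 0).
Definition fps_add f g : fps F := Fps (fun n => f n + g n).
Definition fps_opp f : fps F := Fps (fun n => - f n).
Definition fps_mul f g : fps F := Fps (fun n => \sum_(i < n.+1) f i * g (n - i)%N).

Fact fps_addA : associative fps_add.
Proof. by move=> f g h; apply: fps_eq => n /=; rewrite addrA. Qed.
Fact fps_addC : commutative fps_add.
Proof. by move=> f g; apply: fps_eq => n /=; rewrite addrC. Qed.
Fact fps_add0 : left_id (fps_const 0) fps_add.
Proof. by move=> f; apply: fps_eq => -[|n] /=; rewrite add0r. Qed.
Fact fps_addN : left_inverse (fps_const 0) fps_opp fps_add.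
Proof. by move=> f; apply: fps_eq => -[|n] /=; rewrite addNr. Qed.
HB.instance Definition _ :=
  GRing.isZmodule.Build (fps F) fps_addA fps_addC fps_add0 fps_addN.

Definition fps_trunc n f : {poly F} := \poly_(i < n) f i.

Lemma coef_fps_trunc n f i : (i < n)%N -> (fps_trunc n f)`_i = f i.
Proof. by move=> lt_in; rewrite coef_poly lt_in. Qed.

Lemma fps_mul_trunc n f g i : (i < n)%N ->
  fps_mul f g i = (fps_trunc n f * fps_trunc n g)`_i.
Proof.
move=> lt_in; rewrite coefM /=; apply: eq_bigr => j _.
rewrite !coef_fps_trunc //; first exact: leq_ltn_trans (leq_subr _ _) lt_in.
by apply: leq_ltn_trans lt_in; rewrite -ltnS.
Qed.

Fact fps_mulA : associative fps_mul.
Proof.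
move=> f g h; apply: fps_eq => n.
transitivity ((fps_trunc n.+1 f * fps_trunc n.+1 g * fps_trunc n.+1 h)`_n).
  rewrite -mulrA coefM; apply: eq_bigr => j _.
  by rewrite (fps_mul_trunc (n := n.+1)) ?coef_fps_trunc // ltnS leq_subr.
rewrite coefM; apply: eq_bigr => j _.
by rewrite (fps_mul_trunc (n := n.+1)) ?coef_fps_trunc // ltnS leq_subr.
Qed.
Fact fps_mulC : commutative fps_mul.
Proof.
by move=> f g; apply: fps_eq => n; rewrite !(fps_mul_trunc (n := n.+1)) // mulrC.
Qed.
Fact fps_mul1 : left_id (fps_const 1) fps_mul.
Proof.
move=> f; apply: fps_eq => n /=.
rewrite big_ord_recl /= mul1r subn0 big1 ?addr0 // => i _.
by rewrite mul0r.
Qed.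
Fact fps_mulDl : left_distributive fps_mul fps_add.
Proof.
move=> f g h; apply: fps_eq => n /=; rewrite -big_split.
by apply: eq_bigr => i _; rewrite /= mulrDl.
Qed.
Fact fps_one_neq0 : fps_const 1 != fps_const 0.
Proof. by apply/eqP => /(congr1 (fun f : fps F => f 0)) /eqP; rewrite /= oner_eq0. Qed.
HB.instance Definition _ := GRing.Zmodule_isComNzRing.Build (fps F)
  fps_mulA fps_mulC fps_mul1 fps_mulDl fps_one_neq0.

Definition fps_unit : {pred fps F} := fun f => `[< exists g, g * f = 1 >].
Definition fps_inv f : fps F :=
  if pselect (exists g, g * f = 1) is left ex_inv then projT1 (cid ex_inv) else f.

Fact fps_mulV : {in fps_unit, left_inverse 1 fps_inv *%R}.
Proof.
move=> f /asboolP ex_inv; rewrite /fps_inv; case: pselect => // ex_inv'.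
exact: projT2 (cid ex_inv').
Qed.
Fact fps_unitP f g : g * f = 1 -> f \in fps_unit.
Proof. by move=> gf1; apply/asboolP; exists g. Qed.
Fact fps_inv_out : {in [predC fps_unit], fps_inv =1 id}.
Proof.
by move=> f /asboolP no_inv; rewrite /fps_inv; case: pselect => // /no_inv.
Qed.
HB.instance Definition _ := GRing.ComNzRing_hasMulInverse.Build (fps F)
  fps_mulV fps_unitP fps_inv_out.

Lemma fps_neq0_order f : f != 0 -> {n | f n != 0 & forall i, (i < n)%N -> f i = 0}.
Proof.
move=> nz_f; have ex_n : exists n, f n != 0.
  apply: contrapT => no_n; case/eqP: nz_f; apply: fps_eq => n.
  transitivity (0 : F); last by case: n.
  by apply: contrapT => /eqP nz_fn; apply: no_n; exists n.
case: (ex_minnP ex_n) => n nz_fn n_min; exists n => // i lt_in.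
by apply/eqP; apply: contraTT lt_in => /n_min; rewrite -leqNgt.
Qed.

Fact fps_idomain f g : f * g = 0 -> (f == 0) || (g == 0).
Proof.
move=> fg0; apply/norP => -[/fps_neq0_order[m nz_fm fm0] /fps_neq0_order[n nz_gn gn0]].
have fg_mn : (f * g) (m + n)%N = f m * g n.
  have lt_m : (m < (m + n).+1)%N by rewrite ltnS leq_addr.
  rewrite [LHS](bigD1 (Ordinal lt_m)) //= addKn big1 ?addr0 // => i ne_im.
  have [lt_im | le_mi] := ltnP i m; first by rewrite fm0 ?mul0r.
  rewrite gn0 ?mulr0 // ltn_subLR ?ltn_add2r; last by rewrite -ltnS.
  by rewrite ltn_neqAle eq_sym le_mi andbT.
have /eqP := fg_mn; rewrite fg0 eq_sym.
have -> : (0 : fps F) (m + n)%N = 0 by case: (m + n)%N.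
by rewrite mulf_eq0 (negPf nz_fm) (negPf nz_gn).
Qed.
HB.instance Definition _ :=
  GRing.ComUnitRing_isIntegral.Build (fps F) fps_idomain.

End PowerSeriesRing.

Section PowerSeriesOps.
Variable F : fieldType.
Implicit Types f s u : fps F.

Definition fps_t : fps F := Fps (fun n => (n == 1%N)%:R).
Definition fps_poly (p : {poly F}) : fps F := Fps (fun n => p`_n).
Definition fps_deriv f : fps F := Fps (fun n => f n.+1 *+ n.+1).

(* f(s(t)), meaningful when s has no constant term: s ^+ k then only
   contributes to the coefficients of index at least k. *)
Definition fps_comp f s : fps F :=
  Fps (fun n => \sum_(k < n.+1) f k * (s ^+ k) n).

(* log(1 + u) = \sum_(k >= 1) (-1)^(k+1) u^k / k, when u has no constant term. *)
Definition fps_log1p u : fps F :=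
  Fps (fun n => \sum_(1 <= k < n.+1) (-1) ^+ k.+1 * (u ^+ k) n / k%:R).

End PowerSeriesOps.
Arguments fps_t {F}.

Section FractionLift.
Variables (A : idomainType) (K : fieldType).

(* The extension of an injective ring morphism [phi] to the fraction field; by
   [frac_liftE] it does not depend on the representative of [x]. *)
Definition frac_lift (phi : A -> K) (x : {fraction A}) : K :=
  phi \n_(repr x) / phi \d_(repr x).

(* The extension of a derivation by the quotient rule, see [frac_derivE]. *)
Definition frac_deriv (D : A -> A) (x : {fraction A}) : {fraction A} :=
  let n := \n_(repr x) in let d := \d_(repr x) in
  (D n * d - n * D d)%:F / (d ^+ 2)%:F.

Lemma frac_repr (x : {fraction A}) : x = (\n_(repr x))%:F / (\d_(repr x))%:F.
Proof.
have nz_d : (\d_(repr x))%:F != 0 by rewrite tofrac_eq0 denom_ratioP.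
apply: (canRL (mulfK nz_d)); rewrite -{1}[x]reprK.
have -> : \pi_(FracField.type A)%qT (repr x) * (\d_(repr x))%:F
        = FracField.mul (\pi_(FracField.type A)%qT (repr x)) (\d_(repr x))%:F by [].
unlock FracField.tofrac; rewrite -FracField.pi_mul; apply/eqmodP.
rewrite /= FracField.equivfE /FracField.mulf /=.
by rewrite !numden_Ratio ?mulf_neq0 ?oner_eq0 ?denom_ratioP // !mulr1 mulrC.
Qed.

Lemma frac_cross (a b : A) : b != 0 ->
  \n_(repr (a%:F / b%:F)) * b = a * \d_(repr (a%:F / b%:F)).
Proof.
move=> nz_b; set x := a%:F / b%:F; apply/eqP.
rewrite -tofrac_eq !rmorphM /= -(eqr_div _ _ (y := (\d_(repr x))%:F)).
- by rewrite -frac_repr.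
- by rewrite tofrac_eq0 denom_ratioP.
- by rewrite tofrac_eq0.
Qed.

Lemma frac_liftE (phi : {rmorphism A -> K}) (a b : A) : injective phi -> b != 0 ->
  frac_lift phi (a%:F / b%:F) = phi a / phi b.
Proof.
move=> phi_inj nz_b; have phi_neq0 c : c != 0 -> phi c != 0.
  by move=> nz_c; rewrite (raddf_eq0 _ phi_inj).
apply/eqP; rewrite eqr_div ?phi_neq0 ?denom_ratioP //.
by rewrite -!rmorphM frac_cross.
Qed.

Lemma frac_derivE (D : A -> A) (a b : A) :
    (forall f g, D (f * g) = D f * g + f * D g) -> b != 0 ->
  frac_deriv D (a%:F / b%:F) = (D a * b - a * D b)%:F / (b ^+ 2)%:F.
Proof.
move=> DM nz_b; rewrite /frac_deriv; set n := \n_ _; set d := \d_ _.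
have cross : n * b = a * d by exact: frac_cross.
have nz_d : d != 0 by exact: denom_ratioP.
apply/eqP; rewrite eqr_div ?tofrac_eq0 ?expf_neq0 //.
rewrite -!tofracM tofrac_eq; apply/eqP.
have Dcross : D n * b + n * D b = D a * d + a * D d by rewrite -!DM cross.
have -> : (D n * d - n * D d) * b ^+ 2 = (D n * b + n * D b) * (b * d)
        - (n * b) * (d * D b) - (n * b) * (D d * b) by ring.
by rewrite Dcross cross; ring.
Qed.

End FractionLift.

Notation ratfun F := {fraction {poly F}}.
(* F((t)), as the fraction field of F[[t]]. *)
Notation laurent F := {fraction (fps F)}.
(* F((t))(log t): the outer variable 'X of the polynomial ring stands for log t. *)
Notation loglaurent F := {fraction {poly {fraction (fps F)}}}.

Section Laurent.
Variable F : fieldType.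

(* The expansion of a rational function at the origin. *)
Definition expansion : ratfun F -> laurent F :=
  frac_lift (fun p : {poly F} => (fps_poly p)%:F).

Definition laurent_deriv : laurent F -> laurent F := frac_deriv (@fps_deriv F).

(* f(t) |-> f(s(t)), for a nonzero s without constant term. *)
Definition Phi (s : fps F) : laurent F -> laurent F :=
  frac_lift (fun f : fps F => (fps_comp f s)%:F).

Definition loglaurent_of (f : laurent F) : loglaurent F := (f%:P)%:F.

(* (\sum_i f_i l^i)' = \sum_i f_i' l^i + (\sum_i i f_i l^(i-1)) / t *)
Definition loglaurent_deriv : loglaurent F -> loglaurent F :=
  frac_deriv (fun p : {poly laurent F} =>
    map_poly laurent_deriv p + (fps_t%:F)^-1 *: p^`()).

(* Phi s on coefficients and log t |-> d * log t + c. *)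
Definition Phi_log (s : fps F) (d : nat) (c : fps F) :
    loglaurent F -> loglaurent F :=
  frac_lift (fun p : {poly laurent F} =>
    (map_poly (Phi s) p \Po (d%:R *: 'X + (c%:F)%:P))%:F).

End Laurent.

(* [iota] embeds the field of coefficients [K] into [L], which carries the
   derivation [D]; the n.+1 variables of P are replaced by g, D g, ..., D^n g. *)
Definition diff_transcendental (K L : fieldType) (iota : K -> L) (D : L -> L)
    (g : L) : Prop :=
  forall (n : nat) (P : mpoly n.+1 K), P != 0 ->
    mmap iota (fun i : 'I_n.+1 => iter i D g) P != 0.

Local Open Scope complex_scope.

(* exp(x + i y) = e^x (cos y + i sin y) *)
Definition cexp (K : realType) (z : K[i]) : K[i] :=
  let: x +i* y := z in (expR x * cos y) +i* (expR x * sin y).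

(* Main.v *)
(** Write D for d/dt.  By the chain rule and [Phi Psi = R' Psi], the derivation
    delta = Psi D commutes with Phi.  Suppose that z is differentially algebraic;
    then z and its derivatives lie in a finitely generated, D-stable field E over
    C(t).  With y = z'/z, the elements w_i = delta^i (Psi y) satisfy
    [Phi w_i = w_i + b_i] with b_i in the field generated over C(t) by the
    P_i = delta^i Psi.  The P_i are algebraically independent over E, whereas the
    P_i and w_i for i <= N all lie in E(P_0, ..., P_N), of too small transcendence
    degree over C(t).  So the w_i are algebraically dependent over k = C(t)(P_i),
    and Ostrowski's argument gives a linear relation modulo k with Phi-fixed
    coefficients.  Since w_i is y P_i up to an element of E(P_0, ..., P_(i-1)),
    comparing leading coefficients in the last P_i involved puts y in C(t).

    Then [R' y(R) = y + a'/a].  Write a multiple of y as an exact derivative, plus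
    one logarithmic derivative b'/b, plus logarithmic forms whose residues are
    rationally independent together with 1.  Independence forces the exact part
    and each of the latter forms to be invariant under pullback by R.  An invariant
    form h <> 0 would make Psi h a fixed element of Phi, and Psi rational.  So
    N y = b'/b for some N, and z^N / b is a constant. *)

From HB Require Import structures.
Require Import Defs.
From mathcomp Require Import all_boot all_order all_algebra.
From mathcomp Require Import generic_quotient fraction complex ring.
From mathcomp Require Import -(notations) mpoly.
From mathcomp Require Import boolp reals.

Set Implicit Arguments.
Unset Strict Implicit.
Unset Printing Implicit Defensive.

Import GRing.Theory.
Local Open Scope ring_scope.
Local Open Scope complex_scope.

(** * Towers of subfields and algebraic dependence *)

(** By the chain rule alone, the equation of [z'/z] carries a factor R' and its derivatives carry
    growing powers of R', whereas Ostrowski's argument needs equations of the form [Phi w - w = b].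
    Multiplying by Psi absorbs the factor. The price is that the right-hand sides leave C(t) for the
    field of the [P i], and these are removed at the end thanks to their transcendence over E. Psi
    lives in C((t)) or in C((t))(log t), while z is always a Laurent series. The differential
    algebra is therefore done in an abstract field with a derivation and an endomorphism, into which
    z is carried by an embedding [lift]. The chain rule and the field of fixed elements are
    established for both choices. The hypothesis on iterates enters through the fixed elements when
    d = 1, where Phi preserves orders; when d >= 2 Phi multiplies orders by d, and comparing them
    decides. The exponent N arises from the integer relations between residues: eliminating a
    residue costs an integer factor. *)

Section Subfields.
Variable F : fieldType.
Implicit Types (S T : divringClosed F) (x y : F) (p q : {poly F}).

(* The subfield S(x). *)
Definition adj_pred (S : {pred F}) x : {pred F} := fun y =>
  `[< exists p q, [/\ p \is a polyOver S, q \is a polyOver S, q.[x] != 0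
                    & y = p.[x] / q.[x]] >].

Fact adj_closed S x : GRing.divring_closed (adj_pred S x).
Proof.
split.
- apply/asboolP; exists 1, 1; rewrite !rpred1 !hornerE; split => //.
    by rewrite oner_eq0.
  by rewrite ?invr1 ?mulr1.
- move=> y1 y2 /asboolP[p1 [q1 [p1S q1S nz_q1 ->]]] /asboolP[p2 [q2 [p2S q2S nz_q2 ->]]].
  apply/asboolP; exists (p1 * q2 - p2 * q1), (q1 * q2).
  rewrite rpredB ?rpredM // !hornerE mulf_neq0 //; split=> //.
  by field; apply/andP.
- move=> y1 y2 /asboolP[p1 [q1 [p1S q1S nz_q1 ->]]] /asboolP[p2 [q2 [p2S q2S nz_q2 ->]]].
  have [-> | nz_p2] := eqVneq p2.[x] 0.
    rewrite mul0r invr0 mulr0; apply/asboolP; exists 0, 1; rewrite rpred0 rpred1 !hornerE.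
    by rewrite oner_eq0 ?mul0r.
  apply/asboolP; exists (p1 * q2), (q1 * p2).
  rewrite !rpredM // !hornerE mulf_neq0 //; split=> //.
  by field; apply/and3P.
Qed.
HB.instance Definition _ S x := GRing.isDivringClosed.Build F (adj_pred S x) (adj_closed S x).

Definition adj S x : divringClosed F := adj_pred S x.

Lemma adjP S x y : reflect (exists p q, [/\ p \is a polyOver S, q \is a polyOver S,
  q.[x] != 0 & y = p.[x] / q.[x]]) (y \in adj S x).
Proof. exact: asboolP. Qed.

Lemma sub_adj S x : {subset S <= adj S x}.
Proof.
move=> y yS; apply/adjP; exists y%:P, 1.
by rewrite polyOverC rpred1 !hornerE oner_eq0 divr1.
Qed.

Lemma mem_adj S x : x \in adj S x.
Proof.
by apply/adjP; exists 'X, 1; rewrite polyOverX rpred1 !hornerE oner_eq0 divr1.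
Qed.

Lemma adj_sub S T x : {subset S <= T} -> x \in T -> {subset adj S x <= T}.
Proof.
move=> sST xT y /adjP[p [q [pS qS _ ->]]].
by rewrite rpred_div ?rpred_horner // (polyOverS sST).
Qed.

(* S(v 0, ..., v (n - 1)) *)
Fixpoint tower S (v : nat -> F) n : divringClosed F :=
  if n is n'.+1 then adj (tower S v n') (v n') else S.

Lemma sub_tower S v m n : (m <= n)%N -> {subset tower S v m <= tower S v n}.
Proof.
elim: n => [|n IHn]; first by rewrite leqn0 => /eqP->.
rewrite leq_eqVlt => /predU1P[-> // | /IHn sub x /sub /=].
exact: sub_adj.
Qed.

Lemma mem_tower S v i n : (i < n)%N -> v i \in tower S v n.
Proof. by move=> lt_in; apply: (sub_tower lt_in (mem_adj (tower S v i) (v i))). Qed.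

Lemma base_tower S v n : {subset S <= tower S v n}.
Proof. exact: (@sub_tower S v 0 n). Qed.

Lemma tower_sub S T v n : {subset S <= T} -> (forall i, (i < n)%N -> v i \in T) ->
  {subset tower S v n <= T}.
Proof.
move=> sST; elim: n => [|n IHn] vT //=; apply: adj_sub; last exact: vT.
by apply: IHn => i lt_in; apply/vT/ltnW.
Qed.

Definition alg S x := exists p, [/\ p \is a polyOver S, p != 0 & root p x].

Lemma algS S T x : {subset S <= T} -> alg S x -> alg T x.
Proof. by move=> sST [p [pS nz_p px0]]; exists p; rewrite (polyOverS sST). Qed.

Lemma alg_minpoly S x : alg S x -> exists p, [/\ p \is a polyOver S, p \is monic,
  root p x & forall q, q \is a polyOver S -> root q x -> (size q < size p)%N -> q = 0].
Proof.
move=> [p0 [p0S nz_p0 p0x]].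
pose P n := `[< exists p, [/\ p \is a polyOver S, p != 0, root p x & size p = n] >].
have exP : exists n, P n by exists (size p0); apply/asboolP; exists p0.
case: (ex_minnP exP) => n /asboolP[p [pS nz_p px0 szp]] n_min.
exists ((lead_coef p)^-1 *: p).
have nz_lp : lead_coef p != 0 by rewrite lead_coef_eq0.
split.
- by rewrite polyOverZ // rpredV; apply: (polyOverP pS).
- by rewrite monicE lead_coefZ mulVf.
- by rewrite rootZ ?invr_eq0.
- move=> q qS qx0; rewrite size_scale ?invr_eq0 // szp => lt_qp.
  apply: contraTeq lt_qp => nz_q; rewrite -leqNgt n_min //.
  by apply/asboolP; exists q.
Qed.

(** With [f.[x] = p.[x] / q.[x]], the polynomial [f * q - p] over [T] vanishes at [x], hence is
    zero; so [lead_coef f] is a quotient of two leading coefficients over [S]. This is how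
    coefficients of the [P i] are read off a membership in a smaller field. *)
Lemma lead_coef_transcendental S T x f : {subset S <= T} -> ~ alg T x ->
  f \is a polyOver T -> f.[x] \in adj S x -> lead_coef f \in S.
Proof.
move=> sST tr_x fT /adjP[p [q [pS qS nz_qx fx]]].
have nz_q : q != 0 by apply: contraNneq nz_qx => ->; rewrite horner0.
have fqp : f * q = p.
  apply/eqP; rewrite -subr_eq0; apply/eqP; apply: contrapT => /eqP nz_d.
  apply: tr_x; exists (f * q - p); split => //.
    by rewrite rpredB ?rpredM // ?(polyOverS sST).
  by rewrite /root !hornerE fx divfK ?subrr.
have: lead_coef p / lead_coef q \in S by rewrite rpred_div //; apply: (polyOverP _).
by rewrite -fqp lead_coefM mulfK // lead_coef_eq0.
Qed.

(* The first [v j] that is algebraic over its predecessors: induction on n, with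
   P read as a polynomial in the last variable. *)
Lemma alg_mpoly (K : fieldType) (iota : {rmorphism K -> F}) S
    (v : nat -> F) n (P : mpoly n K) :
    (forall a, iota a \in S) -> P != 0 -> mmap iota (fun i : 'I_n => v i) P = 0 ->
  exists2 j, (j < n)%N & alg (tower S v j) (v j).
Proof.
move=> KS; elim: n P => [|n IHn] P nz_P P0.
  have [c nz_c defP] : exists2 c, c != 0 & P = mpolyC 0 c.
    exists (mcoeff mnm0 P).
      apply: contraNneq nz_P => P00; apply/eqP/mpolyP => m.
      by rewrite mcoeff0 -P00; congr (mcoeff _ _); apply/mnmP => -[].
    apply/mpolyP => m; rewrite mcoeffC (_ : m = mnm0) ?eqxx ?mulr1 //.
    by apply/mnmP => -[].
  by move/eqP: P0; rewrite defP mmapC fmorph_eq0 (negPf nz_c).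
pose h := fun i : 'I_n => v i.
pose ev : {rmorphism mpoly n K -> F} := mmap iota h.
pose r (m : multinom n.+1) : multinom n := Multinom [tuple m (widen_ord (leqnSn n) i) | i < n].
have Phorner : (map_poly ev (muni P)).[v n] = 0.
  rewrite -P0 muniE rmorph_sum horner_sum; apply: eq_bigr => m _ /=.
  rewrite -[X in map_poly _ X]mul_polyC rmorphM /= map_polyC map_polyXn hornerM.
  rewrite hornerC hornerXn /ev /= mmapZ mmapX -mulrA; congr (_ * _).
  rewrite /mmap1 big_ord_recr /=; congr (_ * _); apply: eq_bigr => i _.
  by rewrite mnmE.
(* [muni] regroups monomials by their exponent in the last variable; [m] is recovered from [r m] and
   [m ord_max], so no two monomials can cancel. *)
have nz_uP : muni P != 0.
  apply: contra_neq nz_P => uP0; apply/mpolyP => m; rewrite mcoeff0.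
  have := congr1 (fun q : {poly mpoly n K} => mcoeff (r m) q`_(m ord_max)) uP0.
  rewrite coef0 mcoeff0 => <-; rewrite muniE coef_sum raddf_sum /=.
  have -> : mcoeff m P = \sum_(m1 <- msupp P | m1 == m) mcoeff m1 P.
    have [mP | mP] := boolP (m \in msupp P).
      by rewrite -big_filter filter_pred1_uniq ?msupp_uniq // big_seq1.
    rewrite memN_msupp_eq0 // big_seq_cond big1 // => m1 /andP[m1P /eqP m1m].
    by rewrite m1m (negPf mP) in m1P.
  rewrite big_mkcond; apply: eq_bigr => m1 _ /=.
  rewrite coefZ coefXn mulr_natr mcoeffMn mcoeffZ mcoeffX.
  have [->|ne_m] := eqVneq m1 m; first by rewrite !eqxx mulr1.
  have [eq_r|_] := eqVneq (Multinom _) (r m); last by rewrite mulr0 mul0rn.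
  have [eq_max|_] := eqVneq (m ord_max) (m1 ord_max); last by rewrite mulr0n.
  case/eqP: ne_m.
  apply/mnmP => i; case: (unliftP ord_max i) => [j|] -> //.
  have := congr1 (fun M : multinom n => M j) eq_r; rewrite /r !mnmE.
  by congr (m1 _ = m _); apply: val_inj => /=; rewrite /bump leqNgt ltn_ord.
have coefS i : ev (muni P)`_i \in tower S v n.
  rewrite /ev /= /mmap rpred_sum // => m _; rewrite rpredM //.
    exact/(base_tower v n)/KS.
  by apply: rpred_prod => j _; apply/rpredX/mem_tower.
have [evP0 | nz_evP] := eqVneq (map_poly ev (muni P)) 0.
  have nz_c : lead_coef (muni P) != 0 by rewrite lead_coef_eq0.
  have := congr1 (fun q : {poly F} => q`_(size (muni P)).-1) evP0.
  rewrite coef_map coef0 => /(IHn _ nz_c)[j lt_jn alg_j]; exists j => //.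
  exact: ltnW.
exists n => //; exists (map_poly ev (muni P)); split=> //; last exact/eqP.
by apply/(@polyOverP _ (tower S v n)) => i; rewrite coef_map; apply: coefS.
Qed.

End Subfields.

(** * Transcendence degree, by counting monomials *)

Section AlgebraicDependence.
Variables (K F : fieldType) (iota : {rmorphism K -> F}).

Definition range_pred : {pred F} := fun y => `[< exists a, y = iota a >].

Fact range_closed : GRing.divring_closed range_pred.
Proof.
split; first by apply/asboolP; exists 1; rewrite rmorph1.
  by move=> _ _ /asboolP[a ->] /asboolP[b ->]; apply/asboolP; exists (a - b); rewrite rmorphB.
by move=> _ _ /asboolP[a ->] /asboolP[b ->]; apply/asboolP; exists (a / b); rewrite fmorph_div.
Qed.
HB.instance Definition _ := GRing.isDivringClosed.Build F range_pred range_closed.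
Definition fieldRange : divringClosed F := range_pred.

Lemma fieldRangeP y : reflect (exists a, y = iota a) (y \in fieldRange).
Proof. exact: asboolP. Qed.

Lemma mem_fieldRange a : iota a \in fieldRange.
Proof. by apply/fieldRangeP; exists a. Qed.

(* Counting: with denominators cleared, the monomials in the n fractions of degree
   below D in each of them number D^n, and live in a space of polynomials in e < n
   variables whose dimension is O(D^e). *)
Lemma mmap_fraction_dependent e n (g : 'I_e -> F) (A B : 'I_n -> mpoly e K) :
    (e < n)%N -> (forall j, mmap iota g (B j) != 0) ->
  exists2 P : mpoly n K, P != 0
    & mmap iota (fun j => mmap iota g (A j) / mmap iota g (B j)) P = 0.
Proof.
move=> lt_en nz_B; pose ev : {rmorphism mpoly e K -> F} := mmap iota g.
pose c := \max_j maxn (msize (A j)) (msize (B j)).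
(* Chosen so that [D > (n * c + 1) ^ e]: since [b <= D * (n * c + 1)], this gives
   [b ^ e < D ^ (e + 1) <= D ^ n], hence fewer monomials than exponents [al]. *)
pose D := ((n * c).+1 ^ e).+1.
pose b := (n * D * c).+1.
pose T : finType := {ffun 'I_n -> 'I_D}.
pose X : finType := bmultinom e b.
(* The monomial of exponent [al] in the fractions [A j / B j], times the common denominator
   [\prod_j B j ^+ D]. *)
pose G (al : T) := \prod_j (A j ^+ al j * B j ^+ (D - al j)).
have szG al m : mcoeff m (G al) != 0 -> (mdeg m < b)%N.
  rewrite -mcoeff_msupp => /msize_mdeg_lt; rewrite ltnS => lt_m.
  have degM (p q : mpoly e K) : ((msize (p * q)).-1 <= (msize p).-1 + (msize q).-1)%N.
    have [->|nz_p] := eqVneq p 0; first by rewrite mul0r msize0.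
    have [->|nz_q] := eqVneq q 0; first by rewrite mulr0 msize0.
    rewrite msizeM //; move: nz_p nz_q; rewrite -!msize_poly_eq0.
    by case: (msize p) (msize q) => [|k] [|l] //= _ _; rewrite addnS.
  have degX (p : mpoly e K) k : ((msize p).-1 <= c)%N -> ((msize (p ^+ k)).-1 <= k * c)%N.
    move=> le_p; elim: k => [|k IHk]; first by rewrite expr0 msize1.
    by rewrite exprS mulSn; apply: leq_trans (degM _ _) (leq_add le_p IHk).
  have degG : ((msize (G al)).-1 <= \sum_(j < n) D * c)%N.
    apply: (big_ind2 (fun p k => (msize p).-1 <= k)%N); first by rewrite msize1.
      by move=> p1 k1 p2 k2 le1 le2; apply: leq_trans (degM _ _) (leq_add le1 le2).
    move=> j _; apply: leq_trans (degM _ _) _.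
    rewrite -[in leqRHS](subnKC (ltnW (ltn_ord (al j)))) mulnDl.
    have le_c : (maxn (msize (A j)) (msize (B j)) <= c)%N by exact: leq_bigmax.
    apply: leq_add; apply: degX; apply: leq_trans (leq_pred _) (leq_trans _ le_c).
      exact: leq_maxl.
    exact: leq_maxr.
  move: degG; rewrite sum_nat_const card_ord mulnA; apply: leq_trans.
  by rewrite -ltnS prednK //; apply: leq_ltn_trans lt_m.
have lt_card : (#|X| < #|T|)%N.
  have cardX : (#|X| <= b ^ e)%N.
    pose to (m : X) : {ffun 'I_e -> 'I_b} := [ffun i => inord (bmnm m i)].
    suff /leq_card : injective to by rewrite card_ffun !card_ord.
    move=> m1 m2 /ffunP eq_m; apply/val_inj/mnmP => i.
    have le_deg (m : X) : (bmnm m i < b)%N.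
      by apply: leq_ltn_trans (bmdeg m); rewrite mdegE (bigD1 i) //= leq_addr.
    by have := congr1 val (eq_m i); rewrite !ffunE /= !inordK.
  apply: leq_ltn_trans cardX _; rewrite card_ffun !card_ord.
  have le_b : (b <= D * (n * c).+1)%N.
    by rewrite /b mulnS mulnAC [(n * c * D)%N]mulnC -addn1 addnC leq_add2r.
  apply: (leq_ltn_trans (n := ((D * (n * c).+1) ^ e))).
    by case: (e) => // e'; rewrite leq_exp2r.
  rewrite expnMn; apply: (@leq_trans (D ^ e.+1)); last by rewrite leq_pexp2l.
  by rewrite expnSr ltn_pmul2l ?expn_gt0.
pose M : 'M[K]_(#|T|, #|X|) := \matrix_(i, j) mcoeff (bmnm (enum_val j)) (G (enum_val i)).
(* [M] has more rows than columns, and a nonzero row vector killed by it is a linear relation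
   between the [G al]. *)
have : kermx M != 0.
  rewrite -mxrank_eq0 mxrank_ker subn_eq0 -ltnNge.
  exact: leq_ltn_trans (rank_leq_col _) lt_card.
case/rowV0Pn => v /sub_kermxP vM0 nz_v.
pose mon (al : T) : multinom n := Multinom [tuple (al j : nat) | j < n].
have mon_inj : injective mon.
  move=> al1 al2 /mnmP eq_al; apply/ffunP => j; apply: val_inj.
  by have := eq_al j; rewrite !mnmE.
pose P := \sum_al v 0 (enum_rank al) *: mpolyX K (mon al).
exists P.
  have [i nz_vi] : exists i, v 0 i != 0.
    apply: contrapT => no_i; case/eqP: nz_v; apply/rowP => i; rewrite mxE.
    by apply: contrapT => /eqP nz_vi; apply: no_i; exists i.
  apply: contraNneq nz_vi => /(congr1 (mcoeff (mon (enum_val i)))).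
  rewrite mcoeff0 raddf_sum /= (bigD1 (enum_val i)) //= big1 => [|al ne_al].
    by rewrite addr0 mcoeffZ mcoeffX eqxx mulr1 enum_valK => ->.
  by rewrite mcoeffZ mcoeffX (inj_eq mon_inj) (negPf ne_al) mulr0.
have sumG : \sum_al v 0 (enum_rank al) *: G al = 0.
  apply/mpolyP => m; rewrite mcoeff0 raddf_sum /=.
  have [le_bm | lt_mb] := leqP b (mdeg m).
    apply: big1 => al _; rewrite mcoeffZ.
    have [->|/szG] := eqVneq (mcoeff m (G al)) 0; first by rewrite mulr0.
    by rewrite ltnNge le_bm.
  have := congr1 (fun W : 'rV_#|X| => W 0 (enum_rank (BMultinom lt_mb))) vM0.
  rewrite !mxE => vM; rewrite -[RHS]vM (reindex _ (onW_bij _ (@enum_val_bij T))) /=.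
  by apply: eq_bigr => i _; rewrite mcoeffZ enum_valK !mxE enum_rankK.
have nz_Bs : \prod_j ev (B j) ^+ D != 0.
  by apply/prodf_neq0 => j _; apply/expf_neq0/nz_B.
apply: (mulIf nz_Bs); rewrite mul0r -[RHS](rmorph0 ev) -sumG /P !rmorph_sum mulr_suml /=.
apply: eq_bigr => al _; rewrite !mmapZ mmapX -mulrA; congr (_ * _).
rewrite /mmap1 -big_split rmorph_prod /=; apply: eq_bigr => j _.
rewrite mnmE rmorphM !rmorphXn /= expr_div_n -mulrA; congr (_ * _).
have powB (x : F) k : x != 0 -> (k <= D)%N -> x ^- k * x ^+ D = x ^+ (D - k).
  by move=> nz_x le_kD; rewrite -{1}(subnK le_kD) exprD mulrCA mulVf ?mulr1 ?expf_neq0.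
exact: powB (nz_B j) (ltnW (ltn_ord (al j))).
Qed.

Section Fractions.
Variables (e : nat) (g : 'I_e -> F).

Definition fractions_pred : {pred F} := fun y =>
  `[< exists AB : mpoly e K * mpoly e K,
        mmap iota g AB.2 != 0 /\ y = mmap iota g AB.1 / mmap iota g AB.2 >].

Fact fractions_closed : GRing.divring_closed fractions_pred.
Proof.
pose ev : {rmorphism mpoly e K -> F} := mmap iota g.
have evE p : mmap iota g p = ev p by [].
split.
- apply/asboolP; exists (1, 1); rewrite !evE !rmorph1 divr1; split=> //.
  exact: oner_neq0.
- move=> _ _ /asboolP[[A1 B1] /= [nz1 ->]] /asboolP[[A2 B2] /= [nz2 ->]].
  apply/asboolP; exists (A1 * B2 - A2 * B1, B1 * B2) => /=.
  rewrite !evE in nz1 nz2 *; rewrite rmorphB !rmorphM mulf_neq0 //; split=> //.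
  by field; apply/andP.
- move=> _ _ /asboolP[[A1 B1] /= [nz1 ->]] /asboolP[[A2 B2] /= [nz2 ->]].
  rewrite !evE in nz1 nz2 *.
  have [-> | nzA] := eqVneq (ev A2) 0.
    rewrite mul0r invr0 mulr0; apply/asboolP; exists (0, 1) => /=.
    by rewrite !evE rmorph0 rmorph1 oner_neq0 mul0r.
  apply/asboolP; exists (A1 * B2, B1 * A2) => /=.
  rewrite !evE !rmorphM mulf_neq0 //; split=> //.
  by field; apply/and3P.
Qed.
HB.instance Definition _ := GRing.isDivringClosed.Build F fractions_pred fractions_closed.
Definition fractions : divringClosed F := fractions_pred.

End Fractions.

(** The field generated by [g 0, ..., g (e - 1)] has transcendence degree at most [e]: its elements
    are [fractions] of polynomials in the [g i], to which the counting applies. *)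
Lemma tower_alg_dependent e n (g f : nat -> F) : (e < n)%N ->
    (forall j, (j < n)%N -> f j \in tower fieldRange g e) ->
  exists2 P : mpoly n K, P != 0 & mmap iota (fun j : 'I_n => f j) P = 0.
Proof.
move=> lt_en f_in; pose h := fun i : 'I_e => g i.
pose ev : {rmorphism mpoly e K -> F} := mmap iota h.
have evE p : mmap iota h p = ev p by [].
have sub : {subset tower fieldRange g e <= fractions h}.
  apply: tower_sub => [y /fieldRangeP[a ->]|i lt_ie].
    apply/asboolP; exists (mpolyC e a, 1) => /=.
    by rewrite !evE rmorph1 oner_neq0 divr1 -evE mmapC.
  apply/asboolP; exists (mpolyX K (mnm1 (Ordinal lt_ie)), 1) => /=.
  by rewrite !evE rmorph1 oner_neq0 divr1 -evE mmapX mmap1U.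
have /choice[AB fAB] (j : 'I_n) : exists AB : mpoly e K * mpoly e K,
    mmap iota h AB.2 != 0 /\ f j = mmap iota h AB.1 / mmap iota h AB.2.
  by have /sub/asboolP := f_in j (ltn_ord j).
have [P nz_P P0] := @mmap_fraction_dependent e n h (fun j => (AB j).1)
  (fun j => (AB j).2) lt_en (fun j => (fAB j).1).
exists P => //; rewrite -P0; congr (mmap _ _ _); apply/funext => j.
exact: (fAB j).2.
Qed.

End AlgebraicDependence.

(** * Derivations *)

Definition derivation (A : nzRingType) (D : A -> A) : Prop :=
  {morph D : x y / x + y} /\ forall x y, D (x * y) = D x * y + x * D y.

Section RingDerivations.
Variables (A : nzRingType) (D : A -> A).
Hypothesis derD : derivation D.

Lemma derivation0 : D 0 = 0.
Proof. by apply: (addIr (D 0)); rewrite -derD.1 !add0r. Qed.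

Lemma derivation1 : D 1 = 0.
Proof. by apply: (addIr (D 1)); rewrite -{1}[D 1]mulr1 -[X in _ + X]mul1r -derD.2 mulr1 add0r. Qed.

Lemma derivationB x y : D (x - y) = D x - D y.
Proof. by apply: (addIr (D y)); rewrite -derD.1 !subrK. Qed.

Lemma derivation_sum I (r : seq I) (P : pred I) f :
  D (\sum_(i <- r | P i) f i) = \sum_(i <- r | P i) D (f i).
Proof. exact: (big_morph D derD.1 derivation0). Qed.

End RingDerivations.

Section Derivations.
Variables (F : fieldType) (D : F -> F).
Hypothesis derD : derivation D.
Let DD := derD.1.
Let DM := derD.2.
Let D0 := derivation0 derD.
Implicit Types (S T : divringClosed F) (x y : F) (p q : {poly F}).

Lemma derivation_div x y : y != 0 -> D (x / y) = (D x * y - x * D y) / y ^+ 2.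
Proof.
move=> nz_y; have /(congr1 D) := divfK nz_y x; rewrite DM => Dx.
by rewrite -[in RHS]Dx; field.
Qed.

Lemma derivation_horner p x :
  D p.[x] = (map_poly D p).[x] + p^`().[x] * D x.
Proof.
elim/poly_ind: p => [|p c IHp].
  by rewrite map_poly0 deriv0 !horner0 D0 mul0r addr0.
have -> : map_poly D (p * 'X + c%:P) = map_poly D p * 'X + (D c)%:P.
  apply/polyP => -[|i]; rewrite (coef_map_id0 _ _ D0) !coefD !coefMX !coefC /=.
    by rewrite !add0r.
  by rewrite !addr0 (coef_map_id0 _ _ D0).
rewrite derivD derivM derivC derivX !hornerE DD DM IHp.
by ring.
Qed.

Lemma polyOver_derivation S T p : {in S, forall y, D y \in T} ->
  p \is a polyOver S -> map_poly D p \is a polyOver T.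
Proof.
move=> DS pS; apply/polyOverP => i; rewrite (coef_map_id0 _ _ D0).
exact/DS/(polyOverP pS).
Qed.

Lemma derivation_adj S T x : {subset S <= T} -> {in S, forall y, D y \in T} ->
  x \in T -> D x \in T -> {in adj S x, forall y, D y \in T}.
Proof.
move=> sST DS xT DxT _ /adjP[p [q [pS qS nz_q ->]]].
have inT r : r \is a polyOver S -> (r.[x] \in T) /\ (D r.[x] \in T).
  move=> rS; have rT := polyOverS sST rS.
  split; first exact: rpred_horner.
  rewrite derivation_horner rpredD ?rpredM // ?rpred_horner ?polyOver_deriv //.
  exact: polyOver_derivation rS.
have [[pT DpT] [qT DqT]] := (inT p pS, inT q qS).
by rewrite derivation_div // rpred_div ?rpredX // rpredB ?rpredM.
Qed.

Lemma derivation_tower S T v n : {subset S <= T} -> {in S, forall y, D y \in T} ->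
    (forall i, (i < n)%N -> v i \in T /\ D (v i) \in T) ->
  {in tower S v n, forall y, D y \in T}.
Proof.
move=> sST DS; elim: n => [|n IHn] vT //=.
have vT' i : (i < n)%N -> v i \in T /\ D (v i) \in T by move/ltnW/vT.
apply: derivation_adj; first by apply: tower_sub => // i /vT'[].
- exact: IHn.
- by case: (vT n).
- by case: (vT n).
Qed.

Section IteratedDerivatives.
Variables (S : divringClosed F) (x : F).
Let v i := iter i D x.
Hypothesis DS : {in S, forall y, D y \in tower S v 1}.

(** [DS] asks for [D S] inside [S(x)] only: the derivation [delta = Psi D] sends [E] into [E(Psi)],
    not into [E]. *)
Lemma derivation_tower_iter n : {in tower S v n, forall y, D y \in tower S v n.+1}.
Proof.
apply: derivation_tower => [|y yS|i lt_in]; first exact: base_tower.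
  exact: (sub_tower _ (DS yS)).
by split; [apply/mem_tower/ltnW | apply: (@mem_tower _ S v i.+1)].
Qed.

(** Differentiating [p (v n) = 0] for the minimal polynomial [p] expresses [v n.+1] as minus the
    value at [v n] of the polynomial with differentiated coefficients, divided by [p' (v n)]. All
    higher derivatives then stay in the tower. *)
Hypothesis char0 : forall n, n.+1%:R != 0 :> F.

Lemma tower_differentially_closed n : alg (tower S v n) (v n) ->
  {in tower S v n.+1, forall y, D y \in tower S v n.+1}.
Proof.
case/alg_minpoly => p [pS mon_p px0 p_min].
have sTT : {subset tower S v n <= tower S v n.+1} by apply: sub_tower.
have vn : v n \in tower S v n.+1 by apply: mem_tower.
(* Otherwise [p'] would be zero by minimality of [p], whereas its top coefficient is the degree of
   the monic [p], nonzero in characteristic 0. *)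
have nz_p' : p^`().[v n] != 0.
  apply/negP => p'x0; have nz_p : p != 0 by apply: monic_neq0.
  have p'0 : p^`() = 0 by apply: p_min; rewrite ?polyOver_deriv ?lt_size_deriv.
  have sz_p : (1 < size p)%N by apply: root_size_gt1 nz_p px0.
  have lead1 : p`_(size p).-1 = 1 by rewrite -lead_coefE; apply/monicP.
  have : p^`()`_(size p).-2 = 0 by rewrite p'0 coef0.
  rewrite coef_deriv; move: lead1 sz_p; case: (size p) => [|[|k]] //= -> _ /eqP.
  exact/negP/char0.
have Dvn : v n.+1 \in tower S v n.+1.
  have := derivation_horner p (v n); rewrite (rootP px0) D0 => /esym/eqP.
  rewrite addr_eq0 => /eqP Dv.
  have -> : v n.+1 = - (map_poly D p).[v n] / p^`().[v n].
    by rewrite Dv opprK mulrC mulKf.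
  have DpT := polyOver_derivation (derivation_tower_iter (n := n)) pS.
  by rewrite rpred_div ?rpredN ?rpred_horner // ?polyOver_deriv ?(polyOverS sTT).
apply: derivation_tower => [|y yS|i]; first exact: base_tower.
  exact: (sub_tower _ (DS yS)).
rewrite ltnS leq_eqVlt => /predU1P[-> // | lt_in].
by split; [apply/mem_tower/ltnW | apply: (@mem_tower _ S v i.+1)].
Qed.

End IteratedDerivatives.
End Derivations.

(** * Ostrowski's theorem for difference equations *)

Lemma coef_comp_XaddC (R : comNzRingType) (p : {poly R}) b d : (size p <= d.+2)%N ->
  (p \Po ('X + b%:P))`_d.+1 = p`_d.+1 /\
  (p \Po ('X + b%:P))`_d = p`_d + b * p`_d.+1 *+ d.+1.
Proof.
have size_exp_XaddC n : size (('X + b%:P) ^+ n) = n.+1.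
  by rewrite -[b]opprK polyCN size_exp_XsubC.
have lead n : (('X + b%:P) ^+ n)`_n = 1.
  have /monicP := monic_exp n (monicXaddC b).
  by rewrite lead_coefE size_exp_XaddC.
have sub n : (('X + b%:P) ^+ n.+1)`_n = b *+ n.+1.
  elim: n => [|n IHn]; first by rewrite expr1 coefD coefX coefC add0r.
  by rewrite exprSr mulrDr coefD coefMX coefMC /= IHn lead mul1r -mulrSr.
move=> le_pd.
have compE : p \Po ('X + b%:P) = \sum_(i < d.+2) p`_i *: ('X + b%:P) ^+ i.
  rewrite comp_polyE (big_ord_widen _ (fun i => p`_i *: ('X + b%:P) ^+ i) le_pd).
  rewrite big_mkcond; apply: eq_bigr => i _; case: ltnP => // le_pi.
  by rewrite nth_default // scale0r.
have small k n : (n <= k)%N -> (\sum_(i < n) p`_i *: ('X + b%:P) ^+ i)`_k = 0.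
  move=> le_nk; rewrite coef_sum big1 // => i _; rewrite coefZ.
  have /leq_sizeP -> // : (size (('X + b%:P) ^+ i) <= k)%N; last by rewrite mulr0.
  by rewrite size_exp_XaddC (leq_trans (ltn_ord i)).
rewrite compE !big_ord_recr /= !coefD !small // !coefZ !lead sub.
have /leq_sizeP -> // : (size (('X + b%:P) ^+ d) <= d.+1)%N by rewrite size_exp_XaddC.
rewrite mulr0 !add0r !mulr1 mulrnAr.
by rewrite [b * _]mulrC.
Qed.

Lemma rmorphism_tower (F : fieldType) (Phi : {rmorphism F -> F}) (S T : divringClosed F)
    (v : nat -> F) n :
    {in S, forall y, Phi y \in T} -> (forall i, (i < n)%N -> Phi (v i) \in T) ->
  {in tower S v n, forall y, Phi y \in T}.
Proof.
move=> PhiS; elim: n => [|n IHn] PhiT //= _ /adjP[p [q [pS qS nz_q ->]]].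
have inT r : r \is a polyOver (tower S v n) -> Phi r.[v n] \in T.
  move=> rS; rewrite -horner_map rpred_horner ?PhiT //.
  apply/(@polyOverP _ T) => i; rewrite coef_map; apply: IHn; last exact: (polyOverP rS).
  by move=> j /ltnW/PhiT.
by rewrite fmorph_div rpred_div ?inT.
Qed.

Section Ostrowski.
Variables (F : fieldType) (Phi : {rmorphism F -> F}).
Hypothesis char0 : forall n, n.+1%:R != 0 :> F.
Implicit Types (G : divringClosed F) (v x b : F) (p q : {poly F}).

(** The polynomial counterpart of [Phi y - y], for [y = p.[v]] and [Phi v = v + b]. *)
Definition shift_diff b p := map_poly Phi p \Po ('X + b%:P) - p.

(** The top coefficient 1 is left unchanged by [Phi] and by the shift, so it cancels. *)
Lemma size_shift_diff_monic b p : p \is monic -> (size (shift_diff b p) < size p)%N.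
Proof.
move=> mon_p; have sz_q : size (map_poly Phi p \Po ('X + b%:P)) = size p.
  by rewrite size_comp_poly2 ?size_XaddC ?size_map_poly.
have sz_p : (0 < size p)%N by rewrite size_poly_gt0 monic_neq0.
have mon_q : map_poly Phi p \Po ('X + b%:P) \is monic.
  by rewrite monicE lead_coef_comp ?size_XaddC // lead_coefXaddC expr1n mulr1
     -monicE map_monic.
rewrite -(ltn_predK sz_p) ltnS; apply/leq_sizeP => j.
rewrite leq_eqVlt coefB => /predU1P[<-|].
  by rewrite -{1}sz_q -!lead_coefE (monicP mon_p) (monicP mon_q) subrr.
by rewrite (ltn_predK sz_p) => le_pj; rewrite !nth_default ?sz_q ?subrr.
Qed.

Lemma horner_shift_diff b p v : Phi v = v + b ->
  (shift_diff b p).[v] = Phi p.[v] - p.[v].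
Proof. by move=> Phiv; rewrite !hornerE horner_comp !hornerE -Phiv horner_map. Qed.

Section OverField.
Variables (G : divringClosed F) (v b : F).
Hypotheses (PhiG : {in G, forall y, Phi y \in G}) (fixG : forall y, Phi y = y -> y \in G).
Hypotheses (Phiv : Phi v = v + b) (bG : b \in G).

Lemma polyOver_shift_diff p : p \is a polyOver G -> shift_diff b p \is a polyOver G.
Proof.
move=> pG; rewrite rpredB // polyOver_comp ?rpredD ?polyOverX ?polyOverC //.
by apply/(@polyOverP _ G) => i; rewrite coef_map; apply/PhiG/(polyOverP pG).
Qed.

(* The two top coefficients c and e of p give the fixed element c (deg p) v + e. *)
Lemma small_shift_diff p : p \is a polyOver G -> (1 < size p)%N ->
  (size (shift_diff b p) < (size p).-1)%N -> v \in G.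
Proof.
move=> pG; case sz_p : (size p) => [|[|d]] //= _ sz_d.
have sz_q : (size (map_poly Phi p) <= d.+2)%N by rewrite size_map_poly sz_p.
have [] := coef_comp_XaddC b sz_q; rewrite !coef_map.
have /leq_sizeP diff0 : (size (shift_diff b p) <= d)%N by [].
have coefE i : (d <= i)%N -> (map_poly Phi p \Po ('X + b%:P))`_i = p`_i.
  by move=> /diff0 /eqP; rewrite coefB subr_eq0 => /eqP.
rewrite !coefE // => /esym Phi_c; rewrite Phi_c => p_d.
have nz_c : p`_d.+1 != 0 by have := lead_coef_eq0 p; rewrite lead_coefE -size_poly_eq0 sz_p => ->.
have fixG_u : p`_d.+1 * v *+ d.+1 + p`_d \in G.
  apply: fixG; rewrite rmorphD rmorphMn rmorphM /= Phi_c Phiv {2}p_d.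
  by rewrite mulrDr mulrnDl [b * _]mulrC -!addrA [_ *+ _ + Phi _]addrC.
have -> : v = (p`_d.+1 * v *+ d.+1 + p`_d - p`_d) / (p`_d.+1 *+ d.+1).
  rewrite addrK -mulrnAl mulrC mulKf //.
  by rewrite -mulr_natr mulf_neq0.
have pdG i : p`_i \in G by apply: (polyOverP pG).
by rewrite rpred_div ?rpredMn ?rpredB.
Qed.

(** For the minimal polynomial [p] of [v], [shift_diff b p] vanishes at [v] and has smaller size,
    hence is zero; [small_shift_diff] then applies. *)
Lemma algebraic_additive_solution : alg G v -> v \in G.
Proof.
case/alg_minpoly => p [pG mon_p pv0 p_min].
have sz_p : (1 < size p)%N by apply: root_size_gt1 pv0; apply: monic_neq0.
have diff0 : shift_diff b p = 0.
  apply: p_min; [exact: polyOver_shift_diff | | exact: size_shift_diff_monic].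
  by rewrite /root (horner_shift_diff _ Phiv) (rootP pv0) rmorph0 subrr.
by apply: (small_shift_diff pG sz_p); rewrite diff0 size_poly0 -subn1 subn_gt0.
Qed.

(* A denominator of x of minimal degree in v is invariant under the shift of v by b,
   hence constant; x is then a polynomial in v, of degree at most 1. *)
Lemma transcendental_additive_solution x : ~ alg G v -> x \in adj G v ->
  Phi x - x \in G -> exists2 c, Phi c = c & x - c * v \in G.
Proof.
move=> tr_v /adjP[p0 [q0 [p0G q0G nz_q0 x_eq]]] bxG; set be := Phi x - x in bxG.
have tr_eq p q : p \is a polyOver G -> q \is a polyOver G -> p.[v] = q.[v] -> p = q.
  move=> pG qG eq_pq; apply/eqP; rewrite -subr_eq0; apply: contrapT => /negP nz_d.
  by apply: tr_v; exists (p - q); rewrite rpredB // /root !hornerE eq_pq subrr.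
have v_notin : v \notin G.
  apply/negP => vG; apply: tr_v; exists ('X - v%:P).
  by rewrite polyOverXsubC polyXsubC_eq0 root_XsubC.
pose den q := [/\ q \is a polyOver G, q != 0
  & exists2 p, p \is a polyOver G & x * q.[v] = p.[v]].
have ex_n : exists n, `[< exists2 q, den q & size q = n >].
  exists (size q0); apply/asboolP; exists q0 => //; split=> //.
    by apply: contraNneq nz_q0 => ->; rewrite horner0.
  by exists p0; rewrite // x_eq divfK.
case: (ex_minnP ex_n) => n /asboolP[q1 [q1G nz_q1 [p1 p1G x_q1]] sz_q1] n_min.
have nz_l : (lead_coef q1)^-1 != 0 by rewrite invr_eq0 lead_coef_eq0.
have lG : (lead_coef q1)^-1 \in G by rewrite rpredV; apply: (polyOverP q1G).
pose q : {poly F} := (lead_coef q1)^-1 *: q1; pose p : {poly F} := (lead_coef q1)^-1 *: p1.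
have qG : q \is a polyOver G by rewrite polyOverZ.
have pG : p \is a polyOver G by rewrite polyOverZ.
have mon_q : q \is monic by rewrite monicE lead_coefZ mulVf // -invr_eq0.
have x_q : x * q.[v] = p.[v] by rewrite !hornerZ mulrCA x_q1.
have diff_q : shift_diff b q = 0.
  apply: contrapT => /eqP nz_diff; have := size_shift_diff_monic b mon_q.
  rewrite size_scale // sz_q1 ltnNge n_min //; apply/asboolP.
  exists (shift_diff b q) => //; split=> //; first exact: polyOver_shift_diff.
  (* The numerator that goes with the denominator [shift_diff b q]: from [Phi x = x + be] one gets
     [x * Phi q.[v] = Phi p.[v] - be * Phi q.[v]], and [shift_diff b q + q] takes the value [Phi
     q.[v]] at [v]. *)
  exists (shift_diff b p - be *: (shift_diff b q + q)).
    have diffG := rpredD (polyOver_shift_diff qG) qG.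
    exact: rpredB (polyOver_shift_diff pG) (polyOverZ bxG diffG).
  have horner_comb (A B : {poly F}) : (A - be *: (B + q)).[v] = A.[v] - be * (B.[v] + q.[v]).
    by rewrite !(hornerD, hornerN, hornerZ).
  rewrite horner_comb !(horner_shift_diff _ Phiv) -x_q rmorphM /= /be.
  by ring.
have q1E : q = 1.
  have [sz_q | sz_q] := leqP (size q) 1.
    by move: mon_q; rewrite (size1_polyC sz_q) monicE lead_coefC => /eqP ->.
  case/negP: v_notin; apply: (small_shift_diff qG sz_q).
  by rewrite diff_q size_poly0 -subn1 subn_gt0.
have x_p : x = p.[v] by rewrite -x_q q1E hornerC mulr1.
have diff_p : shift_diff b p = be%:P.
  apply: tr_eq; [exact: polyOver_shift_diff | by rewrite polyOverC |].
  by rewrite (horner_shift_diff _ Phiv) hornerC -x_p.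
have sz_p : (size p <= 2)%N.
  rewrite leqNgt; apply: contra v_notin => sz_p.
  apply: (small_shift_diff pG (ltnW sz_p)); rewrite diff_p.
  by apply: leq_ltn_trans (size_polyC_leq1 _) _; rewrite -subn1 ltn_subRL.
have p_E : p = p`_1 *: 'X + (p`_0)%:P.
  apply/polyP => -[|[|i]]; rewrite coefD coefZ coefX coefC /= ?mulr0 ?mulr1 ?addr0 ?add0r //.
  by rewrite nth_default // (leq_trans sz_p).
(* The slope is fixed by [Phi], because [shift_diff b p] is the constant [be] and so has no
   coefficient in degree 1. *)
exists p`_1.
  have szPp : (size (map_poly Phi p) <= 2)%N by rewrite size_map_poly.
  have [c_eq _] := coef_comp_XaddC b szPp.
  have := congr1 (fun r : {poly F} => r`_1) diff_p; rewrite coefB c_eq coef_map coefC /=.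
  by move/eqP; rewrite subr_eq0 => /eqP.
rewrite x_p {1}p_E !hornerE [_ * v + _]addrC addrK.
exact: (polyOverP pG).
Qed.

End OverField.

(* Kolchin and Ostrowski: algebraic relations between solutions of
   [Phi v - v \in k] come from linear ones. *)
Section Tower.
Variables (k : divringClosed F) (v : nat -> F).
Hypotheses (Phik : {in k, forall y, Phi y \in k}) (fixk : forall y, Phi y = y -> y \in k).

Definition linear_relation n := exists c : nat -> F, [/\ forall i, Phi (c i) = c i,
  exists2 i, (i < n)%N & c i != 0 & \sum_(i < n) c i * v i \in k].

Lemma tower_Phi n : (forall i, (i < n)%N -> Phi (v i) - v i \in k) ->
  {in tower k v n, forall y, Phi y \in tower k v n}.
Proof.
move=> bk; apply: rmorphism_tower => [y /Phik|i lt_in]; first exact: base_tower.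
rewrite -[Phi _](subrK (v i)) rpredD ?mem_tower //.
exact/base_tower/bk.
Qed.

Let extend n (c0 : F) (c : nat -> F) i := if i == n then c0 else c i.

Let extendP n c0 c : Phi c0 = c0 -> (forall i, Phi (c i) = c i) ->
  forall i, Phi (extend n c0 c i) = extend n c0 c i.
Proof. by rewrite /extend => c0P cP i; case: eqP. Qed.

Let sum_extend n c0 c :
  \sum_(i < n.+1) extend n c0 c i * v i = \sum_(i < n) c i * v i + c0 * v n.
Proof.
rewrite big_ord_recr /= /extend eqxx; congr (_ + _); apply: eq_bigr => i _.
by rewrite (ltn_eqF (ltn_ord i)).
Qed.

Lemma linear_relationS n : linear_relation n -> linear_relation n.+1.
Proof.
case=> c [cP [i lt_in nz_c] c_in]; exists (extend n 0 c).
split; first by apply: extendP; rewrite ?rmorph0.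
  by exists i; [exact: ltnW | rewrite /extend (ltn_eqF lt_in)].
by rewrite sum_extend mul0r addr0.
Qed.

Lemma linear_relation_span n (c : nat -> F) : (forall i, Phi (c i) = c i) ->
  v n - \sum_(i < n) c i * v i \in k -> linear_relation n.+1.
Proof.
move=> cP c_in; exists (extend n (-1) c); split.
- by apply: extendP; rewrite ?rmorphN1.
- by exists n; rewrite // /extend eqxx oppr_eq0 oner_neq0.
- by rewrite sum_extend mulN1r -rpredN opprB.
Qed.

(** Induction on [n]. If [v n] is algebraic over the earlier ones, it lies in their field, and the
    induction hypothesis applied to [v n] in place of [x] gives a relation. Otherwise some
    [x - c0 * v n] lies in the lower tower and is again an additive solution over [k]. *)
Lemma additive_solution_tower n x : (forall i, (i < n)%N -> Phi (v i) - v i \in k) ->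
    Phi x - x \in k -> x \in tower k v n -> linear_relation n \/
  exists2 c : nat -> F, forall i, Phi (c i) = c i & x - \sum_(i < n) c i * v i \in k.
Proof.
elim: n x => [|n IHn] x bk bx x_in.
  by right; exists (fun=> 0) => [i|]; rewrite ?rmorph0 // big_ord0 subr0.
have bk' i : (i < n)%N -> Phi (v i) - v i \in k by move/ltnW/bk.
have bn := bk n (ltnSn n).
have Phivn : Phi (v n) = v n + (Phi (v n) - v n) by rewrite addrC subrK.
have PhiT := tower_Phi bk'; have fixT y : Phi y = y -> y \in tower k v n.
  by move/fixk; apply: base_tower.
have bT : Phi (v n) - v n \in tower k v n by apply: base_tower.
have bxT : Phi x - x \in tower k v n by apply: base_tower.
have [alg_v | tr_v] := pselect (alg (tower k v n) (v n)).
  have vn_in := algebraic_additive_solution PhiT fixT Phivn bT alg_v.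
  left; have [/linear_relationS // | [c cP c_in]] := IHn _ bk' bn vn_in.
  exact: linear_relation_span cP c_in.
have [c0 c0P x_in'] := transcendental_additive_solution PhiT fixT Phivn bT tr_v x_in bxT.
have bx' : Phi (x - c0 * v n) - (x - c0 * v n) \in k.
  have -> : Phi (x - c0 * v n) - (x - c0 * v n) = Phi x - x - c0 * (Phi (v n) - v n).
    by rewrite rmorphB rmorphM /= c0P; ring.
  by rewrite rpredB ?rpredM // fixk.
have [/linear_relationS | [c cP c_in]] := IHn _ bk' bx' x_in'; [by left | right].
exists (extend n c0 c); first exact: extendP.
by rewrite sum_extend opprD addrA addrAC.
Qed.

Lemma algebraic_relation_linear n : (forall i, (i <= n)%N -> Phi (v i) - v i \in k) ->
  alg (tower k v n) (v n) -> linear_relation n.+1.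
Proof.
move=> bk alg_v.
have bk' i : (i < n)%N -> Phi (v i) - v i \in k by move/ltnW/bk.
have bn := bk n (leqnn n).
have Phivn : Phi (v n) = v n + (Phi (v n) - v n) by rewrite addrC subrK.
have PhiT := tower_Phi bk'; have fixT y : Phi y = y -> y \in tower k v n.
  by move/fixk; apply: base_tower.
have bT : Phi (v n) - v n \in tower k v n by apply: base_tower.
have vn_in := algebraic_additive_solution PhiT fixT Phivn bT alg_v.
have [/linear_relationS // | [c cP c_in]] := additive_solution_tower bk' bn vn_in.
exact: linear_relation_span cP c_in.
Qed.

End Tower.
End Ostrowski.

(** * Rationality of the logarithmic derivative *)

Section LogarithmicDerivative.
Variables (K F : fieldType) (iota : {rmorphism K -> F}) (D : F -> F)
  (Phi : {rmorphism F -> F}) (rho : K).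
Hypothesis char0 : forall n, n.+1%:R != 0 :> F.
Hypothesis derD : derivation D.
Hypothesis D_iota : forall a, D (iota a) \in fieldRange iota.
Hypothesis Phi_iota : forall a, Phi (iota a) \in fieldRange iota.
Hypothesis chain_rule : forall g, D (Phi g) = iota rho * Phi (D g).
Hypothesis Phi_fixed : forall g, Phi g = g -> g \in fieldRange iota.

Variable Psi : F.
Hypothesis Phi_Psi : Phi Psi = iota rho * Psi.
Hypothesis Psi_transcendental : forall n (P : mpoly n.+1 K), P != 0 ->
  mmap iota (fun i : 'I_n.+1 => iter i D Psi) P != 0.

Let D_range : {in fieldRange iota, forall y, D y \in fieldRange iota}.
Proof. by move=> _ /fieldRangeP[a ->]. Qed.

(** The first [e + 1] derivatives of [Psi], lying in a field with [e] generators, would satisfy a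
    polynomial relation. *)
Let finitely_generated e (g : nat -> F) :
  ~ (forall i, iter i D Psi \in tower (fieldRange iota) g e).
Proof.
move=> Psi_in; have [//|P nz_P P0] := @tower_alg_dependent _ _ iota e e.+1 g
  (fun i => iter i D Psi) (ltnSn e).
by case/eqP: (Psi_transcendental nz_P).
Qed.

(* [Psi h] is fixed by Phi, so that Psi would be rational. *)
Lemma invariant_form_eq0 h : iota rho * Phi (iota h) = iota h -> h = 0.
Proof.
move=> h_inv; apply: contrapT => /eqP nz_h.
have /Phi_fixed Psih_in : Phi (Psi * iota h) = Psi * iota h.
  by rewrite rmorphM /= Phi_Psi mulrAC h_inv mulrC.
have Psi_in : Psi \in fieldRange iota.
  have nz_ih : iota h != 0 by rewrite fmorph_eq0.
  by rewrite -(mulfK nz_ih Psi) rpred_div ?mem_fieldRange.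
apply: (@finitely_generated 0%N (fun=> 0)) => i; elim: i => //= i.
exact: D_range.
Qed.

Let nz_Psi : Psi != 0.
Proof.
apply/negP => /eqP Psi0; apply: (@finitely_generated 0%N (fun=> 0)) => i.
suff -> : iter i D Psi = 0 by exact: rpred0.
by rewrite Psi0; elim: i => //= i ->; apply: derivation0.
Qed.

Definition delta x := Psi * D x.

Let der_delta : derivation delta.
Proof.
split=> x y; rewrite /delta; first by rewrite derD.1 mulrDr.
by rewrite derD.2; ring.
Qed.

Lemma Phi_delta x : Phi (delta x) = delta (Phi x).
Proof. by rewrite /delta rmorphM /= Phi_Psi chain_rule; ring. Qed.

Let P i := iter i delta Psi.

Section DeltaTower.
Variable E : divringClosed F.
Hypothesis DE : {in E, forall y, D y \in E}.

Lemma delta_tower n : {in tower E P n, forall y, delta y \in tower E P n.+1}.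
Proof.
apply: derivation_tower_iter => // y yE; rewrite rpredM ?mem_adj //.
exact/sub_adj/DE.
Qed.

(* Otherwise E(P 0, ..., P n) is stable under delta, hence under D, and all the
   derivatives of Psi lie in a finitely generated field. *)
Lemma tower_delta_transcendental e (g : nat -> F) n :
  {subset E <= tower (fieldRange iota) g e} -> ~ alg (tower E P n) (P n).
Proof.
move=> E_fg alg_P.
have DS : {in E, forall y, delta y \in tower E P 1} by apply: (delta_tower (n := 0)).
have T_delta := tower_differentially_closed der_delta DS char0 alg_P.
(* [h] lists the [g i], then [P 0, ..., P n]. *)
pose h i := if (i < e)%N then g i else P (i - e)%N.
apply: (@finitely_generated (e + n.+1) h) => i.
suff in_T : iter i D Psi \in tower E P n.+1.
  apply: tower_sub in_T => [y /E_fg|j lt_jn]; last first.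
    have <- : h (e + j)%N = P j by rewrite /h ltnNge leq_addr addKn.
    by apply: mem_tower; rewrite ltn_add2l.
  apply: tower_sub => [|j lt_je]; first exact: base_tower.
  have <- : h j = g j by rewrite /h lt_je.
  by apply: mem_tower; rewrite ltn_addr.
have Psi_in : Psi \in tower E P n.+1 by apply: (@mem_tower _ E P 0).
elim: i => [//|i IHi]; rewrite iterS.
have -> : D (iter i D Psi) = delta (iter i D Psi) / Psi by rewrite /delta mulrC (mulKf nz_Psi).
by rewrite rpred_div ?T_delta.
Qed.

Lemma tower_range_descent x m n : {subset fieldRange iota <= E} ->
    (forall j, ~ alg (tower E P j) (P j)) ->
  x \in tower E P m -> x \in tower (fieldRange iota) P n -> x \in tower (fieldRange iota) P m.
Proof.
move=> sKE tr_P xE; elim: n => [|n IHn]; first exact: base_tower.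
have [le_nm | lt_mn] := leqP n.+1 m; first exact: sub_tower.
move=> x_in; apply: IHn; rewrite -[x]lead_coefC.
apply: lead_coef_transcendental (tr_P n) _ _; last by rewrite hornerC.
  by apply: tower_sub => [y /sKE|i]; [apply: base_tower | apply: mem_tower].
by rewrite polyOverC (sub_tower _ xE).
Qed.

End DeltaTower.

Variables (a : K) (z : F).
Hypotheses (nz_z : z != 0) (Phi_z : Phi z = iota a * z).

Lemma log_derivative_rational n0 (P0 : mpoly n0.+1 K) : P0 != 0 ->
  mmap iota (fun i : 'I_n0.+1 => iter i D z) P0 = 0 -> exists y, D z = iota y * z.
Proof.
move=> nz_P0 P00; pose zs i := iter i D z.
(* [zs N0] is algebraic over the lower derivatives of [z], so the field [E] generated by
   [zs 0, ..., zs N0] is stable under [D]. *)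
have [N0 _ alg_z] := alg_mpoly (v := zs) (mem_fieldRange iota) nz_P0 P00.
pose N := N0.+1; pose E := tower (fieldRange iota) zs N.
have DE : {in E, forall y, D y \in E}.
  apply: tower_differentially_closed => // y yK.
  exact/base_tower/D_range.
have zE : z \in E by apply: (@mem_tower _ _ zs 0).
pose y := D z / z; have yE : y \in E by rewrite rpred_div ?DE.
have sKE : {subset fieldRange iota <= E} by apply: base_tower.
have tr_P j : ~ alg (tower E P j) (P j).
  by apply: (@tower_delta_transcendental E DE N zs).
pose w i := iter i delta (Psi * y).
have w_P i : w i - y * P i \in tower E P i.
  elim: i => [|i IHi] /=; first by rewrite /w /P /= mulrC subrr rpred0.
  (* [delta] sends the previous remainder one level up the tower, and the new term [delta y * P i]
     involves no other [P] than [P 0] and [P i]. *)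
  have -> : delta (w i) - y * delta (P i) = delta (w i - y * P i) + delta y * P i.
    by rewrite /delta (derivationB derD) derD.2; ring.
  rewrite rpredD ?delta_tower // rpredM ?mem_adj //.
  by apply: (sub_tower (ltn0Sn i)); apply: delta_tower.
have w_in i : w i \in tower E P i.+1.
  have yEi : y \in tower E P i.+1 by apply: base_tower.
  have PEi : P i \in tower E P i.+1 by apply: mem_tower.
  by rewrite -(subrK (y * P i) (w i)) rpredD ?(rpredM yEi PEi) //; apply: sub_adj.
pose k := tower (fieldRange iota) P N.+1.
have bk i : (i <= N)%N -> Phi (w i) - w i \in k.
  have nz_a : iota a != 0.
    by apply: contraNneq nz_z => a0; rewrite -(fmorph_eq0 Phi) Phi_z a0 mul0r.
  (* [w 0] is [delta z / z], and [Phi] turns [z] into [a z]: the difference is the logarithmic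
     derivative of [a] with respect to [delta]. *)
  pose b0 := delta (iota a) / iota a.
  have b0E : Phi (w 0) - w 0 = b0.
    have w0 : w 0%N = delta z / z by rewrite /w /= /delta /y mulrA.
    rewrite w0 fmorph_div Phi_delta Phi_z der_delta.2 /b0.
    by field; apply/andP.
  have biE : Phi (w i) - w i = iter i delta b0.
    rewrite -b0E; elim: i => //= i <-.
    by rewrite Phi_delta (derivationB der_delta).
  move=> le_iN; apply: (sub_tower (m := i.+1)); first by rewrite ltnS.
  rewrite biE; elim: i {biE le_iN} => [|i IHi]; last exact: delta_tower.
  rewrite rpred_div //; last by apply/sub_adj/mem_fieldRange.
  exact: (delta_tower D_range (n := 0) (mem_fieldRange iota a)).
(* [v] lists the 2N + 2 elements [P 0, ..., P N, w 0, ..., w N]; [g] lists 2N + 1 generators, namely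
   the [N] derivatives of [z] that generate [E], then [P 0, ..., P N]. The surplus of one forces a
   relation. *)
pose v i := if (i < N.+1)%N then P i else w (i - N.+1)%N.
pose g i := if (i < N)%N then zs i else P (i - N)%N.
have sEg : {subset E <= tower (fieldRange iota) g (N + N.+1)}.
  apply: tower_sub => [|i lt_iN]; first exact: base_tower.
  have <- : g i = zs i by rewrite /g lt_iN.
  by apply: mem_tower; rewrite ltn_addr.
have Pg i : (i < N.+1)%N -> P i \in tower (fieldRange iota) g (N + N.+1).
  have <- : g (N + i)%N = P i by rewrite /g ltnNge leq_addr addKn.
  by move=> lt_iN; apply: mem_tower; rewrite ltn_add2l.
have vg j : (j < N.+1 + N.+1)%N -> v j \in tower (fieldRange iota) g (N + N.+1).
  move=> lt_j; rewrite /v; case: ltnP => [|le_Nj]; first exact: Pg.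
  apply: tower_sub (w_in _) => // i; rewrite ltnS => le_ij; apply: Pg.
  by apply: leq_ltn_trans le_ij _; rewrite ltn_subLR.
have [|P1 nz_P1 P10] := tower_alg_dependent _ vg; first by rewrite addSn ltnSn.
have [j lt_j alg_v] := alg_mpoly (mem_fieldRange iota) nz_P1 P10.
(* The dependent element [v j] cannot be a [P j], transcendental even over [E] and the earlier ones.
   So it is some [w l], algebraic over [k] and the earlier [w i]. *)
have [lt_jN | le_Nj] := ltnP j N.+1.
  have vj : v j = P j by rewrite /v lt_jN.
  case: (tr_P j); rewrite -vj; apply: algS alg_v.
  apply: tower_sub => [x /sKE|i lt_ij]; first exact: base_tower.
  by rewrite /v (ltn_trans lt_ij lt_jN) mem_tower.
pose l := (j - N.+1)%N; have le_lN : (l <= N)%N by rewrite -ltnS ltn_subLR.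
have alg_w : alg (tower k w l) (w l).
  have vj : v j = w l by rewrite /v ltnNge le_Nj.
  rewrite -vj; apply: algS alg_v.
  apply: tower_sub => [x xK|i lt_ij]; first exact/base_tower/base_tower.
  rewrite /v; case: ltnP => [lt_iN | le_Ni]; first exact/base_tower/mem_tower.
  by apply: mem_tower; rewrite ltn_sub2r // (leq_ltn_trans le_Ni).
have Phik : {in k, forall x, Phi x \in k}.
  apply: rmorphism_tower => [x /fieldRangeP[x0 ->]|i lt_iN].
    exact/base_tower/Phi_iota.
  have -> : Phi (P i) = iter i delta (iota rho * Psi).
    by elim: i {lt_iN} => //= i <-; apply: Phi_delta.
  apply: (sub_tower lt_iN); elim: i {lt_iN} => [|i IHi]; last exact: delta_tower.
  by rewrite rpredM ?mem_adj //; apply/sub_adj/mem_fieldRange.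
have fixk x : Phi x = x -> x \in k by move/Phi_fixed; apply: base_tower.
have bk' i : (i <= l)%N -> Phi (w i) - w i \in k by move/leq_trans/(_ le_lN)/bk.
have [c [cP [i0 lt_i0 nz_c0] sum_in]] := algebraic_relation_linear char0 Phik fixk bk' alg_w.
(* [m] will be the last index with a nonzero coefficient, which makes [c m * y] the coefficient of
   [P m]. *)
have ex_m : exists m, (m < l.+1)%N && (c m != 0) by exists i0; rewrite lt_i0.
have max_m m : (m < l.+1)%N && (c m != 0) -> (m <= l)%N by case/andP.
case: (ex_maxnP ex_m max_m) => m /andP[lt_ml nz_cm] m_max.
have {}sum_in : \sum_(i < m.+1) c i * w i \in k.
  move: sum_in; rewrite (big_ord_widen _ (fun i => c i * w i) lt_ml).
  rewrite [X in _ -> X \in _]big_mkcond /=.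
  rewrite (_ : \sum_(i < l.+1) c i * w i
    = \sum_(i < l.+1) if (i < m.+1)%N then c i * w i else 0) //.
  apply: eq_bigr => i _; rewrite ltnS; case: leqP => // lt_mi.
  have [-> | nz_ci] := eqVneq (c i) 0; first by rewrite mul0r.
  by have := m_max i; rewrite ltn_ord nz_ci leqNgt lt_mi => /(_ isT).
have cE i n : c i \in tower E P n by apply/base_tower/sKE/Phi_fixed.
(* [B] gathers what is free of [P m]: by [w_P] the relation is a polynomial of degree 1 in [P m]
   over [E(P 0, ..., P (m - 1))], with a value in [k]. *)
pose B := \sum_(i < m) c i * w i + c m * (w m - y * P m).
have BE : B \in tower E P m.
  rewrite /B; apply: rpredD; last exact: rpredM (cE m m) (w_P m).
  apply: rpred_sum => i _; apply: rpredM; first exact: cE.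
  exact: (sub_tower _ (w_in i)).
have sumE : \sum_(i < m.+1) c i * w i = c m * y * P m + B.
  by rewrite big_ord_recr /= /B; ring.
have [y0 | nz_y] := eqVneq y 0.
  by exists 0; rewrite rmorph0 mul0r -(divfK nz_z (D z)) -/y y0 mul0r.
have nz_cy : c m * y != 0 by rewrite mulf_neq0.
have yEm n : y \in tower E P n by apply: base_tower.
have cy_in : c m * y \in tower (fieldRange iota) P m.
  have -> : c m * y = lead_coef ((c m * y)%:P * 'X + B%:P).
    rewrite lead_coefDl ?lead_coefMX ?lead_coefC // size_mulX ?polyC_eq0 //.
    by rewrite [X in (_ < X.+1)%N]size_polyC nz_cy ltnS size_polyC_leq1.
  apply: lead_coef_transcendental (tr_P m) _ _.
  - by apply: tower_sub => [x /sKE|i]; [apply: base_tower | apply: mem_tower].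
  - have cyE : c m * y \in tower E P m by apply: rpredM (cE m m) (yEm m).
    by apply: rpredD; [apply: rpredM|]; rewrite ?polyOverX ?polyOverC.
  (* The value is known to lie in the field of [P 0, ..., P N]; the generators beyond [P m] are
     removed before the leading coefficient is compared. *)
  rewrite hornerD hornerMX !hornerC -sumE; apply: (@tower_range_descent E _ m.+1 N.+1) => //.
  have [cyE PE] : c m * y \in tower E P m.+1 /\ P m \in tower E P m.+1.
    by split; [apply: rpredM (cE m _) (yEm _) | apply: mem_tower].
  by rewrite sumE rpredD ?(rpredM cyE PE) //; apply: sub_adj.
(* The fixed element [c m] lies in the image of [iota] and can be divided out; then the remaining
   [P i] are removed, since [y] belongs to [E]. *)
have : y \in tower (fieldRange iota) P 0.
  apply: (@tower_range_descent E _ 0 m) => //.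
  have cm_in : c m \in tower (fieldRange iota) P m by apply/base_tower/Phi_fixed.
  by rewrite -(mulKf nz_cm y) mulrC rpred_div.
by case/fieldRangeP => y0 yE0; exists y0; rewrite -yE0 divfK.
Qed.

End LogarithmicDerivative.

(** * Morphisms and derivations of fraction fields *)

Lemma quotient_ruleD (F : fieldType) (a b c d Da Db Dc Dd : F) : b != 0 -> d != 0 ->
  (((Da * d + a * Dd) + (Dc * b + c * Db)) * (b * d) - (a * d + c * b) * (Db * d + b * Dd))
    / (b * d) ^+ 2 = (Da * b - a * Db) / b ^+ 2 + (Dc * d - c * Dd) / d ^+ 2.
Proof. by move=> nz_b nz_d; field; apply/andP. Qed.

Lemma quotient_ruleM (F : fieldType) (a b c d Da Db Dc Dd : F) : b != 0 -> d != 0 ->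
  ((Da * c + a * Dc) * (b * d) - a * c * (Db * d + b * Dd)) / (b * d) ^+ 2
    = (Da * b - a * Db) / b ^+ 2 * (c / d) + a / b * ((Dc * d - c * Dd) / d ^+ 2).
Proof. by move=> nz_b nz_d; field; apply/andP. Qed.

Section Fractions.
Variable A : idomainType.

Lemma fractionW (P : {fraction A} -> Prop) :
  (forall a b, b != 0 -> P (a%:F / b%:F)) -> forall x, P x.
Proof. by move=> PF x; rewrite (frac_repr x); apply/PF/denom_ratioP. Qed.

Lemma tofrac_neq0 (a : A) : a != 0 -> a%:F != 0.
Proof. by rewrite tofrac_eq0. Qed.

Section Lift.
Variables (K : fieldType) (phi : {rmorphism A -> K}).
Hypothesis phi_inj : injective phi.

Let phi_neq0 a : a != 0 -> phi a != 0.
Proof. by move=> nz_a; rewrite (raddf_eq0 _ phi_inj). Qed.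

Fact frac_lift_zmod_morphism : zmod_morphism (frac_lift phi).
Proof.
elim/fractionW => a b nz_b; elim/fractionW => c d nz_d.
have -> : a%:F / b%:F - c%:F / d%:F = (a * d - c * b)%:F / (b * d)%:F.
  by rewrite tofracB !tofracM -mulNr addf_div ?tofrac_neq0 // mulNr.
rewrite !frac_liftE ?mulf_neq0 // rmorphB !rmorphM.
by field; rewrite !phi_neq0.
Qed.

Fact frac_lift_monoid_morphism : monoid_morphism (frac_lift phi).
Proof.
split.
  have -> : 1 = 1%:F / 1%:F :> {fraction A} by rewrite tofrac1 divr1.
  by rewrite frac_liftE ?oner_neq0 // rmorph1 divr1.
elim/fractionW => a b nz_b; elim/fractionW => c d nz_d.
have -> : a%:F / b%:F * (c%:F / d%:F) = (a * c)%:F / (b * d)%:F.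
  by rewrite !tofracM mulf_div.
rewrite !frac_liftE ?mulf_neq0 // !rmorphM.
by field; rewrite !phi_neq0.
Qed.

Definition frac_morphism : {rmorphism {fraction A} -> K} :=
  HB.pack (frac_lift phi)
    (GRing.isZmodMorphism.Build _ _ (frac_lift phi) frac_lift_zmod_morphism)
    (GRing.isMonoidMorphism.Build _ _ (frac_lift phi) frac_lift_monoid_morphism).

Lemma frac_lift_tofrac a : frac_lift phi a%:F = phi a.
Proof. by rewrite -[a%:F]divr1 -tofrac1 frac_liftE ?oner_neq0 // rmorph1 divr1. Qed.

End Lift.

Section Derivation.
Variable D : A -> A.
Hypothesis derD : derivation D.

Lemma frac_deriv_div a b : b != 0 ->
  frac_deriv D (a%:F / b%:F) = ((D a)%:F * b%:F - a%:F * (D b)%:F) / b%:F ^+ 2.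
Proof.
move=> nz_b; rewrite frac_derivE //; last exact: derD.2.
by rewrite tofracXn tofracB !tofracM.
Qed.

Lemma frac_deriv_derivation : derivation (frac_deriv D).
Proof.
split; elim/fractionW => a b nz_b; elim/fractionW => c d nz_d.
  have -> : a%:F / b%:F + c%:F / d%:F = (a * d + c * b)%:F / (b * d)%:F.
    by rewrite tofracD !tofracM addf_div ?tofrac_neq0.
  rewrite !frac_deriv_div ?mulf_neq0 // derD.1 !derD.2 !(tofracD, tofracM).
  by apply: quotient_ruleD; rewrite tofrac_neq0.
have -> : a%:F / b%:F * (c%:F / d%:F) = (a * c)%:F / (b * d)%:F.
  by rewrite !tofracM mulf_div.
rewrite !frac_deriv_div ?mulf_neq0 // !derD.2 !(tofracD, tofracM).
by apply: quotient_ruleM; rewrite tofrac_neq0.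
Qed.

Lemma frac_deriv_tofrac a : frac_deriv D a%:F = (D a)%:F.
Proof.
rewrite -[a%:F]divr1 -tofrac1 frac_deriv_div ?oner_neq0 //.
by rewrite (derivation1 derD) tofrac1 tofrac0 mulr0 subr0 expr1n mulr1 divr1.
Qed.

End Derivation.
End Fractions.

(** * Logarithmic differential forms on the line *)

Section LogDerivatives.
Variables (K : fieldType) (D : K -> K).
Hypothesis derD : derivation D.
Implicit Types b c : K.

Definition dlog b := D b / b.

Lemma dlogM b c : b != 0 -> c != 0 -> dlog (b * c) = dlog b + dlog c.
Proof. by move=> nz_b nz_c; rewrite /dlog derD.2; field; apply/andP. Qed.

Lemma dlog1 : dlog 1 = 0.
Proof. by rewrite /dlog (derivation1 derD) mul0r. Qed.

Lemma dlogV b : b != 0 -> dlog b^-1 = - dlog b.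
Proof.
move=> nz_b; apply: (addrI (dlog b)).
by rewrite -dlogM ?invr_eq0 // mulfV // dlog1 subrr.
Qed.

Lemma dlog_div b c : b != 0 -> c != 0 -> dlog (b / c) = dlog b - dlog c.
Proof. by move=> nz_b nz_c; rewrite dlogM ?invr_eq0 // dlogV. Qed.

Lemma dlogXn b n : b != 0 -> dlog (b ^+ n) = dlog b *+ n.
Proof.
move=> nz_b; elim: n => [|n IHn]; first by rewrite expr0 dlog1.
by rewrite exprS dlogM ?expf_neq0 // IHn mulrS.
Qed.

Lemma dlogXz b (n : int) : b != 0 -> dlog (b ^ n) = dlog b *~ n.
Proof.
move=> nz_b; case: n => n; first by rewrite -exprnP dlogXn // pmulrn.
by rewrite NegzE -exprnN dlogV ?expf_neq0 // dlogXn // mulrNz pmulrn.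
Qed.

End LogDerivatives.

(* [K] stands for the field of fractions of [{poly C}]. *)
Section RationalForms.
Variables (C : closedFieldType) (K : fieldType) (i : {rmorphism {poly C} -> K}) (D : K -> K).
Hypothesis char0 : forall n, n.+1%:R != 0 :> C.
Hypothesis i_inj : injective i.
Hypothesis i_fraction : forall x, exists a b, b != 0 /\ x = i a / i b.
Hypothesis derD : derivation D.
Hypothesis D_i : forall a, D (i a) = i a^`().

Let cst c := i c%:P.
Let lin p := i ('X - p%:P).

Let i_neq0 a : a != 0 -> i a != 0.
Proof. by move=> nz_a; rewrite (raddf_eq0 _ i_inj). Qed.

Let lin_neq0 p : lin p != 0.
Proof. by apply: i_neq0; rewrite polyXsubC_eq0. Qed.

Let D_lin p : D (lin p) = 1.
Proof. by rewrite D_i derivXsubC rmorph1. Qed.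

Let D_cst c : D (cst c) = 0.
Proof. by rewrite D_i derivC rmorph0. Qed.

Let D_cstM c x : D (cst c * x) = cst c * D x.
Proof. by rewrite derD.2 D_cst mul0r add0r. Qed.

Let cst_is_additive : zmod_morphism cst.
Proof. by move=> c c'; rewrite /cst polyCB rmorphB. Qed.
Let cst_is_multiplicative : monoid_morphism cst.
Proof. by split=> [|c c']; rewrite /cst ?polyCM ?rmorphM ?rmorph1. Qed.
HB.instance Definition _ := GRing.isZmodMorphism.Build C K cst cst_is_additive.
HB.instance Definition _ := GRing.isMonoidMorphism.Build C K cst cst_is_multiplicative.

Let char0_K n : n.+1%:R != 0 :> K.
Proof. by rewrite -(rmorph_nat (cst : {rmorphism C -> K})) fmorph_eq0. Qed.

(** * Partial fractions and Hermite reduction *)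

Section Hermite.

Inductive partial_fraction : K -> Prop :=
| pf_poly q : partial_fraction (i q)
| pf_pole c p k : partial_fraction (cst c / lin p ^+ k.+1)
| pf_add x y : partial_fraction x -> partial_fraction y -> partial_fraction (x + y).

Lemma partial_fraction_div_lin x p : partial_fraction x -> partial_fraction (x / lin p).
Proof.
elim=> [q|c p0 k|y z _ pf_y _ pf_z]; last by rewrite mulrDl; apply: pf_add.
  rewrite (divp_eq q ('X - p%:P)) modp_XsubC rmorphD rmorphM mulrDl mulfK ?lin_neq0 //.
  by apply: pf_add; [apply: pf_poly | apply: (pf_pole _ p 0)].
have [-> | ne_p0] := eqVneq p0 p.
  have -> : cst c / lin p ^+ k.+1 / lin p = cst c / lin p ^+ k.+2.
    by rewrite [in RHS]exprSr invfM mulrA.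
  exact: pf_pole.
have [d [nz_d linE fracE]] : exists d, [/\ d != 0, lin p = lin p0 - d
    & forall c', cst (c' / (p - p0)) = cst c' / d].
  exists (cst (p - p0)); split.
  - by rewrite fmorph_eq0 subr_eq0 eq_sym.
  - by rewrite /lin /cst -rmorphB polyCB; congr (i _); ring.
  - by move=> c'; rewrite fmorph_div.
have nz_q := lin_neq0 p; rewrite linE in nz_q.
(* With [l = lin p0] and [lin p = l - d], the identity [1 / (l (l - d)) = (1 / (l - d) - 1 / l) / d]
   lowers the pole order at [p0] by one. *)
have step m c' : cst c' / lin p0 ^+ m.+1 / lin p
    = cst (c' / (p - p0)) / lin p0 ^+ m / lin p
      + cst (- (c' / (p - p0))) / lin p0 ^+ m.+1.
  rewrite [cst (- _)]rmorphN /= !fracE linE exprS.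
  have : lin p0 ^+ m != 0 by rewrite expf_neq0.
  move: (lin p0 ^+ m) (lin p0) (lin_neq0 p0) nz_q => L l nz_l nz_q nz_L.
  by field; rewrite nz_l nz_q nz_L nz_d.
elim: k c => [|k IHk] c; rewrite step; apply: pf_add; try exact: pf_pole; last exact: IHk.
by rewrite expr0 divr1; apply: (pf_pole _ p 0).
Qed.

(** Over the algebraically closed [C] the denominator splits into linear factors, which are divided
    out one at a time. *)
Lemma partial_fractionP x : partial_fraction x.
Proof.
have [a [b [nz_b ->]]] := i_fraction x.
have [r ->] := closed_field_poly_normal b.
have nz_l : lead_coef b != 0 by rewrite lead_coef_eq0.
rewrite -mul_polyC rmorphM invfM mulrA.
have -> : i a / i (lead_coef b)%:P = i (a * ((lead_coef b)^-1)%:P).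
  by rewrite rmorphM -[i _%:P]/(cst _) -[i (_^-1)%:P]/(cst _) fmorphV.
elim: r {nz_b} => [|p r IHr]; first by rewrite big_nil rmorph1 divr1; apply: pf_poly.
by rewrite big_cons [i (_ * \prod_(_ <- _) _)]rmorphM invfM mulrCA mulrC;
  apply: partial_fraction_div_lin.
Qed.

(** Polynomials and poles of order at least 2 have primitives in [K]; a simple pole is a constant
    times the logarithmic derivative of [lin p]. *)
Lemma hermite_decomposition y : exists g (s : seq (C * K)), all (fun cb => cb.2 != 0) s
  /\ y = D g + \sum_(cb <- s) cst cb.1 * dlog D cb.2.
Proof.
elim: (partial_fractionP y) => [q|c p k|y1 y2 _ [g1 [s1 [nz1 ->]]] _ [g2 [s2 [nz2 ->]]]].
- pose q1 := \poly_(j < (size q).+1) (if j is j'.+1 then q`_j' / j'.+1%:R else 0).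
  exists (i q1), [::]; split=> //; rewrite big_nil addr0 D_i; congr (i _).
  apply/polyP => j; rewrite coef_deriv coef_poly ltnS; case: ltnP => [_|le_qj].
    by rewrite -[RHS]mulr_natr mulfVK.
  by rewrite nth_default // mul0rn.
- case: k => [|k].
    exists 0, [:: (c, lin p)]; rewrite /= lin_neq0 big_seq1 (derivation0 derD) add0r.
    by rewrite expr1 /dlog /= D_lin mul1r.
  exists (cst (- (c / k.+1%:R)) / lin p ^+ k.+1), [::]; split=> //.
  rewrite big_nil addr0 D_cstM.
  have nz_l : lin p ^+ k.+1 != 0 by rewrite expf_neq0.
  have /(canRL (mulfVK nz_l)) DX := dlogXn derD k.+1 (lin_neq0 p).
  rewrite -[(lin p ^+ k.+1)^-1]mul1r (derivation_div derD) // (derivation1 derD).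
  rewrite -mulr_natr in DX; rewrite DX.
  rewrite /dlog D_lin rmorphN fmorph_div rmorph_nat /= exprS.
  move: (lin p ^+ k.+1) (lin p) (k.+1%:R) (cst c) nz_l (lin_neq0 p) (char0_K k).
  by move=> L l m c0 nz_L nz_l nz_m; field; rewrite nz_m nz_L nz_l.
exists (g1 + g2), (s1 ++ s2); rewrite all_cat nz1 nz2; split=> //.
by rewrite derD.1 big_cat /= addrACA.
Qed.

(* Residues that satisfy a relation with integer coefficients can be merged, at
   the price of the integer factor [N]. *)
Definition hermite_form r y := exists (N : int) g b0 (c : 'I_r -> C) (b : 'I_r -> K),
  [/\ N != 0, b0 != 0, forall j, b j != 0
    & y *~ N = D g + dlog D b0 + \sum_j cst (c j) * dlog D (b j)].

Lemma hermite_form_exists y : exists r, hermite_form r y.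
Proof.
have [g [s [nz_s ->]]] := hermite_decomposition y.
exists (size s), 1, g, 1, (fun j => (nth (0, 1) s j).1), (fun j => (nth (0, 1) s j).2).
split; rewrite ?oner_neq0 //; first by move=> j; apply: (all_nthP (0, 1) nz_s).
by rewrite mulr1z (dlog1 derD) addr0 (big_nth (0, 1)) big_mkord.
Qed.

(** After multiplication by [n k], the residue [c k] is eliminated through [n k * c k = - n0 -
    \sum_(j != k) n j * c j]. This moves [b k] into [b0] with exponent [- n0] and into each other
    [b j] with exponent [- n j]. *)
Lemma hermite_form_reduce r y N g b0 (c : 'I_r.+1 -> C) (b : 'I_r.+1 -> K)
    (n0 : int) (n : 'I_r.+1 -> int) k :
    N != 0 -> b0 != 0 -> (forall j, b j != 0) ->
    y *~ N = D g + dlog D b0 + \sum_j cst (c j) * dlog D (b j) ->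
    n0%:~R + \sum_j c j *~ n j = 0 -> n k != 0 -> hermite_form r y.
Proof.
move=> nz_N nz_b0 nz_b yE rel nz_k.
exists (N * n k), (g *~ n k), (b0 ^ n k / b k ^ n0), (fun j => c (lift k j)),
  (fun j => b (lift k j) ^ n k / b k ^ n (lift k j)).
have nzX (x : K) (m : int) : x != 0 -> x ^ m != 0 by move=> nz_x; rewrite expfz_neq0.
split; rewrite ?mulf_neq0 ?invr_eq0 ?nzX //.
  by move=> j; rewrite mulf_neq0 ?invr_eq0 ?nzX.
have D_Mz x (m : int) : D (x *~ m) = D x *~ m.
  rewrite -mulrzl -[RHS]mulrzl derD.2.
  suff -> : D m%:~R = 0 by rewrite mul0r add0r.
  by rewrite -(rmorph_int (cst : {rmorphism C -> K})) D_cst.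
have {rel} : n0%:~R + \sum_j cst (c j) * (n j)%:~R = 0 :> K.
  have /(congr1 cst) := rel; rewrite rmorphD rmorph_int rmorph0 rmorph_sum /= => rel0.
  rewrite -[RHS]rel0; congr (_ + _); apply: eq_bigr => j _.
  by rewrite rmorphMz mulrzr.
rewrite mulrzA yE !(bigD1_ord k) //= dlog_div ?nzX // !dlogXz // !D_Mz.
have -> : \sum_(j < r) cst (c (lift k j)) * dlog D (b (lift k j) ^ n k / b k ^ n (lift k j))
    = (n k)%:~R * (\sum_(j < r) cst (c (lift k j)) * dlog D (b (lift k j)))
      - (\sum_(j < r) cst (c (lift k j)) * (n (lift k j))%:~R) * dlog D (b k).
  rewrite mulr_sumr mulr_suml -sumrB; apply: eq_bigr => j _.
  rewrite dlog_div ?nzX // !dlogXz //.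
  rewrite -[dlog D (b (lift k j)) *~ _]mulrzr -[dlog D (b k) *~ _]mulrzr.
  move: (cst _) (dlog D _) (dlog D _) (_%:~R) (_%:~R) => x1 x2 x3 x4 x5.
  by ring.
move: (\sum_(j < r) _) (\sum_(j < r) _) => S1 S2 rel.
have {}rel : n0%:~R = - (cst (c k) * (n k)%:~R + S2) by apply/eqP; rewrite -addr_eq0 rel.
rewrite -[(_ + _) *~ n k]mulrzr -[D g *~ _]mulrzr -[dlog D b0 *~ _]mulrzr.
rewrite -[dlog D (b k) *~ _]mulrzr rel.
move: (cst _) (dlog D _) (dlog D _) (D g) (_%:~R) => x1 x2 x3 x4 x5.
by ring.
Qed.

End Hermite.

(** * The local ring at a point, and residues *)

Section LocalRing.
Variable p : C.

(** Evaluation at [p] stands in for the valuation: [regular] is the local ring at [p], and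
    [local_unit] its group of units. *)
Definition regular x := exists u v, v.[p] != 0 /\ x = i u / i v.
Definition local_unit x := exists u v, [/\ u.[p] != 0, v.[p] != 0 & x = i u / i v].

Let nz_horner v : v.[p] != 0 -> i v != 0.
Proof. by move=> nz_vp; apply: i_neq0; apply: contraNneq nz_vp => ->; rewrite horner0. Qed.

Lemma regular_i u : regular (i u).
Proof. by exists u, 1; rewrite hornerC oner_neq0 rmorph1 divr1. Qed.

Lemma regular1 : regular 1.
Proof. by rewrite -(rmorph1 i); apply: regular_i. Qed.

Lemma regular0 : regular 0.
Proof. by rewrite -(rmorph0 i); apply: regular_i. Qed.

Lemma regular_unit w : local_unit w -> regular w.
Proof. by case=> u [v [_ nz_v ->]]; exists u, v. Qed.

Lemma regularD x y : regular x -> regular y -> regular (x + y).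
Proof.
move=> [u [v [nz_v ->]]] [u' [v' [nz_v' ->]]]; exists (u * v' + u' * v), (v * v').
rewrite hornerM mulf_neq0 // rmorphD !rmorphM; split=> //.
by rewrite addf_div ?nz_horner.
Qed.

Lemma regularM x y : regular x -> regular y -> regular (x * y).
Proof.
move=> [u [v [nz_v ->]]] [u' [v' [nz_v' ->]]]; exists (u * u'), (v * v').
by rewrite hornerM mulf_neq0 // !rmorphM mulf_div.
Qed.

Lemma regularN x : regular x -> regular (- x).
Proof. by case=> u [v [nz_v ->]]; exists (- u), v; rewrite rmorphN mulNr. Qed.

Lemma regularB x y : regular x -> regular y -> regular (x - y).
Proof. by move=> rx ry; apply: regularD => //; apply: regularN. Qed.

Lemma regular_X x n : regular x -> regular (x ^+ n).
Proof.
move=> rx; elim: n => [|n IHn]; first exact: regular1.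
by rewrite exprS; apply: regularM.
Qed.

Lemma regular_sum (I : finType) (f : I -> K) :
  (forall j, regular (f j)) -> regular (\sum_j f j).
Proof.
move=> rf; apply: (big_ind regular) => //; first exact: regular0.
exact: regularD.
Qed.

Lemma regular_deriv x : regular x -> regular (D x).
Proof.
case=> u [v [nz_v ->]]; exists (u^`() * v - u * v^`()), (v ^+ 2).
rewrite horner_exp expf_neq0 //; split=> //.
by rewrite (derivation_div derD) ?nz_horner // !D_i rmorphB rmorphXn !rmorphM.
Qed.

Lemma local_unitV w : local_unit w -> local_unit w^-1.
Proof. by case=> u [v [nz_u nz_v ->]]; exists v, u; rewrite invf_div. Qed.

Lemma local_unit_neq0 w : local_unit w -> w != 0.
Proof. by case=> u [v [nz_u nz_v ->]]; rewrite mulf_neq0 ?invr_eq0 ?nz_horner. Qed.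

Lemma local_unit_cst c : c != 0 -> local_unit (cst c).
Proof. by move=> nz_c; exists c%:P, 1; rewrite !hornerC nz_c oner_neq0 rmorph1 divr1. Qed.

Lemma local_unitM w w' : local_unit w -> local_unit w' -> local_unit (w * w').
Proof.
move=> [u [v [nz_u nz_v ->]]] [u' [v' [nz_u' nz_v' ->]]]; exists (u * u'), (v * v').
by rewrite !hornerM !mulf_neq0 // !rmorphM mulf_div.
Qed.

Lemma regular_dlog w : local_unit w -> regular (dlog D w).
Proof.
by move=> w_unit; apply: regularM; [apply/regular_deriv | ]; apply: regular_unit => //;
  apply: local_unitV.
Qed.

Lemma lin_regular_nonunit x : regular x -> ~ local_unit (lin p * x).
Proof.
case=> u [v [nz_v ->]] [u' [v' [nz_u' nz_v']]] /eqP.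
rewrite mulrA -rmorphM eqr_div ?nz_horner // -!rmorphM (inj_eq i_inj).
move/eqP/(congr1 (fun q => q.[p]))/eqP; rewrite !hornerE subrr !mul0r eq_sym.
by rewrite mulf_eq0 (negPf nz_u') (negPf nz_v).
Qed.

Lemma local_factor x : x != 0 -> exists (n : int) w, local_unit w /\ x = lin p ^ n * w.
Proof.
have [a [b [nz_b ->]]] := i_fraction x; have [-> | nz_a _] := eqVneq a 0.
  by rewrite rmorph0 mul0r eqxx.
have [m [u]] := multiplicity_XsubC a p; rewrite nz_a /= => nz_u a_eq.
have [n [v]] := multiplicity_XsubC b p; rewrite nz_b /= => nz_v b_eq.
exists (m%:Z - n%:Z), (i u / i v); split; first by exists u, v.
rewrite a_eq b_eq !rmorphM !rmorphXn expfzDr ?lin_neq0 // -exprnN -exprnP.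
by rewrite [RHS]mulrC mulf_div.
Qed.

Lemma dlog_factor n w : local_unit w -> dlog D (lin p ^ n * w) = n%:~R / lin p + dlog D w.
Proof.
move=> w_unit; rewrite dlogM ?expfz_neq0 ?lin_neq0 ?local_unit_neq0 // dlogXz ?lin_neq0 //.
by rewrite /dlog D_lin mul1r mulrzl.
Qed.

(* A derivative has no residue. *)
Lemma residue_deriv h r : regular (cst r / lin p + D h) -> r = 0.
Proof.
move=> reg; apply: contrapT => /eqP nz_r.
have reg_case : regular (D h) -> False.
  move=> reg_Dh; have reg_r : regular (cst r / lin p).
    by rewrite -(addrK (D h) (cst r / lin p)); apply: regularB.
  apply: (lin_regular_nonunit reg_r).
  by rewrite mulrC divfK ?lin_neq0 //; apply: local_unit_cst.
have [h0 | nz_h] := eqVneq h 0.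
  by apply: reg_case; rewrite h0 (derivation0 derD); apply: regular0.
have [n [w [w_unit h_eq]]] := local_factor nz_h.
case: n h_eq => k h_eq.
  apply/reg_case/regular_deriv; rewrite h_eq -exprnP.
  by apply: regularM; [apply/regular_X/regular_i | apply: regular_unit].
have reg_w := regular_unit w_unit; have reg_lin : regular (lin p) := regular_i _.
(* With [h = w / lin p ^ (k + 1)], the worst term of [D h] is [- (k + 1) w / lin p ^ (k + 2)].
   Isolating it exhibits the unit [(k + 1) w] as a multiple of [lin p]. *)
suff : local_unit (lin p * (D w + cst r * lin p ^+ k - lin p ^+ k.+1 * (cst r / lin p + D h))).
  apply: lin_regular_nonunit; apply: regularB; last by apply: regularM => //; apply: regular_X.
  apply: regularD; first exact: regular_deriv.
  by apply: regularM; [apply: regular_i | apply: regular_X].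
have -> : lin p * (D w + cst r * lin p ^+ k - lin p ^+ k.+1 * (cst r / lin p + D h))
    = cst k.+1%:R * w.
  rewrite h_eq NegzE -exprnN derD.2.
  have nz_L : lin p ^+ k.+1 != 0 by rewrite expf_neq0.
  have /(canRL (mulfVK nz_L)) DX := dlogXn derD k.+1 (lin_neq0 p).
  rewrite -[(lin p ^+ k.+1)^-1]mul1r (derivation_div derD) // (derivation1 derD).
  rewrite -mulr_natr in DX; rewrite DX /dlog D_lin rmorph_nat.
  move: nz_L (lin_neq0 p) (D w); rewrite exprS mulf_eq0 negb_or => /andP[_].
  move: (lin p ^+ k) (lin p) (k.+1%:R) (cst r) => L l m c nz_L nz_l Dw.
  by field; rewrite nz_l nz_L.
by apply: local_unitM => //; apply: local_unit_cst.
Qed.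

End LocalRing.

Lemma reduced_fraction x : exists a b, [/\ coprimep a b, b != 0 & x = i a / i b].
Proof.
have [a [b [nz_b x_eq]]] := i_fraction x.
have nz_g : gcdp a b != 0 by rewrite gcdp_eq0 negb_and nz_b orbT.
exists (a %/ gcdp a b), (b %/ gcdp a b); split.
- by rewrite coprimep_div_gcd // nz_b orbT.
- by rewrite dvdp_div_eq0 ?dvdp_gcdr.
- rewrite x_eq -[in LHS](divpK (dvdp_gcdl a b)) -[X in _ / i X](divpK (dvdp_gcdr a b)).
  by rewrite !rmorphM -mulf_div divff ?mulr1 ?i_neq0.
Qed.

(** In lowest terms, a root of the numerator or of the denominator would be a zero or a pole of [x];
    as [C] is algebraically closed, both are constants. *)
Lemma no_zero_no_pole x : (forall p, local_unit p x) -> D x = 0.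
Proof.
move=> x_unit; have [a [b [cop nz_b x_eq]]] := reduced_fraction x.
have cross p : exists u v, [/\ u.[p] != 0, v.[p] != 0 & u * b = a * v].
  have [u [v [nz_u nz_v]]] := x_unit p.
  have nz_iv : i v != 0 by apply: i_neq0; apply: contraNneq nz_v => ->; rewrite horner0.
  rewrite x_eq => /eqP; rewrite eqr_div ?nz_iv ?i_neq0 // -!rmorphM (inj_eq i_inj) => /eqP ab.
  by exists u, v; rewrite -ab.
have const (q : {poly C}) : (forall p, ~~ root q p) -> q^`() = 0.
  move=> no_root; have [/size_poly1P[c _ ->] | sz_q] := boolP (size q == 1%N).
    by rewrite derivC.
  by have [p] := elimT (closed_rootP q) sz_q; rewrite (negPf (no_root p)).
have a_no_root p : ~~ root a p.
  apply/negP => ap0; have [u [v [nz_u nz_v /(congr1 (fun q => q.[p]))/eqP]]] := cross p.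
  rewrite !hornerM (rootP ap0) mul0r mulf_eq0 (negPf nz_u) /=.
  exact/negP/(coprimep_root cop ap0).
have b_no_root p : ~~ root b p.
  apply/negP => bp0; have [u [v [nz_u nz_v /(congr1 (fun q => q.[p]))/eqP]]] := cross p.
  rewrite !hornerM (rootP bp0) mulr0 eq_sym mulf_eq0 (negPf nz_v) orbF.
  by apply/negP; rewrite coprimep_sym in cop; apply: (coprimep_root cop bp0).
by rewrite x_eq (derivation_div derD) ?i_neq0 // !D_i !const // rmorph0 mul0r mulr0 subrr mul0r.
Qed.

(** Taking residues at [p] gives an integer relation between 1 and the [c j], whose coefficients are
    the orders of [b0] and of the [b j] at [p]. Independence makes every order zero at every point,
    so these functions are constants. *)
Lemma log_forms_independent r h (b0 : K) (c : 'I_r -> C) (b : 'I_r -> K) :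
    b0 != 0 -> (forall j, b j != 0) ->
    (forall (n0 : int) (n : 'I_r -> int), n0%:~R + \sum_j c j *~ n j = 0 -> forall j, n j = 0) ->
    D h + dlog D b0 + \sum_j cst (c j) * dlog D (b j) = 0 ->
  D h = 0 /\ forall j, D (b j) = 0.
Proof.
move=> nz_b0 nz_b indep eq0.
have units p : local_unit p b0 /\ forall j, local_unit p (b j).
  have [n0 [w0 [w0_unit b0_eq]]] := local_factor p nz_b0.
  have /choice[nw nwP] j : exists nw : int * K, local_unit p nw.2 /\ b j = lin p ^ nw.1 * nw.2.
    by have [m [w []]] := local_factor p (nz_b j); exists (m, w).
  have res0 : n0%:~R + \sum_j c j *~ (nw j).1 = 0.
    apply: (@residue_deriv p h).
    have -> : cst (n0%:~R + \sum_j c j *~ (nw j).1) / lin p + D h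
        = - (dlog D w0 + \sum_j cst (c j) * dlog D (nw j).2).
      apply/eqP; rewrite -addr_eq0 -[eqbRHS]eq0 b0_eq dlog_factor //.
      rewrite rmorphD rmorph_int rmorph_sum /= mulrDl.
      have -> : \sum_j cst (c j) * dlog D (b j)
          = (\sum_j cst (c j *~ (nw j).1)) / lin p + \sum_j cst (c j) * dlog D (nw j).2.
        rewrite mulr_suml -big_split; apply: eq_bigr => j _ /=.
        have [w_unit ->] := nwP j.
        by rewrite dlog_factor // mulrDr rmorphMz /= mulrA mulrzr.
      by apply/eqP; ring.
    apply/regularN/regularD; first exact: regular_dlog.
    apply: regular_sum => j; apply: regularM; first exact: regular_i.
    by apply/regular_dlog; case: (nwP j).
  have n_eq0 := indep _ _ res0.
  have n0_eq0 : n0 = 0.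
    move: res0; rewrite big1 => [|j _]; last by rewrite n_eq0 mulr0z.
    rewrite addr0; case: (n0) => m /eqP.
      by case: m => // m; rewrite -pmulrn (negPf (char0 m)).
    by rewrite NegzE mulrNz oppr_eq0 -pmulrn (negPf (char0 m)).
  split=> [|j]; first by rewrite b0_eq n0_eq0 expr0z mul1r.
  by have [w_unit ->] := nwP j; rewrite n_eq0 expr0z mul1r.
have Db0 : D b0 = 0 by apply: no_zero_no_pole => p; case: (units p).
have Db j : D (b j) = 0 by apply: no_zero_no_pole => p; case: (units p).
split=> //; move: eq0; rewrite /dlog Db0 mul0r addr0 big1 ?addr0 // => j _.
by rewrite Db mul0r mulr0.
Qed.

Variables (Theta : {rmorphism K -> K}) (rho : K).
Hypothesis chain_rule : forall g, D (Theta g) = rho * Theta (D g).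
Hypothesis Theta_cst : forall c, Theta (i c%:P) = i c%:P.
Hypothesis no_invariant : forall h, rho * Theta h = h -> h = 0.

Variables (y al : K).
Hypotheses (nz_al : al != 0) (y_eq : rho * Theta y = y + dlog D al).

(** [Theta] fixes constants, so substituting the decomposition into [y_eq] keeps the residues [c j].
    The difference of the two sides is a vanishing form built on [Theta g - g],
    [Theta b0 / b0 / al ^ N] and the [Theta (b j) / b j], to which [log_forms_independent]
    applies. *)
Lemma independent_form_dlog r (N : int) g b0 (c : 'I_r -> C) (b : 'I_r -> K) :
    b0 != 0 -> (forall j, b j != 0) ->
    y *~ N = D g + dlog D b0 + \sum_j cst (c j) * dlog D (b j) ->
    (forall (n0 : int) (n : 'I_r -> int), n0%:~R + \sum_j c j *~ n j = 0 -> forall j, n j = 0) ->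
  y *~ N = dlog D b0.
Proof.
move=> nz_b0 nz_b yE indep.
have nzT x : x != 0 -> Theta x != 0 by rewrite fmorph_eq0.
have nz_alN : al ^ N != 0 by rewrite expfz_neq0.
have Tdlog x : rho * Theta (dlog D x) = dlog D (Theta x).
  by rewrite /dlog fmorph_div mulrA -chain_rule.
have sumT : \sum_j cst (c j) * dlog D (Theta (b j)) + (D (Theta g) + dlog D (Theta b0))
    = y *~ N + dlog D al *~ N.
  rewrite -mulrzDl -y_eq -mulrzr -mulrA [Theta y * _]mulrC -[N%:~R](rmorph_int Theta).
  rewrite -rmorphM mulrzl yE rmorphD rmorphD rmorph_sum /= !mulrDr -chain_rule Tdlog addrC.
  congr (_ + _); rewrite mulr_sumr; apply: eq_bigr => j _.
  by rewrite rmorphM /= Theta_cst [RHS]mulrCA Tdlog.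
have [] := @log_forms_independent r (Theta g - g) (Theta b0 / b0 / al ^ N) c
  (fun j => Theta (b j) / b j).
- by rewrite !mulf_neq0 ?invr_eq0 ?nzT.
- by move=> j; rewrite mulf_neq0 ?invr_eq0 ?nzT.
- exact: indep.
- rewrite (derivationB derD) !dlog_div ?mulf_neq0 ?invr_eq0 ?nzT // dlogXz //.
  have -> : \sum_j cst (c j) * dlog D (Theta (b j) / b j)
      = \sum_j cst (c j) * dlog D (Theta (b j)) - \sum_j cst (c j) * dlog D (b j).
    by rewrite -sumrB; apply: eq_bigr => j _; rewrite dlog_div ?nzT // mulrBr.
  have -> : \sum_j cst (c j) * dlog D (b j) = y *~ N - (D g + dlog D b0).
    by rewrite yE; ring.
  have -> : \sum_j cst (c j) * dlog D (Theta (b j))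
      = y *~ N + dlog D al *~ N - (D (Theta g) + dlog D (Theta b0)) by rewrite -sumT; ring.
  by ring.
move=> Dh DB.
have Dg : D g = 0.
  apply: no_invariant; rewrite -chain_rule; apply/eqP.
  by rewrite -subr_eq0 -(derivationB derD) Dh.
have dlog_b j : dlog D (b j) = 0.
  apply: no_invariant; rewrite Tdlog; apply/eqP.
  by rewrite -subr_eq0 -dlog_div ?nzT // /dlog DB mul0r.
by rewrite yE Dg add0r big1 ?addr0 // => j _; rewrite dlog_b mulr0.
Qed.

(** Each integer relation between residues removes one of them, so recursion on their number reaches
    an independent family, at the latest the empty one. *)
Lemma coboundary_dlog : exists (N : int) b, [/\ N != 0, b != 0 & y *~ N = dlog D b].
Proof.
have [r] := hermite_form_exists y.
elim: r => [|r IHr] [N [g [b0 [c [b [nz_N nz_b0 nz_b yE]]]]]].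
  exists N, b0; split=> //; apply: independent_form_dlog nz_b0 nz_b yE _.
  by move=> ? ? _ [].
have [indep | /existsNP[n0 /existsNP[n /not_implyP[rel /existsNP[k /eqP nz_k]]]]] :=
  pselect (forall (n0 : int) (n : 'I_r.+1 -> int),
    n0%:~R + \sum_j c j *~ n j = 0 -> forall j, n j = 0).
  exists N, b0; split=> //; exact: independent_form_dlog nz_b0 nz_b yE indep.
exact: (IHr (hermite_form_reduce nz_N nz_b0 nz_b yE rel nz_k)).
Qed.

End RationalForms.

(** * Power series *)

Lemma natr_inj (A : pzRingType) : (forall n, n.+1%:R != 0 :> A) -> injective (fun n => n%:R : A).
Proof.
move=> char0 m n; wlog le_mn : m n / (m <= n)%N => [Hw|].
  by case: (leqP m n) => [|/ltnW] le eq_mn; [|apply/esym]; apply: Hw.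
rewrite -(subnKC le_mn) natrD => /eqP; rewrite eq_sym -subr_eq0 addrC addKr.
by case: (n - m)%N => [|k]; rewrite ?addn0 // (negPf (char0 k)).
Qed.

Section PowerSeries.
Variable F : fieldType.
Implicit Types (f g h s u : fps F) (c : F).

Local Arguments fps_coef : simpl never.

Lemma coef_Fps (a : nat -> F) n : Fps a n = a n.
Proof. by []. Qed.

Lemma coef_fps_const c n : fps_const c n = c *+ (n == 0%N).
Proof. by case: n. Qed.

Lemma coef_fps_deriv f n : fps_deriv f n = f n.+1 *+ n.+1.
Proof. by []. Qed.

Lemma coef_fps_comp f s n : fps_comp f s n = \sum_(k < n.+1) f k * (s ^+ k) n.
Proof. by []. Qed.

Lemma coef_fps0 n : (0 : fps F) n = 0.
Proof. by case: n. Qed.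

Lemma coef_fps1 n : (1 : fps F) n = (n == 0%N)%:R.
Proof. by case: n. Qed.

Lemma coef_fpsD f g n : (f + g) n = f n + g n.
Proof. by []. Qed.

Lemma coef_fpsB f g n : (f - g) n = f n - g n.
Proof. by []. Qed.

Lemma coef_fpsM f g n : (f * g) n = \sum_(i < n.+1) f i * g (n - i)%N.
Proof. by []. Qed.

Lemma coef_fps_sum (I : Type) (r : seq I) (P : pred I) (G : I -> fps F) n :
  (\sum_(i <- r | P i) G i) n = \sum_(i <- r | P i) G i n.
Proof. by elim/big_rec2: _ => [|i x y _ <-] //; apply: coef_fps0. Qed.

Lemma fps_const_zmod_morphism : zmod_morphism (@fps_const F).
Proof. by move=> c d; apply: fps_eq => n; rewrite coef_fpsB !coef_fps_const mulrnBl. Qed.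

Lemma coef_fps_constM c f n : (fps_const c * f) n = c * f n.
Proof.
rewrite coef_fpsM big_ord_recl subn0 big1 ?addr0 // => i _.
by rewrite coef_fps_const mul0r.
Qed.

Lemma fps_const_monoid_morphism : monoid_morphism (@fps_const F).
Proof.
split=> // c d; apply: fps_eq => n; rewrite coef_fps_constM.
by rewrite !coef_fps_const mulrnAr.
Qed.
HB.instance Definition _ :=
  GRing.isZmodMorphism.Build F (fps F) (@fps_const F) fps_const_zmod_morphism.
HB.instance Definition _ :=
  GRing.isMonoidMorphism.Build F (fps F) (@fps_const F) fps_const_monoid_morphism.

(* [f = c t^n + O(t^(n+1))]; here [c] may vanish. *)
Definition leading f n c := (forall i, (i < n)%N -> f i = 0) /\ f n = c.

Lemma leading_exists f : f != 0 -> exists n c, c != 0 /\ leading f n c.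
Proof. by case/fps_neq0_order => n nz_fn f0; exists n, (f n). Qed.

Lemma leadingM f g m n c d : leading f m c -> leading g n d ->
  leading (f * g) (m + n) (c * d).
Proof.
move=> [f0 fm] [g0 gn]; split=> [i lt_i|].
  rewrite coef_fpsM big1 // => j _; have [lt_jm | le_mj] := ltnP j m.
    by rewrite f0 // mul0r.
  rewrite g0 ?mulr0 // ltn_subLR; last by rewrite -ltnS.
  by rewrite (leq_trans lt_i) // leq_add2r.
have lt_m : (m < (m + n).+1)%N by rewrite ltnS leq_addr.
rewrite coef_fpsM (bigD1 (Ordinal lt_m)) //= addKn fm gn big1 ?addr0 // => i ne_im.
have [lt_im | le_mi] := ltnP i m; first by rewrite f0 ?mul0r.
rewrite g0 ?mulr0 // ltn_subLR ?ltn_add2r; last by rewrite -ltnS.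
by rewrite ltn_neqAle eq_sym le_mi andbT.
Qed.

Lemma leading1 : leading 1 0 1.
Proof. by []. Qed.

Lemma leadingX f m c k : leading f m c -> leading (f ^+ k) (m * k) (c ^+ k).
Proof.
move=> f_lead; elim: k => [|k IHk]; first by rewrite muln0; apply: leading1.
by rewrite !exprS mulnS; apply: leadingM.
Qed.

Lemma leadingD f g n c d : leading f n c -> leading g n d -> leading (f + g) n (c + d).
Proof.
by move=> [f0 <-] [g0 <-]; split=> // i lt_in; rewrite coef_fpsD f0 ?g0 ?addr0.
Qed.

Lemma leading_const c : leading (fps_const c) 0 c.
Proof. by []. Qed.

Lemma leading_uniq f m n c d : leading f m c -> leading f n d -> c != 0 -> d != 0 ->
  m = n /\ c = d.
Proof.
move=> [f0 fm] [f0' fn] nz_c nz_d.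
have eq_mn : m = n.
  apply/eqP; rewrite eqn_leq; apply/andP; split; rewrite leqNgt; apply/negP.
    by move/f0; rewrite fn => /eqP; apply/negP.
  by move/f0'; rewrite fm => /eqP; apply/negP.
by split=> //; rewrite -fm eq_mn.
Qed.

Lemma coef_fps_t n : (fps_t : fps F) n = (n == 1%N)%:R.
Proof. by []. Qed.

Lemma leading_t : leading fps_t 1 1.
Proof. by split=> // -[]. Qed.

Lemma coef_fps_tM f n : (fps_t * f) n = if n is n'.+1 then f n' else 0.
Proof.
rewrite coef_fpsM; case: n => [|n]; first by rewrite big_ord1 coef_fps_t mul0r.
rewrite 2!big_ord_recl big1 => [|i _]; last by rewrite coef_fps_t mul0r.
by rewrite !coef_fps_t mul0r add0r mul1r addr0 subSS subn0.
Qed.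

Lemma coef_fps_tXM k f n : (fps_t ^+ k * f) n = if (n < k)%N then 0 else f (n - k)%N.
Proof.
elim: k n => [|k IHk] n; first by rewrite expr0 mul1r subn0.
by rewrite exprS -mulrA coef_fps_tM; case: n => [|n]; rewrite ?IHk // subSS ltnS.
Qed.

Lemma coef_monomial c k n : (fps_const c * fps_t ^+ k) n = c *+ (n == k).
Proof.
rewrite coef_fps_constM -[fps_t ^+ k]mulr1 coef_fps_tXM coef_fps1; case: ltngtP => [||->].
- by rewrite mulr0.
- by move=> lt_kn; rewrite subn_eq0 leqNgt lt_kn mulr0.
- by rewrite subnn mulr1.
Qed.

Lemma fps_factor f n : (forall i, (i < n)%N -> f i = 0) ->
  f = fps_t ^+ n * Fps (fun i => f (n + i)%N).
Proof.
move=> f0; apply: fps_eq => i; rewrite coef_fps_tXM; case: ltnP => [/f0 // | le_ni].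
by rewrite coef_Fps subnKC.
Qed.

Section Additive.

(* Continuity for the t-adic topology. *)
Definition fps_continuous (A : fps F -> fps F) := forall n, exists N, forall f,
  (forall i, (i < N)%N -> f i = 0) -> A f n = 0.

(** Up to the order that governs the [n]-th coefficients of [A f] and [B f], the series [f] is a
    finite sum of monomials. The product rule, the chain rule, and the multiplicativity and
    associativity of composition are all reduced to monomials in this way. *)
Lemma fps_additive_ext (A B : fps F -> fps F) :
    {morph A : f g / f + g} -> {morph B : f g / f + g} ->
    fps_continuous A -> fps_continuous B ->
    (forall c k, A (fps_const c * fps_t ^+ k) = B (fps_const c * fps_t ^+ k)) ->
  A =1 B.
Proof.
move=> AD BD Acont Bcont AB f; apply: fps_eq => n.
have [N1 AN] := Acont n; have [N2 BN] := Bcont n.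
pose N := maxn N1 N2.
pose p := \sum_(k < N) fps_const (f k) * fps_t ^+ k.
have pE i : (i < N)%N -> p i = f i.
  move=> lt_iN; rewrite coef_fps_sum (bigD1 (Ordinal lt_iN)) //= big1 => [|k ne_k].
    by rewrite addr0 coef_monomial eqxx.
  by rewrite coef_monomial eq_sym; have /negPf -> : (k != i :> nat) by [].
have rest0 i : (i < N)%N -> (f - p) i = 0 by move/pE => pi; rewrite coef_fpsB pi subrr.
have A0 : A 0 = 0 by apply: (addIr (A 0)); rewrite -AD !add0r.
have B0 : B 0 = 0 by apply: (addIr (B 0)); rewrite -BD !add0r.
have -> : A f n = A p n.
  rewrite -{1}(subrK p f) AD coef_fpsD AN ?add0r // => i lt_i.
  by apply: rest0; rewrite leq_max lt_i.
have -> : B f n = B p n.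
  rewrite -{1}(subrK p f) BD coef_fpsD BN ?add0r // => i lt_i.
  by apply: rest0; rewrite leq_max lt_i orbT.
rewrite (big_morph A AD A0) (big_morph B BD B0); congr (fps_coef _ n).
exact: eq_bigr.
Qed.

Lemma fps_continuous_mull g A : fps_continuous A -> fps_continuous (fun f => g * A f).
Proof.
move=> Acont n.
have [N NP] : exists N, forall f, (forall i, (i < N)%N -> f i = 0) ->
    forall j, (j <= n)%N -> A f j = 0.
  elim: n => [|n [N NP]].
    have [N NP] := Acont 0%N; exists N => f f0 j; rewrite leqn0 => /eqP->; exact: NP.
  have [N' NP'] := Acont n.+1; exists (maxn N N') => f f0 j.
  rewrite leq_eqVlt => /predU1P[->|lt_j].
    by apply: NP' => i lt_i; apply: f0; rewrite leq_max lt_i orbT.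
  by apply: NP => // i lt_i; apply: f0; rewrite leq_max lt_i.
exists N => f f0; rewrite coef_fpsM big1 // => i _.
by rewrite NP ?mulr0 ?leq_subr.
Qed.

Lemma fps_continuous_comp (A B : fps F -> fps F) : fps_continuous A ->
    (forall f n, (forall i, (i < n)%N -> f i = 0) -> forall i, (i < n)%N -> B f i = 0) ->
  fps_continuous (fun f => A (B f)).
Proof.
by move=> Acont Bvan n; have [N NP] := Acont n; exists N => f f0; apply: NP; apply: Bvan.
Qed.

Lemma fps_continuous_id : fps_continuous id.
Proof. by move=> n; exists n.+1 => f; apply. Qed.

End Additive.

Lemma mull_vanish g f n : (forall i, (i < n)%N -> f i = 0) ->
  forall i, (i < n)%N -> (g * f) i = 0.
Proof.
move=> f0 i lt_in; rewrite coef_fpsM big1 // => j _.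
by rewrite f0 ?mulr0 // (leq_ltn_trans _ lt_in) // leq_subr.
Qed.

Lemma fps_derivD : {morph @fps_deriv F : f g / f + g}.
Proof. by move=> f g; apply: fps_eq => n; rewrite coef_fpsD !coef_fps_deriv mulrnDl. Qed.

Lemma fps_deriv_continuous : fps_continuous (@fps_deriv F).
Proof. by move=> n; exists n.+2 => f f0; rewrite coef_fps_deriv f0 ?mul0rn. Qed.

Lemma fps_deriv_monomial c k :
  fps_deriv (fps_const c * fps_t ^+ k) = fps_const (c *+ k) * fps_t ^+ k.-1.
Proof.
apply: fps_eq => n; rewrite coef_fps_deriv !coef_monomial.
case: k => [|k] /=; first by rewrite !mul0rn.
by rewrite eqSS; case: eqP => [->|_]; rewrite ?mulr1n // !mulr0n mul0rn.
Qed.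

Lemma fps_deriv_const c : fps_deriv (fps_const c) = 0.
Proof. by apply: fps_eq => n; rewrite coef_fps_deriv coef_fps_const coef_fps0 mul0rn. Qed.

Lemma monomialM c d k l : fps_const c * fps_t ^+ k * (fps_const d * fps_t ^+ l)
  = fps_const (c * d) * fps_t ^+ (k + l) :> fps F.
Proof. by rewrite mulrACA -rmorphM exprD. Qed.

Lemma fps_derivM f g : fps_deriv (f * g) = fps_deriv f * g + f * fps_deriv g.
Proof.
pose B g f := fps_deriv f * g + f * fps_deriv g.
have BDl h : {morph B h : f g / f + g}.
  by move=> f1 f2; rewrite /B fps_derivD !mulrDl addrACA.
have BC h1 h2 : B h1 h2 = B h2 h1 by rewrite /B addrC mulrC [_ * h1]mulrC.
have Bcont h : fps_continuous (B h).
  move=> n; have [N1 NP1] := fps_continuous_mull h fps_deriv_continuous n.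
  have [N2 NP2] := fps_continuous_mull (fps_deriv h) fps_continuous_id n.
  exists (maxn N1 N2) => f0 f00; rewrite coef_fpsD [fps_deriv f0 * h]mulrC NP1 ?add0r.
    by rewrite mulrC NP2 // => i lt_i; apply: f00; rewrite leq_max lt_i orbT.
  by move=> i lt_i; apply: f00; rewrite leq_max lt_i.
have Acont h : fps_continuous (fun f => fps_deriv (h * f)).
  exact: fps_continuous_comp fps_deriv_continuous (mull_vanish h).
have AD h : {morph (fun f => fps_deriv (h * f)) : f g / f + g}.
  by move=> f1 f2; rewrite mulrDr fps_derivD.
rewrite mulrC -[RHS]/(B g f).
apply: (fps_additive_ext (AD g) (BDl g) (Acont g) (Bcont g)) => c k.
rewrite mulrC BC.
apply: (fps_additive_ext (AD _) (BDl _) (Acont _) (Bcont _)) => d l.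
rewrite monomialM fps_deriv_monomial /B !fps_deriv_monomial !monomialM mulrnAl mulrnAr.
rewrite [d * c]mulrC.
case: k => [|k]; first by rewrite mulr0n rmorph0 mul0r addr0 add0n addn0.
case: l => [|l]; first by rewrite mulr0n rmorph0 mul0r add0r add0n addn0.
rewrite !addSn !addnS /= [(l + k)%N]addnC -mulrDl -rmorphD -mulrnDr.
by rewrite [(l.+1 + k.+1)%N]addSn addnS [(l + k)%N]addnC.
Qed.

Lemma fps_deriv_derivation : derivation (@fps_deriv F).
Proof. by split; [apply: fps_derivD | apply: fps_derivM]. Qed.

Section Composition.
Variable s : fps F.
Hypothesis s0 : s 0%N = 0.

Let sX_vanish k i : (i < k)%N -> (s ^+ k) i = 0.
Proof.
have s_lead : leading s 1 (s 1%N) by split=> // -[].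
by have [sX0 _] := leadingX k s_lead; rewrite mul1n in sX0; apply: sX0.
Qed.

Lemma fps_compD : {morph (fps_comp (F := F))^~ s : f g / f + g}.
Proof.
move=> f g; apply: fps_eq => n; rewrite coef_fpsD !coef_fps_comp -big_split.
by apply: eq_bigr => k _; rewrite coef_fpsD mulrDl.
Qed.

Lemma fps_comp_vanish f n : (forall i, (i < n)%N -> f i = 0) ->
  forall i, (i < n)%N -> fps_comp f s i = 0.
Proof.
move=> f0 i lt_in; rewrite coef_fps_comp big1 // => k _.
by rewrite f0 ?mul0r // (leq_ltn_trans _ lt_in) // -ltnS.
Qed.

Lemma fps_comp_continuous : fps_continuous ((fps_comp (F := F))^~ s).
Proof.
exact: fps_continuous_comp fps_continuous_id fps_comp_vanish.
Qed.

Lemma fps_comp_monomial c k : fps_comp (fps_const c * fps_t ^+ k) s = fps_const c * s ^+ k.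
Proof.
apply: fps_eq => n; rewrite coef_fps_constM coef_fps_comp.
under eq_bigr => i _ do rewrite coef_monomial mulrnAl.
have [le_kn | lt_nk] := ltnP k n.+1.
  rewrite (bigD1 (Ordinal le_kn)) //= eqxx big1 ?addr0 // => i ne_ik.
  by have /negPf -> : (i != k :> nat) by [].
rewrite sX_vanish // mulr0 big1 // => i _.
by rewrite (ltn_eqF (leq_trans (ltn_ord i) lt_nk)).
Qed.

Lemma fps_compM f g : fps_comp (f * g) s = fps_comp f s * fps_comp g s.
Proof.
have Acont h : fps_continuous (fun f => fps_comp (h * f) s).
  by move=> n; have := fps_continuous_comp fps_comp_continuous (mull_vanish h) n.
have AD h : {morph (fun f => fps_comp (h * f) s) : f g / f + g}.
  by move=> f1 f2; rewrite mulrDr fps_compD.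
have Bcont h : fps_continuous (fun f => fps_comp h s * fps_comp f s).
  exact: fps_continuous_mull fps_comp_continuous.
have BD h : {morph (fun f => fps_comp h s * fps_comp f s) : f g / f + g}.
  by move=> f1 f2; rewrite fps_compD mulrDr.
apply: (fps_additive_ext (AD f) (BD f) (Acont f) (Bcont f)) => c k.
rewrite mulrC [RHS]mulrC.
apply: (fps_additive_ext (AD _) (BD _) (Acont _) (Bcont _)) => d l.
by rewrite monomialM !fps_comp_monomial mulrACA -rmorphM exprD.
Qed.

Lemma fps_comp_const c : fps_comp (fps_const c) s = fps_const c.
Proof. by have := fps_comp_monomial c 0; rewrite !expr0 !mulr1. Qed.

Lemma fps_comp_t : fps_comp fps_t s = s.
Proof. by have := fps_comp_monomial 1 1; rewrite !expr1 rmorph1 !mul1r. Qed.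

Fact fps_comp_zmod_morphism : zmod_morphism ((fps_comp (F := F))^~ s).
Proof.
move=> f g; apply: (addIr (fps_comp g s)); rewrite subrK.
by rewrite -fps_compD subrK.
Qed.

Fact fps_comp_monoid_morphism : monoid_morphism ((fps_comp (F := F))^~ s).
Proof. by split; [apply: (fps_comp_const 1) | apply: fps_compM]. Qed.

Definition fps_comp_morphism : {rmorphism fps F -> fps F} :=
  HB.pack ((fps_comp (F := F))^~ s)
    (GRing.isZmodMorphism.Build _ _ ((fps_comp (F := F))^~ s) fps_comp_zmod_morphism)
    (GRing.isMonoidMorphism.Build _ _ ((fps_comp (F := F))^~ s) fps_comp_monoid_morphism).

Lemma fps_chain_rule f : fps_deriv (fps_comp f s) = fps_deriv s * fps_comp (fps_deriv f) s.
Proof.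
have derX k : fps_deriv (s ^+ k) = fps_const k%:R * (fps_deriv s * s ^+ k.-1).
  elim: k => [|k IHk].
    rewrite expr0 rmorph0 mul0r; apply: fps_eq => n.
    by rewrite coef_fps_deriv coef_fps1 mul0rn coef_fps0.
  rewrite exprS fps_derivM IHk -natr1 rmorphD rmorph1 mulrDl mul1r addrC /=.
  congr (_ + _); case: k {IHk} => [|k]; first by rewrite rmorph0 !mul0r mulr0.
  by rewrite /= mulrCA [s * _]mulrCA -exprS.
have Acont : fps_continuous (fun f => fps_deriv (fps_comp f s)).
  exact: fps_continuous_comp fps_deriv_continuous fps_comp_vanish.
have Bcont : fps_continuous (fun f => fps_deriv s * fps_comp (fps_deriv f) s).
  apply: fps_continuous_mull => n; exists n.+2 => g g0; rewrite coef_fps_comp big1 // => k _.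
  by rewrite coef_fps_deriv g0 ?mul0rn ?mul0r // ltnS.
apply: (fps_additive_ext _ _ Acont Bcont) => [f1 f2|f1 f2|c k].
- by rewrite fps_compD fps_derivD.
- by rewrite fps_derivD fps_compD mulrDr.
rewrite fps_comp_monomial fps_deriv_monomial fps_comp_monomial fps_derivM derX.
by rewrite fps_deriv_const mul0r add0r mulrA -rmorphM mulr_natr mulrCA.
Qed.

(** Write [f = t^m g] with [g(0) = c]; then [f(s) = s^m g(s)]. *)
Lemma leading_comp f d r m c : leading s d r -> leading f m c ->
  leading (fps_comp f s) (d * m) (c * r ^+ m).
Proof.
move=> s_lead [f0 fm]; rewrite (fps_factor f0) fps_compM.
have -> : fps_comp (fps_t ^+ m) s = s ^+ m.
  by have := fps_comp_monomial 1 m; rewrite rmorph1 !mul1r.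
rewrite -[(d * m)%N]addn0 [c * _]mulrC; apply: leadingM; first exact: leadingX.
by split=> //; rewrite coef_fps_comp big_ord1 expr0 coef_fps1 mulr1 coef_Fps addn0.
Qed.

Lemma fps_comp_neq0 d r f : leading s d r -> r != 0 -> f != 0 -> fps_comp f s != 0.
Proof.
move=> s_lead nz_r /leading_exists[m [c [nz_c /(leading_comp s_lead)[_ lead]]]].
apply: contra_eq_neq lead => ->; rewrite coef_fps0 eq_sym.
by rewrite mulf_neq0 ?expf_neq0.
Qed.

Lemma fps_comp_inj d r : leading s d r -> r != 0 -> injective ((fps_comp (F := F))^~ s).
Proof.
move=> s_lead nz_r f g /eqP; rewrite -subr_eq0 -fps_comp_zmod_morphism.
move/eqP=> fg0; apply/eqP; rewrite -subr_eq0; apply: contraT.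
by move/(fps_comp_neq0 s_lead nz_r)/eqP.
Qed.

End Composition.

Lemma fps_comp_id f : fps_comp f fps_t = f.
Proof.
have t0 : (fps_t : fps F) 0%N = 0 by [].
apply: (fps_additive_ext (fps_compD fps_t) _ (fps_comp_continuous fps_t)
  fps_continuous_id) => [//|c k].
by rewrite fps_comp_monomial.
Qed.

Lemma fps_compA f g s : g 0%N = 0 -> s 0%N = 0 ->
  fps_comp (fps_comp f g) s = fps_comp f (fps_comp g s).
Proof.
move=> g0 s0.
have gs0 : fps_comp g s 0%N = 0 by rewrite coef_fps_comp big_ord1 g0 mul0r.
apply: (@fps_additive_ext (fun f => fps_comp (fps_comp f g) s)
  (fun f => fps_comp f (fps_comp g s))) => [f1 f2|f1 f2|||c k].
- by rewrite !fps_compD.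
- by rewrite fps_compD.
- exact: fps_continuous_comp (fps_comp_continuous s) (@fps_comp_vanish g).
- exact: fps_comp_continuous.
rewrite !fps_comp_monomial // fps_compM // fps_comp_const //.
by have -> : fps_comp (g ^+ k) s = fps_comp g s ^+ k := rmorphXn (fps_comp_morphism s0) k g.
Qed.

Lemma coef_fps_poly (p : {poly F}) n : fps_poly p n = p`_n.
Proof. by []. Qed.

Fact fps_poly_zmod_morphism : zmod_morphism (@fps_poly F).
Proof. by move=> p q; apply: fps_eq => n; rewrite coef_fpsB !coef_fps_poly coefB. Qed.

Fact fps_poly_monoid_morphism : monoid_morphism (@fps_poly F).
Proof.
split=> [|p q]; apply: fps_eq => n; first by rewrite coef_fps_poly coef1 coef_fps1.
by rewrite coef_fps_poly coefM coef_fpsM.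
Qed.
HB.instance Definition _ :=
  GRing.isZmodMorphism.Build {poly F} (fps F) (@fps_poly F) fps_poly_zmod_morphism.
HB.instance Definition _ :=
  GRing.isMonoidMorphism.Build {poly F} (fps F) (@fps_poly F) fps_poly_monoid_morphism.

Lemma fps_poly_inj : injective (@fps_poly F).
Proof.
move=> p q eq_pq; apply/polyP => n.
by rewrite -!coef_fps_poly eq_pq.
Qed.

Lemma fps_polyC c : fps_poly c%:P = fps_const c.
Proof.
by apply: fps_eq => n; rewrite coef_fps_poly coefC coef_fps_const; case: eqP.
Qed.

Lemma fps_polyX : fps_poly 'X = fps_t :> fps F.
Proof. by apply: fps_eq => n; rewrite coef_fps_poly coefX. Qed.

Lemma fps_deriv_poly (p : {poly F}) : fps_deriv (fps_poly p) = fps_poly p^`().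
Proof. by apply: fps_eq => n; rewrite coef_fps_deriv !coef_fps_poly coef_deriv. Qed.

Section Iterates.
Variables (s : fps F) (r : F).
Hypotheses (s_lead : leading s 1 r) (nz_r : r != 0).

Let s0 : s 0%N = 0. Proof. exact: s_lead.1. Qed.
Let iterate k := iter k (fun f => fps_comp f s) fps_t.

Lemma leading_iterate k : leading (iterate k) 1 (r ^+ k).
Proof.
elim: k => [|k IHk]; first exact: leading_t.
by have := leading_comp s0 s_lead IHk; rewrite mul1n expr1 -exprSr.
Qed.

(** Composing the identity for [k] with [s], then using the one for [s], leaves a common factor
    [q(s)] to cancel. *)
Lemma iterate_fixed p q k : q != 0 -> fps_comp p s * q = p * fps_comp q s ->
  fps_comp p (iterate k) * q = p * fps_comp q (iterate k).
Proof.
move=> nz_q fix1; elim: k => [|k IHk]; first by rewrite !fps_comp_id.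
have it0 : iterate k 0%N = 0 by apply: (leading_iterate k).1.
have nz_qs : fps_comp q s != 0.
  exact: fps_comp_neq0 s_lead nz_r nz_q.
rewrite /iterate iterS -[iter k _ _]/(iterate k) -!fps_compA //.
apply: (mulIf nz_qs); have /(congr1 ((fps_comp (F := F))^~ s)) := IHk.
rewrite !fps_compM // => IHs.
by rewrite mulrAC IHs mulrAC fix1 mulrAC.
Qed.

End Iterates.

(* If [S = t + b t^(l+1) + ...] then [f(S) - f = f'(t) (S - t) + ...]. *)
Lemma leading_comp_sub S b l f m c : (0 < l)%N -> leading (S - fps_t) l.+1 b ->
  leading f m c -> leading (fps_comp f S - f) (m + l) (c * b *+ m).
Proof.
move=> l_gt0 [e0 el] [f0 fm].
have S_lead : leading S 1 1.
  have e1 : (S - fps_t) 1%N = 0 by apply: e0; rewrite ltnS.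
  have e00 : (S - fps_t) 0%N = 0 by apply: e0.
  by split=> [[|//] _|]; rewrite -(subrK fps_t S) coef_fpsD ?e00 ?e1 add0r.
have SX k : leading (S ^+ k - fps_t ^+ k) (k + l) (b *+ k).
  elim: k => [|k IHk]; first by rewrite !expr0 subrr; split=> [i _|]; rewrite coef_fps0.
  have -> : S ^+ k.+1 - fps_t ^+ k.+1 = S * (S ^+ k - fps_t ^+ k) + (S - fps_t) * fps_t ^+ k.
    by rewrite !exprS mulrBr mulrBl addrA subrK.
  rewrite mulrSr -[b *+ k]mul1r addSn -add1n; apply: leadingD; first exact: leadingM.
  have := leadingM (conj e0 el) (leadingX k leading_t).
  by rewrite mul1n expr1n mulr1 addSn addnC.
have coefE n : (fps_comp f S - f) n = \sum_(k < n.+1) f k * (S ^+ k - fps_t ^+ k) n.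
  rewrite -{2}(fps_comp_id f) coef_fpsB !coef_fps_comp -sumrB.
  by apply: eq_bigr => k _; rewrite -mulrBr.
split=> [i lt_i|]; rewrite coefE.
  rewrite big1 // => k _; have [/f0 -> | le_mk] := ltnP k m; first by rewrite mul0r.
  by rewrite (SX k).1 ?mulr0 // (leq_trans lt_i) // leq_add2r.
have lt_m : (m < (m + l).+1)%N by rewrite ltnS leq_addr.
rewrite (bigD1 (Ordinal lt_m)) //= (SX m).2 fm big1 ?addr0 ?mulrnAr // => k ne_k.
have [/f0 -> | le_mk] := ltnP k m; first by rewrite mul0r.
rewrite (SX k).1 ?mulr0 // ltn_add2r ltn_neqAle le_mk andbT eq_sym.
exact: ne_k.
Qed.

(* If subtracting constants from p / q preserves [T], and [T] forces p and q to
   have the same order, then p / q is constant. *)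
Lemma fps_ratio_const (T : fps F -> Prop) q :
    (forall p c, T p -> T (p - fps_const c * q)) -> q != 0 ->
    (forall p m c n d, T p -> leading p m c -> leading q n d -> c != 0 -> d != 0 -> m = n) ->
  forall p, T p -> exists c, p = fps_const c * q.
Proof.
move=> TB nz_q Teq p Tp; have [n [d [nz_d q_lead]]] := leading_exists nz_q.
have [->|/leading_exists[m [c [nz_c p_lead]]]] := eqVneq p 0.
  by exists 0; rewrite rmorph0 mul0r.
have eq_mn := Teq _ _ _ _ _ Tp p_lead q_lead nz_c nz_d; rewrite {}eq_mn in p_lead.
exists (c / d); apply/eqP; rewrite -subr_eq0; apply: contrapT => /negP.
case/leading_exists => m' [c' [nz_c' lead']].
have eq_m' := Teq _ _ _ _ _ (TB _ (c / d) Tp) lead' q_lead nz_c' nz_d.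
case/eqP: nz_c'; rewrite -lead'.2 eq_m' coef_fpsB coef_fps_constM p_lead.2 q_lead.2.
by rewrite divfK ?subrr.
Qed.

Section Characteristic0.
Hypothesis char0 : forall n, n.+1%:R != 0 :> F.

(** [l] is the series of log(1 + t), whose derivative is the geometric series of 1 / (1 + t); the
    chain rule transfers this to [u]. *)
Lemma fps_deriv_log1p u : u 0%N = 0 -> (1 + u) * fps_deriv (fps_log1p u) = fps_deriv u.
Proof.
move=> u0; pose l : fps F := Fps (fun k => if k is k'.+1 then (-1) ^+ k.+1 / k%:R else 0).
have -> : fps_log1p u = fps_comp l u.
  apply: fps_eq => n; rewrite coef_fps_comp coef_Fps big_ord_recl mul0r add0r.
  rewrite big_add1 big_mkord; apply: eq_bigr => i _.
  by rewrite !coef_Fps mulrAC.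
have l'E : (1 + fps_t) * fps_deriv l = 1.
  have l'n n : fps_deriv l n = (-1) ^+ n.
    by rewrite coef_fps_deriv coef_Fps -[LHS]mulr_natr mulfVK // !exprS !mulN1r opprK.
  apply: fps_eq => n; rewrite mulrDl mul1r coef_fpsD coef_fps_tM coef_fps1 l'n.
  by case: n => [|n]; rewrite ?addr0 // l'n exprS mulN1r addNr.
rewrite fps_chain_rule // mulrCA.
have /(congr1 ((fps_comp (F := F))^~ u)) := l'E.
rewrite fps_compM // fps_compD fps_comp_t // -[1](rmorph1 (@fps_const F)).
by rewrite !fps_comp_const // rmorph1 => ->; rewrite mulr1.
Qed.

Lemma fps_deriv_ratio_const p q : q != 0 -> fps_deriv p * q = p * fps_deriv q ->
  exists c, p = fps_const c * q.
Proof.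
move=> nz_q; apply: (fps_ratio_const (T := fun p => fps_deriv p * q = p * fps_deriv q)).
- move=> {}p c pq; rewrite -mulNr -rmorphN fps_derivD fps_derivM.
  by rewrite fps_deriv_const mul0r add0r !mulrDl pq mulrAC.
- by [].
move=> {}p m c n d pq p_lead q_lead nz_c nz_d.
(* The operator [t d/dt] multiplies the coefficient of index [n] by [n], so the leading coefficients
   of the two sides give [m = n]. *)
have theta f k e : leading f k e -> leading (fps_t * fps_deriv f) k (e *+ k).
  move=> [f0 fk]; have coefE j : (fps_t * fps_deriv f) j = f j *+ j.
    have := coef_fps_tXM 1 (fps_deriv f) j; rewrite expr1 => ->.
    by case: j => [|j]; rewrite ?mulr0n // subSS subn0.
  by split=> [i lt_i|]; rewrite coefE; [rewrite f0 // mul0rn | rewrite fk].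
have := leadingM (theta _ _ _ p_lead) q_lead.
have := leadingM p_lead (theta _ _ _ q_lead).
rewrite mulrCA -pq -mulrA => -[_ e1] [_]; rewrite {}e1 => /eqP.
move/eqP=> eq_mn; have nz_cd : c * d != 0 by rewrite mulf_neq0.
apply/(natr_inj char0)/(mulfI nz_cd); move: eq_mn; rewrite mulrnAr mulrnAl.
by rewrite -[_ *+ m]mulr_natr -[_ *+ n]mulr_natr => ->.
Qed.

(* If p / q has order m - n <> 0, then r is a root of unity; some iterate of s is then
   tangent to t without being t, and compares the orders of p and q again. *)
Lemma fps_fixed_ratio_tangent s r p q : leading s 1 r -> r != 0 ->
    (forall k, (0 < k)%N -> iter k (fun f => fps_comp f s) fps_t != fps_t) ->
    q != 0 -> fps_comp p s * q = p * fps_comp q s ->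
  exists c, p = fps_const c * q.
Proof.
move=> s_lead nz_r no_iter nz_q; have s0 : s 0%N = 0 by apply: s_lead.1.
apply: (fps_ratio_const (T := fun p => fps_comp p s * q = p * fps_comp q s)) => //.
  move=> {}p c pq; rewrite fps_comp_zmod_morphism fps_compM // fps_comp_const //.
  by rewrite !mulrBl pq mulrAC.
move=> {}p m c n d pq p_lead q_lead nz_c nz_d; apply/eqP; apply: contrapT => /negP ne_mn.
have nz_cd : c * d != 0 by rewrite mulf_neq0.
have rmn : r ^+ m = r ^+ n.
  have := leadingM p_lead (leading_comp s0 s_lead q_lead).
  have := leadingM (leading_comp s0 s_lead p_lead) q_lead.
  rewrite pq !mul1n => -[_ e1] [_]; rewrite {}e1 => /eqP.
  by rewrite mulrA [c * _ * d]mulrAC => /eqP/(mulfI nz_cd).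
have [k k_gt0 rk] : exists2 k, (0 < k)%N & r ^+ k = 1.
  case: (ltngtP m n) ne_mn => // lt _.
    exists (n - m)%N; rewrite ?subn_gt0 //.
    by apply: (mulfI (expf_neq0 m nz_r)); rewrite mulr1 -exprD (subnKC (ltnW lt)) rmn.
  exists (m - n)%N; rewrite ?subn_gt0 //.
  by apply: (mulfI (expf_neq0 n nz_r)); rewrite mulr1 -exprD (subnKC (ltnW lt)) rmn.
pose S := iter k (fun f => fps_comp f s) fps_t.
have [j [b [nz_b e_lead]]] : exists j b, b != 0 /\ leading (S - fps_t) j b.
  by apply: leading_exists; rewrite subr_eq0 no_iter.
have S_lead : leading S 1 1 by rewrite -rk; apply: leading_iterate.
(* [S] starts with [t], so [S - t] has order at least 2, as [leading_comp_sub] requires. *)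
case: j e_lead => [|[|l]] e_lead.
- by case/eqP: nz_b; rewrite -e_lead.2 coef_fpsB S_lead.1 ?subrr.
- by case/eqP: nz_b; rewrite -e_lead.2 coef_fpsB S_lead.2 subrr.
have pqS : (fps_comp p S - p) * q = p * (fps_comp q S - q).
  by rewrite mulrBl mulrBr (iterate_fixed s_lead nz_r _ nz_q pq).
have := leadingM (leading_comp_sub (ltn0Sn l) e_lead p_lead) q_lead.
have := leadingM p_lead (leading_comp_sub (ltn0Sn l) e_lead q_lead).
rewrite pqS addnA addnAC => -[_ e1] [_]; rewrite {}e1 => /eqP.
move/eqP=> eq_mn; case/eqP: ne_mn; have nz_cdb : c * d * b != 0 by rewrite mulf_neq0.
apply/(natr_inj char0)/(mulfI nz_cdb); move: eq_mn; rewrite mulrnAr mulrnAl mulrA [c * b * d]mulrAC.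
by rewrite -[_ *+ m]mulr_natr -[_ *+ n]mulr_natr => ->.
Qed.

(** Equating orders gives [d m + n = m + d n], hence [m = n] as [d > 1]; equating leading
    coefficients then gives [kappa = 1]. A general eigenvalue is allowed because powers of [d]
    appear once log t is adjoined. *)
Lemma fps_eigen_ratio s d r kappa p q : leading s d r -> r != 0 -> (1 < d)%N ->
    kappa != 0 -> q != 0 -> p != 0 ->
    fps_comp p s * q = fps_const kappa * (p * fps_comp q s) ->
  kappa = 1 /\ exists c, p = fps_const c * q.
Proof.
move=> s_lead nz_r d_gt1 nz_k nz_q nz_p pq.
have s0 : s 0%N = 0 by apply: s_lead.1; apply: ltnW.
have main p' m c n e k' : k' != 0 -> fps_comp p' s * q = fps_const k' * (p' * fps_comp q s) ->
    leading p' m c -> leading q n e -> c != 0 -> e != 0 -> m = n /\ k' = 1.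
  move=> nz_k' pq' p_lead q_lead nz_c nz_e.
  have lead1 := leadingM (leading_comp s0 s_lead p_lead) q_lead.
  have := leadingM (leading_const k') (leadingM p_lead (leading_comp s0 s_lead q_lead)).
  rewrite -pq' add0n => lead2.
  have [||eq_deg eq_c] := leading_uniq lead1 lead2; try by rewrite !mulf_neq0 ?expf_neq0.
  have eq_mn : m = n.
    case: (d) d_gt1 eq_deg => [|[|d']] // _; rewrite mulSn -addnA [in RHS]mulSn.
    by rewrite [(n + _)%N]addnC => /addnI/addIn/eqP; rewrite eqn_pmul2l // => /eqP.
  split=> //; have nz : c * e * r ^+ n != 0 by rewrite !mulf_neq0 ?expf_neq0.
  by apply: (mulIf nz); rewrite mul1r -mulrA -eq_c eq_mn mulrAC mulrA.
have [m [c [nz_c p_lead]]] := leading_exists nz_p.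
have [n [e [nz_e q_lead]]] := leading_exists nz_q.
have [_ k1] := main _ _ _ _ _ _ nz_k pq p_lead q_lead nz_c nz_e.
split=> //; rewrite k1 rmorph1 mul1r in pq.
apply: (fps_ratio_const (T := fun p => fps_comp p s * q = p * fps_comp q s)) pq => //.
  move=> p1 c' pq1; rewrite fps_comp_zmod_morphism fps_compM // fps_comp_const //.
  by rewrite !mulrBl pq1 mulrAC.
move=> p' m' c' n' d' pq' p_lead' q_lead' nz_c' nz_d'.
have pq1 : fps_comp p' s * q = fps_const 1 * (p' * fps_comp q s) by rewrite rmorph1 mul1r.
by have [] := main _ _ _ _ _ _ (oner_neq0 F) pq1 p_lead' q_lead' nz_c' nz_d'.
Qed.

End Characteristic0.
End PowerSeries.

(** * Laurent series *)

Lemma quotient_chain_rule (K : fieldType) (r a b Da Db : K) :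
  (r * Da * b - a * (r * Db)) / b ^+ 2 = r * ((Da * b - a * Db) / b ^+ 2).
Proof. by rewrite [r * (_ / _)]mulrA; congr (_ / _); ring. Qed.

Section Laurent.
Variable F : fieldType.

Local Notation L := (laurent F).
Local Notation lau := (@tofrac (fps F)).
Local Notation rat := (@tofrac {poly F}).

Lemma deriv_derivation : derivation (@deriv F).
Proof. by split; [apply: derivD | apply: derivM]. Qed.

Definition expansion_poly : {rmorphism {poly F} -> L} := lau \o @fps_poly F.

Lemma expansion_poly_inj : injective expansion_poly.
Proof. by move=> p q /eqP; rewrite tofrac_eq => /eqP/fps_poly_inj. Qed.

Definition expansion_morphism : {rmorphism ratfun F -> L} :=
  frac_morphism expansion_poly_inj.

Lemma expansionE : expansion_morphism =1 @expansion F.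
Proof. by []. Qed.

Lemma expansionD x y : expansion (x + y) = expansion x + expansion y :> L.
Proof. exact: (rmorphD expansion_morphism). Qed.

Lemma expansionM x y : expansion (x * y) = expansion x * expansion y :> L.
Proof. exact: (rmorphM expansion_morphism). Qed.

Lemma expansion_div x y : expansion (x / y) = expansion x / expansion y :> L.
Proof. exact: (fmorph_div expansion_morphism). Qed.

Lemma expansion_inj : injective (@expansion F).
Proof. exact: (fmorph_inj expansion_morphism). Qed.

Lemma expansion_tofrac p : expansion (rat p) = lau (fps_poly p).
Proof. exact: (frac_lift_tofrac expansion_poly_inj). Qed.

Lemma expansion_fraction p q : q != 0 ->
  expansion (rat p / rat q) = lau (fps_poly p) / lau (fps_poly q).
Proof. exact: (frac_liftE _ expansion_poly_inj). Qed.

Definition ratfun_deriv : ratfun F -> ratfun F := frac_deriv (@deriv F).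

Lemma ratfun_deriv_derivation : derivation ratfun_deriv.
Proof. exact: frac_deriv_derivation deriv_derivation. Qed.

Lemma ratfun_deriv_poly p : ratfun_deriv (rat p) = rat p^`().
Proof. exact: frac_deriv_tofrac deriv_derivation p. Qed.

Lemma laurent_deriv_derivation : derivation (@laurent_deriv F).
Proof. exact: frac_deriv_derivation (@fps_deriv_derivation F). Qed.

Lemma laurent_deriv_fps f : laurent_deriv (lau f) = lau (fps_deriv f).
Proof. exact: frac_deriv_tofrac (@fps_deriv_derivation F) f. Qed.

Lemma laurent_deriv_expansion x : laurent_deriv (expansion x) = expansion (ratfun_deriv x).
Proof.
elim/fractionW: x => a b nz_b; rewrite expansion_fraction //.
have nz_pb : fps_poly b != 0 by rewrite -(rmorph0 (@fps_poly F)) (inj_eq (@fps_poly_inj F)).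
rewrite /laurent_deriv (frac_deriv_div (@fps_deriv_derivation F)) // !fps_deriv_poly.
rewrite /ratfun_deriv (frac_deriv_div deriv_derivation) // -!expansionE fmorph_div rmorphXn.
by rewrite rmorphB !rmorphM !expansionE !expansion_tofrac.
Qed.

Section Substitution.
Variables (s : fps F) (d : nat) (r : F).
Hypotheses (s0 : s 0%N = 0) (s_lead : leading s d r) (nz_r : r != 0).

Definition Phi_fps : {rmorphism fps F -> L} := lau \o fps_comp_morphism s0.

Lemma Phi_fps_inj : injective Phi_fps.
Proof. by move=> f g /eqP; rewrite tofrac_eq => /eqP/(fps_comp_inj s0 s_lead nz_r). Qed.

Definition Phi_morphism : {rmorphism L -> L} := frac_morphism Phi_fps_inj.

Lemma PhiE : Phi_morphism =1 Phi s.
Proof. by []. Qed.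

Lemma PhiM x y : Phi s (x * y) = Phi s x * Phi s y.
Proof. exact: (rmorphM Phi_morphism). Qed.

Lemma Phi_div x y : Phi s (x / y) = Phi s x / Phi s y.
Proof. exact: (fmorph_div Phi_morphism). Qed.

Lemma Phi_tofrac f : Phi s (lau f) = lau (fps_comp f s).
Proof. exact: (frac_lift_tofrac Phi_fps_inj). Qed.

Lemma Phi_fraction f g : g != 0 -> Phi s (lau f / lau g) = lau (fps_comp f s) / lau (fps_comp g s).
Proof. exact: (frac_liftE _ Phi_fps_inj). Qed.

Lemma laurent_chain_rule x :
  laurent_deriv (Phi s x) = lau (fps_deriv s) * Phi s (laurent_deriv x).
Proof.
elim/fractionW: x => f g nz_g; rewrite Phi_fraction //.
have nz_gs := fps_comp_neq0 s0 s_lead nz_r nz_g.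
rewrite /laurent_deriv !(frac_deriv_div (@fps_deriv_derivation F)) // -!PhiE fmorph_div rmorphXn.
rewrite rmorphB !rmorphM !PhiE !Phi_tofrac !fps_chain_rule // !tofracM.
exact: quotient_chain_rule.
Qed.

Lemma Phi_const c : Phi s (lau (fps_const c)) = lau (fps_const c).
Proof. by rewrite Phi_tofrac fps_comp_const. Qed.

Section RationalSubstitution.
Variable R : ratfun F.
Hypothesis R_s : expansion R = lau s.

Definition ratfun_const : {rmorphism F -> ratfun F} := rat \o polyC.

Definition comp_ratfun_poly : {rmorphism {poly F} -> ratfun F} :=
  horner_eval R \o map_poly ratfun_const.

Lemma expansion_comp_poly p : expansion (comp_ratfun_poly p) = Phi s (expansion (rat p)).
Proof.
rewrite expansion_tofrac Phi_tofrac.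
elim/poly_ind: p => [|p c IHp].
  rewrite (rmorph0 comp_ratfun_poly) (rmorph0 (@fps_poly F)).
  have -> : fps_comp 0 s = 0 := rmorph0 (fps_comp_morphism s0).
  by rewrite -expansionE !rmorph0.
rewrite [LHS](_ : _ = expansion (comp_ratfun_poly p) * expansion R + lau (fps_const c)).
  have -> : fps_poly (p * 'X + c%:P) = fps_poly p * fps_t + fps_const c.
    by rewrite rmorphD rmorphM /= fps_polyX fps_polyC.
  rewrite IHp R_s.
  by rewrite fps_compD fps_compM // fps_comp_t // fps_comp_const // tofracD tofracM.
have -> : comp_ratfun_poly (p * 'X + c%:P) = comp_ratfun_poly p * R + ratfun_const c.
  rewrite /comp_ratfun_poly /= /horner_eval.
  have -> : map_poly ratfun_const (p * 'X + c%:P)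
      = map_poly ratfun_const p * 'X + (ratfun_const c)%:P.
    by rewrite rmorphD rmorphM /= map_polyX map_polyC.
  by rewrite hornerMXaddC.
by rewrite expansionD expansionM expansion_tofrac fps_polyC.
Qed.

(** Inherited from the injectivity of [Phi s] through the expansion; this is what lets the
    substitution extend to fractions. *)
Lemma comp_ratfun_poly_inj : injective comp_ratfun_poly.
Proof.
move=> p q eq_pq; apply: expansion_poly_inj.
apply: (fmorph_inj Phi_morphism).
have := expansion_comp_poly p; rewrite eq_pq expansion_comp_poly.
by rewrite !expansion_tofrac.
Qed.

Definition comp_ratfun : {rmorphism ratfun F -> ratfun F} := frac_morphism comp_ratfun_poly_inj.

Lemma expansion_comp x : Phi s (expansion x) = expansion (comp_ratfun x).
Proof.
elim/fractionW: x => a b nz_b.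
rewrite [comp_ratfun _](frac_liftE a comp_ratfun_poly_inj nz_b).
by rewrite !expansion_div Phi_div !expansion_comp_poly.
Qed.

Lemma comp_ratfun_const c : comp_ratfun (rat c%:P) = rat c%:P.
Proof.
apply: expansion_inj; rewrite -expansion_comp.
by rewrite expansion_tofrac fps_polyC Phi_const.
Qed.

Lemma comp_ratfun_chain_rule x :
  ratfun_deriv (comp_ratfun x) = ratfun_deriv R * comp_ratfun (ratfun_deriv x).
Proof.
apply: expansion_inj; rewrite (expansionM (ratfun_deriv R)).
rewrite -!laurent_deriv_expansion -!expansion_comp -laurent_deriv_expansion.
by rewrite laurent_chain_rule R_s laurent_deriv_fps.
Qed.

End RationalSubstitution.

Section FixedElements.
Hypothesis char0 : forall n, n.+1%:R != 0 :> F.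

Lemma laurent_char0 n : n.+1%:R != 0 :> L.
Proof.
rewrite -(rmorph_nat (lau \o @fps_const F : {rmorphism F -> L})).
by rewrite fmorph_eq0.
Qed.

Lemma laurent_constants x : laurent_deriv x = 0 -> exists c, x = lau (fps_const c).
Proof.
elim/fractionW: x => f g nz_g.
rewrite /laurent_deriv (frac_deriv_div (@fps_deriv_derivation F)) // => /eqP.
have nz_lg : lau g != 0 by rewrite tofrac_eq0.
rewrite mulf_eq0 invr_eq0 expf_eq0 (negPf nz_lg) andbF orbF subr_eq0 -!tofracM tofrac_eq.
case/eqP/(fps_deriv_ratio_const char0 nz_g) => c ->; exists c.
by rewrite tofracM mulfK.
Qed.

Lemma Phi_eigen_constant kappa x : (1 < d)%N -> kappa != 0 -> x != 0 ->
    Phi s x = lau (fps_const kappa) * x ->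
  kappa = 1 /\ exists c, x = lau (fps_const c).
Proof.
move=> d_gt1 nz_k; elim/fractionW: x => f g nz_g nz_x.
have nz_lg : lau g != 0 by rewrite tofrac_eq0.
have nz_f : f != 0 by apply: contraNneq nz_x => ->; rewrite tofrac0 mul0r.
have nz_gs := fps_comp_neq0 s0 s_lead nz_r nz_g.
rewrite Phi_fraction // mulrA => /eqP; rewrite eqr_div ?tofrac_eq0 // -!tofracM tofrac_eq.
rewrite -mulrA => /eqP fg.
have [k1 [c f_eq]] := fps_eigen_ratio s_lead nz_r d_gt1 nz_k nz_g nz_f fg.
by split=> //; exists c; rewrite f_eq tofracM mulfK.
Qed.

(** For [d > 1] orders are multiplied by [d] and decide alone; for [d = 1] they are preserved, and
    the hypothesis on iterates takes over. *)
Lemma Phi_fixed_constant x :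
    (d = 1%N -> forall k, (0 < k)%N -> iter k (fun f => fps_comp f s) fps_t != fps_t) ->
    (0 < d)%N -> Phi s x = x -> exists c, x = lau (fps_const c).
Proof.
move=> no_iter d_gt0 fix_x.
have [->|nz_x] := eqVneq x 0; first by exists 0; rewrite (rmorph0 (@fps_const F)) tofrac0.
have [d_gt1 | d_le1] := ltnP 1 d.
  have [|_ //] := Phi_eigen_constant d_gt1 (oner_neq0 F) nz_x.
  by rewrite (rmorph1 (@fps_const F)) tofrac1 mul1r.
have d1 : d = 1%N by apply/eqP; rewrite eqn_leq d_le1.
move: (s_lead) (no_iter d1) => lead1 {}no_iter; rewrite d1 in lead1.
elim/fractionW: x fix_x {nz_x} => f g nz_g.
have nz_lg : lau g != 0 by rewrite tofrac_eq0.
have nz_gs := fps_comp_neq0 s0 s_lead nz_r nz_g.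
rewrite Phi_fraction // => /eqP; rewrite eqr_div ?tofrac_eq0 // -!tofracM tofrac_eq => /eqP fg.
have [c f_eq] := fps_fixed_ratio_tangent char0 lead1 nz_r no_iter nz_g fg.
by exists c; rewrite f_eq tofracM mulfK.
Qed.

End FixedElements.
End Substitution.
End Laurent.

(** * Adjoining a logarithm *)

Lemma map_poly_derivation (K : fieldType) (D : K -> K) :
  derivation D -> derivation (map_poly D).
Proof.
move=> derD; have D0 := derivation0 derD.
split=> p q; apply/polyP => n; rewrite !(coef_map_id0 _ _ D0, coefD) ?derD.1 //.
rewrite !coefM (derivation_sum derD) -big_split; apply: eq_bigr => i _.
by rewrite /= derD.2 !(coef_map_id0 _ _ D0).
Qed.

Lemma log_product_rule (A : comNzRingType) (M v c' t d : A) :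
  d * M * v + t * (M * (v * c')) = M * v * (t * c' + d).
Proof. by ring. Qed.

Lemma log_chain_rule_identity (A : comNzRingType) (r P Q l T x : A) :
  r * P * l + Q * (r * T) + r * x = r * (P * l + Q * T + x).
Proof. by ring. Qed.

(** Logarithmic differentiation of [s], cleared of denominators: [t s' / s = t c' + d], where [c]
    plays the part of log(1 + u) up to a constant. *)
Lemma fps_deriv_tangent (F : fieldType) (u c : fps F) r d : (1 + u) * fps_deriv c = fps_deriv u ->
  let s := fps_const r * fps_t ^+ d * (1 + u) in
  fps_t * fps_deriv s = s * (fps_t * fps_deriv c + d%:R).
Proof.
move=> cu s.
have tX : fps_t * fps_deriv (fps_const r * fps_t ^+ d) = d%:R * (fps_const r * fps_t ^+ d).
  rewrite fps_deriv_monomial; case: d {s} => [|d]; first by rewrite rmorph0 !mul0r mulr0.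
  by rewrite rmorphMn -mulr_natl /= [fps_t * _]mulrC -!mulrA -exprSr.
have u'E : fps_deriv (1 + u) = fps_deriv u.
  by rewrite fps_derivD -[1](rmorph1 (@fps_const F)) fps_deriv_const add0r.
rewrite /s fps_derivM u'E -cu mulrDr [fps_t * (_ * (1 + u))]mulrA tX.
exact: log_product_rule.
Qed.

Lemma eigen_ratio (L : fieldType) (a b fa fb m n : L) : b != 0 -> fb != 0 ->
  fa * m * b = a * (fb * n) -> fa / fb * m * b * fb = a / b * n * b * fb.
Proof.
move=> nz_b nz_fb eq_ab; have -> : a / b * n * b * fb = a * (fb * n) by field.
by rewrite -eq_ab; field.
Qed.

Section LogExtension.
Variables (L : fieldType) (D : L -> L) (phi : {rmorphism L -> L}) (tinv c rho : L) (d : nat).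
Hypotheses (derD : derivation D) (nz_d : (d%:R : L) != 0).
Hypothesis chain_rule : forall x, D (phi x) = rho * phi (D x).
Hypothesis log_compat : D c + d%:R * tinv = rho * phi tinv.
Hypothesis eigen : forall x m n, x != 0 ->
  phi x * d%:R ^+ m = x * d%:R ^+ n -> m = n.

Local Notation pol := (@tofrac {poly L}).
Let D0 := derivation0 derD.

Definition log_deriv (p : {poly L}) : {poly L} := map_poly D p + tinv *: p^`().

Lemma log_deriv_derivation : derivation log_deriv.
Proof.
have [DD DM] := map_poly_derivation derD.
split=> p q; rewrite /log_deriv.
  by rewrite DD derivD scalerDr addrACA.
by rewrite DM derivM scalerDr mulrDl mulrDr -scalerAl -scalerAr addrACA.
Qed.

Lemma log_derivC x : log_deriv x%:P = (D x)%:P.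
Proof.
rewrite /log_deriv derivC scaler0 addr0; apply/polyP => n.
by rewrite (coef_map_id0 _ _ D0) !coefC; case: eqP.
Qed.

Lemma log_derivX : log_deriv 'X = tinv%:P.
Proof.
rewrite /log_deriv derivX alg_polyC [X in X + _](_ : _ = 0) ?add0r //.
apply/polyP => n; rewrite (coef_map_id0 _ _ D0) coefX coef0.
by case: eqP => _; rewrite ?D0 // (derivation1 derD).
Qed.

Lemma log_frac_deriv_derivation : derivation (frac_deriv log_deriv).
Proof. exact: frac_deriv_derivation log_deriv_derivation. Qed.

Lemma log_frac_derivC x : frac_deriv log_deriv (pol x%:P) = pol (D x)%:P.
Proof. by rewrite (frac_deriv_tofrac log_deriv_derivation) log_derivC. Qed.

Let ell : {poly L} := d%:R *: 'X + c%:P.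

Let size_ell : size ell = 2.
Proof.
by rewrite /ell -mul_polyC size_MXaddC polyC_eq0 (negPf nz_d) /= size_polyC nz_d.
Qed.

Let lead_ell : lead_coef ell = d%:R.
Proof. by rewrite lead_coefE size_ell /ell coefD coefZ coefX coefC /= mulr1 addr0. Qed.

Definition log_subst : {rmorphism {poly L} -> {poly L}} := comp_poly ell \o map_poly phi.

Lemma log_substE p : log_subst p = map_poly phi p \Po ell.
Proof. by []. Qed.

Lemma log_substD p q : log_subst (p + q) = log_subst p + log_subst q.
Proof. exact: rmorphD. Qed.

Lemma log_substM p q : log_subst (p * q) = log_subst p * log_subst q.
Proof. exact: rmorphM. Qed.

Lemma size_log_subst p : size (log_subst p) = size p.
Proof. by rewrite log_substE size_comp_poly2 // size_map_poly. Qed.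

Lemma log_subst_neq0 p : p != 0 -> log_subst p != 0.
Proof. by rewrite -size_poly_eq0 -(size_log_subst p) size_poly_eq0. Qed.

Lemma lead_log_subst p :
  lead_coef (log_subst p) = phi (lead_coef p) * d%:R ^+ (size p).-1.
Proof. by rewrite log_substE lead_coef_comp ?size_ell // lead_ell lead_coef_map size_map_poly. Qed.

Definition log_frac_subst_poly : {rmorphism {poly L} -> {fraction {poly L}}} := pol \o log_subst.

Lemma log_frac_subst_poly_inj : injective log_frac_subst_poly.
Proof.
move=> p q /eqP; rewrite tofrac_eq -subr_eq0 -rmorphB -size_poly_eq0 size_log_subst.
by rewrite size_poly_eq0 subr_eq0 => /eqP.
Qed.

Definition log_frac_subst : {rmorphism {fraction {poly L}} -> {fraction {poly L}}} :=
  frac_morphism log_frac_subst_poly_inj.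

Lemma log_frac_subst_tofrac p : log_frac_subst (pol p) = pol (log_subst p).
Proof. exact: (frac_lift_tofrac log_frac_subst_poly_inj). Qed.

Lemma log_frac_subst_fraction p q : q != 0 ->
  log_frac_subst (pol p / pol q) = pol (log_subst p) / pol (log_subst q).
Proof. exact: (frac_liftE _ log_frac_subst_poly_inj). Qed.

Lemma log_substC x : log_subst x%:P = (phi x)%:P.
Proof. by rewrite log_substE map_polyC comp_polyC. Qed.

Lemma log_substX : log_subst 'X = ell.
Proof. by rewrite log_substE map_polyX comp_polyX. Qed.

Lemma log_frac_substC x : log_frac_subst (pol x%:P) = pol (phi x)%:P.
Proof. by rewrite log_frac_subst_tofrac log_substC. Qed.

(** The chain rule at the generator: [ell] is the image of log t, and [log_compat] is this identity
    read in [L]. *)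
Lemma log_deriv_ell : log_deriv ell = (rho * phi tinv)%:P.
Proof.
have [DD DM] := log_deriv_derivation.
rewrite /ell -mul_polyC DD DM !log_derivC log_derivX -log_compat polyCD [RHS]addrC polyCM.
have -> : D d%:R = 0.
  by elim: (d) => [|k IHk]; rewrite ?D0 // -natr1 derD.1 IHk (derivation1 derD) addr0.
by rewrite polyC0 mul0r add0r.
Qed.

Lemma log_chain_rule_poly p : log_deriv (log_subst p) = rho%:P * log_subst (log_deriv p).
Proof.
have [DD DM] := log_deriv_derivation.
elim/poly_ind: p => [|p x IHp].
  by rewrite rmorph0 -polyC0 log_derivC D0 polyC0 rmorph0 mulr0.
rewrite log_substD log_substM log_substX log_substC !DD !DM IHp log_deriv_ell.
rewrite !log_derivC log_derivX.
rewrite chain_rule !log_substD !log_substM.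
rewrite log_substX !log_substC !polyCM -[log_subst (map_poly D p) + _]log_substD.
exact: log_chain_rule_identity.
Qed.

Lemma log_frac_chain_rule x : frac_deriv log_deriv (log_frac_subst x)
  = pol rho%:P * log_frac_subst (frac_deriv log_deriv x).
Proof.
elim/fractionW: x => p q nz_q; rewrite log_frac_subst_fraction //.
have nz_qs := log_subst_neq0 nz_q.
rewrite !(frac_deriv_div log_deriv_derivation) // fmorph_div rmorphXn rmorphB !rmorphM.
rewrite !log_frac_subst_tofrac !log_chain_rule_poly !tofracM.
exact: quotient_chain_rule.
Qed.

(* Comparing degrees and leading coefficients in log t: if p / q is fixed, p and q
   have the same degree and a constant ratio a of leading coefficients, and the
   same holds for p - a q unless it is 0. *)
Lemma log_frac_subst_fixed x : log_frac_subst x = x -> exists2 a, phi a = a & x = pol a%:P.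
Proof.
elim/fractionW: x => p q nz_q.
have nz_qs := log_subst_neq0 nz_q.
have nz_lq : pol q != 0 by rewrite tofrac_eq0.
rewrite log_frac_subst_fraction // => /eqP.
rewrite eqr_div ?tofrac_eq0 // -!tofracM tofrac_eq => /eqP pq.
have main p' : p' != 0 -> log_subst p' * q = p' * log_subst q ->
    size p' = size q /\ exists2 a, phi a = a & lead_coef p' = a * lead_coef q.
  move=> nz_p' pq'.
  have nz_lp : lead_coef p' != 0 by rewrite lead_coef_eq0.
  have nz_lq' : lead_coef q != 0 by rewrite lead_coef_eq0.
  have := congr1 lead_coef pq'; rewrite !lead_coefM !lead_log_subst => lead_eq.
  have nz_w : lead_coef p' / lead_coef q != 0 by rewrite mulf_neq0 ?invr_eq0.
  have nz_plq : phi (lead_coef q) != 0 by rewrite fmorph_eq0.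
  (* Since log t goes to [d * log t + c], a leading coefficient in degree [n] is multiplied by
     [d ^ n]; the ratio of leading coefficients thus becomes an eigenvector, as in [eigen]. *)
  have w_eq : phi (lead_coef p' / lead_coef q) * d%:R ^+ (size p').-1
      = lead_coef p' / lead_coef q * d%:R ^+ (size q).-1.
    rewrite fmorph_div; apply: (mulIf nz_lq'); apply: (mulIf nz_plq).
    exact: eigen_ratio nz_lq' nz_plq lead_eq.
  have eq_sz := eigen nz_w w_eq.
  split.
    have szp : (0 < size p')%N by rewrite size_poly_gt0.
    have szq : (0 < size q)%N by rewrite size_poly_gt0.
    by rewrite -(prednK szp) eq_sz prednK.
  exists (lead_coef p' / lead_coef q); last by rewrite divfK.
  by apply: (mulIf (expf_neq0 (size p').-1 nz_d)); rewrite w_eq eq_sz.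
have [-> | nz_p] := eqVneq p 0.
  exists 0; first exact: rmorph0.
  by rewrite (polyC0 L : 0%:P = 0) tofrac0 mul0r.
have [eq_sz [a phi_a lead_eq]] := main p nz_p pq; exists a => //.
have [/eqP | nz_diff] := eqVneq (p - a%:P * q) 0.
  by rewrite subr_eq0 => /eqP ->; rewrite tofracM mulfK.
have pq2 : log_subst (p - a%:P * q) * q = (p - a%:P * q) * log_subst q.
  by rewrite rmorphB rmorphM log_substC phi_a !mulrBl pq mulrAC.
have [sz_eq _] := main _ nz_diff pq2.
have szq : (0 < size q)%N by rewrite size_poly_gt0.
suff : (size (p - a%:P * q)%R < size q)%N by rewrite sz_eq ltnn.
rewrite -(prednK szq) ltnS; apply/leq_sizeP => n.
rewrite leq_eqVlt coefB coefCM => /predU1P[<-|].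
  by rewrite -lead_coefE -lead_eq lead_coefE eq_sz subrr.
by rewrite (prednK szq) => le_qn; rewrite !nth_default ?eq_sz // mulr0 subr0.
Qed.

End LogExtension.

(** * The dichotomy *)

Lemma mmap_rmorphism (K L L' : fieldType) (iota : K -> L) (f : {rmorphism L -> L'})
    n (h : 'I_n -> L) (h' : 'I_n -> L') (P : mpoly n K) :
  (forall i, h' i = f (h i)) -> mmap (f \o iota) h' P = f (mmap iota h P).
Proof.
move=> h'E; rewrite /mmap rmorph_sum; apply: eq_bigr => m _.
rewrite rmorphM /= /mmap1 rmorph_prod; congr (_ * _); apply: eq_bigr => i _.
by rewrite rmorphXn h'E.
Qed.

Lemma log_compat_identity (L : fieldType) (t s s' c' d : L) : t != 0 -> s != 0 ->
  t * s' = s * (t * c' + d) -> c' + d * t^-1 = s' * s^-1.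
Proof.
move=> nz_t nz_s tsE; apply: (mulfI nz_t); apply: (mulIf nz_s).
rewrite mulrDr -mulrA [_ * s]mulrC mulrA [t * (d * _)]mulrC.
by rewrite mulfVK // -tsE mulrA divfK // mulrC.
Qed.

Lemma chain_rule_identity (L : fieldType) (a a' y rho y' z : L) : a != 0 ->
  a' * z + a * (y * z) = rho * (y' * (a * z)) ->
  rho * y' * (a * z) = (y + a' / a) * (a * z).
Proof. by move=> nz_a; rewrite -mulrA => <-; field. Qed.

Lemma dlog_eq0 (L : fieldType) (D : L -> L) x : x != 0 -> dlog D x = 0 -> D x = 0.
Proof. by move=> nz_x Dx0; rewrite -[D x](divfK nz_x) [D x / x]Dx0 mul0r. Qed.

Lemma root_map_XnsubC (K L : fieldType) (f : {rmorphism K -> L}) n b z :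
  z ^+ n = f b -> root (map_poly f ('X^n - b%:P)) z.
Proof.
by move=> zn; rewrite rmorphB /= map_polyXn map_polyC rootE !hornerE zn subrr.
Qed.

Section Dichotomy.
Variables (C : closedFieldType) (R : ratfun C) (s : fps C) (d : nat) (r : C).
Hypothesis char0 : forall n, n.+1%:R != 0 :> C.
Hypotheses (s0 : s 0%N = 0) (s_lead : leading s d r) (nz_r : r != 0).
Hypothesis R_s : expansion R = s%:F.
Variables (a : ratfun C) (z : laurent C).
Hypotheses (nz_z : z != 0) (Phi_z : Phi s z = expansion a * z).

Local Notation Theta := (comp_ratfun s0 s_lead nz_r R_s).
Local Notation rho := (ratfun_deriv R).

Lemma power_rational (y : ratfun C) :
    (forall h, rho * Theta h = h -> h = 0) -> laurent_deriv z = expansion y * z ->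
  exists2 N : nat, (0 < N)%N & exists b, z ^+ N = expansion b.
Proof.
move=> no_invariant z'E.
have derL := @laurent_deriv_derivation C; have derK := @ratfun_deriv_derivation C.
have nz_exp (x : ratfun C) : x != 0 -> expansion x != 0.
  by rewrite -(expansionE x) fmorph_eq0.
have nz_a : a != 0.
  apply/eqP => a0; move: Phi_z; rewrite a0 -[expansion 0]expansionE rmorph0 mul0r.
  by move/eqP; rewrite -(PhiE s0 s_lead nz_r) fmorph_eq0 (negPf nz_z).
(* Obtained by differentiating both sides of [Phi_z] and dividing by [a z]. *)
have y_eq : rho * Theta y = y + dlog (@ratfun_deriv C) a.
  have nz_exp_a := nz_exp _ nz_a.
  have := laurent_chain_rule s0 s_lead nz_r z.
  rewrite z'E Phi_z (PhiM s0 s_lead nz_r) Phi_z derL.2 z'E laurent_deriv_expansion.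
  rewrite -laurent_deriv_fps -R_s laurent_deriv_expansion (expansion_comp s0 s_lead nz_r R_s).
  move=> eq_z; apply: (@expansion_inj C); apply: (mulIf (mulf_neq0 nz_exp_a nz_z)).
  rewrite (expansionM rho) expansionD [expansion (dlog _ _)]expansion_div.
  exact: chain_rule_identity.
(* [coboundary_dlog] gives a nonzero integer; a negative one is replaced by its opposite at the
   price of inverting [b]. *)
have [N [b [N_gt0 nz_b yN]]] :
    exists (N : nat) b, [/\ (0 < N)%N, b != 0 & y *+ N = dlog (@ratfun_deriv C) b].
  have frac x : exists p q : {poly C}, q != 0 /\ x = p%:F / q%:F.
    by elim/fractionW: x => p q nz_q; exists p, q.
  have inj : injective (@tofrac {poly C}) by move=> p q /eqP; rewrite tofrac_eq => /eqP.
  have [[[|N]|N] [b [nz_N nz_b yN]]] := coboundary_dlog char0 inj frac derK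
    (@ratfun_deriv_poly C) (comp_ratfun_chain_rule s0 s_lead nz_r R_s)
    (comp_ratfun_const s0 s_lead nz_r R_s) no_invariant nz_a y_eq.
  - by case/eqP: nz_N.
  - by exists N.+1, b; split=> //; rewrite -yN pmulrn.
  exists N.+1, b^-1; split; rewrite ?invr_eq0 // (dlogV derK) // -yN NegzE mulrNz opprK.
  by rewrite pmulrn.
have nz_eb := nz_exp _ nz_b; have nz_zN : z ^+ N != 0 by rewrite expf_neq0.
have dlog0 : dlog (@laurent_deriv C) (z ^+ N / expansion b) = 0.
  have dlog_z : dlog (@laurent_deriv C) z = expansion y by rewrite /dlog z'E mulfK.
  have dlog_b : dlog (@laurent_deriv C) (expansion b) = expansion (y *+ N).
    by rewrite yN expansion_div -laurent_deriv_expansion.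
  rewrite (dlog_div derL nz_zN nz_eb) (dlogXn derL _ nz_z) dlog_z dlog_b.
  by rewrite -!expansionE rmorphMn subrr.
have [c zN] : exists c, z ^+ N / expansion b = (fps_const c)%:F.
  apply: (laurent_constants char0).
  by apply: dlog_eq0 dlog0; rewrite mulf_neq0 ?invr_eq0.
exists N => //; exists ((c%:P)%:F * b).
by rewrite expansionM expansion_tofrac fps_polyC -zN divfK.
Qed.

Lemma no_invariant_form (F : fieldType) (iota : {rmorphism ratfun C -> F}) (D : F -> F)
    (Phi' : {rmorphism F -> F}) (Psi : F) :
    (forall x, D (iota x) = iota (ratfun_deriv x)) ->
    (forall x, Phi' (iota x) = iota (Theta x)) ->
    (forall x, Phi' x = x -> x \in fieldRange iota) ->
    Phi' Psi = iota rho * Psi -> diff_transcendental iota D Psi ->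
  forall h, rho * Theta h = h -> h = 0.
Proof.
move=> D_iota Phi_iota Phi_fixed Phi_Psi Psi_tr h rhoh.
apply: (invariant_form_eq0 _ Phi_fixed Phi_Psi Psi_tr) => [x|].
  by rewrite D_iota mem_fieldRange.
by rewrite Phi_iota -rmorphM rhoh.
Qed.

(** The relation satisfied by [z] is carried by [lift] into the field where [Psi] lives, and the
    resulting [z' = y z] is brought back to Laurent series by injectivity. *)
Lemma differential_dichotomy (F : fieldType) (iota : {rmorphism ratfun C -> F})
    (lift : {rmorphism laurent C -> F}) (D : F -> F)
    (Phi' : {rmorphism F -> F}) (Psi : F) :
    (forall x, iota x = lift (expansion x)) ->
    (forall x, D (lift x) = lift (laurent_deriv x)) ->
    (forall x, Phi' (lift x) = lift (Phi s x)) ->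
    derivation D -> (forall x, D (Phi' x) = iota rho * Phi' (D x)) ->
    (forall x, Phi' x = x -> exists c, x = lift (fps_const c)%:F) ->
    Phi' Psi = iota rho * Psi -> diff_transcendental iota D Psi ->
  ~ diff_transcendental (@expansion C) (@laurent_deriv C) z ->
  exists2 N : nat, (0 < N)%N & exists b, z ^+ N = expansion b.
Proof.
move=> iotaE D_lift Phi_lift derD chain fixed Phi_Psi Psi_tr.
move=> /existsNP[n /existsNP[P /not_implyP[nz_P /negP]]]; rewrite negbK => /eqP P0.
have D_iota x : D (iota x) = iota (ratfun_deriv x).
  by rewrite !iotaE D_lift laurent_deriv_expansion.
have Phi_iota x : Phi' (iota x) = iota (Theta x).
  by rewrite !iotaE Phi_lift (expansion_comp s0 s_lead nz_r R_s).
have Phi_fixed x : Phi' x = x -> x \in fieldRange iota.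
  move=> /fixed[c ->]; apply/fieldRangeP; exists (c%:P)%:F.
  by rewrite iotaE expansion_tofrac fps_polyC.
have char0F n0 : n0.+1%:R != 0 :> F.
  by rewrite -(rmorph_nat lift) fmorph_eq0 laurent_char0.
have iter_lift i : iter i D (lift z) = lift (iter i (@laurent_deriv C) z).
  by elim: i => //= i ->; apply: D_lift.
have [|||||y] := log_derivative_rational char0F derD _ _ chain Phi_fixed Phi_Psi Psi_tr
    (a := a) (z := lift z) _ _ nz_P.
- by move=> x; rewrite D_iota mem_fieldRange.
- by move=> x; rewrite Phi_iota mem_fieldRange.
- by rewrite fmorph_eq0.
- by rewrite Phi_lift Phi_z rmorphM iotaE.
- rewrite -(rmorph0 lift) -P0 -(mmap_rmorphism _ _ (fun i => iter_lift i)).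
  by congr (mmap _ _ _); apply/funext => x; rewrite iotaE.
rewrite D_lift iotaE -rmorphM => /fmorph_inj z'E.
apply: power_rational z'E.
exact: no_invariant_form D_iota Phi_iota Phi_fixed Phi_Psi Psi_tr.
Qed.

Lemma derivR_expansion : expansion (ratfun_deriv R) = (fps_deriv s)%:F.
Proof. by rewrite -laurent_deriv_expansion R_s laurent_deriv_fps. Qed.

Lemma tangent_dichotomy (Psi : laurent C) : (0 < d)%N ->
    (d = 1%N -> forall k, (0 < k)%N -> iter k (fun f => fps_comp f s) fps_t != fps_t) ->
    Phi s Psi = laurent_deriv (expansion R) * Psi ->
    diff_transcendental (@expansion C) (@laurent_deriv C) Psi ->
  ~ diff_transcendental (@expansion C) (@laurent_deriv C) z ->
  exists2 N : nat, (0 < N)%N & exists b, z ^+ N = expansion b.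
Proof.
move=> d_gt0 no_iter; rewrite laurent_deriv_expansion => Phi_Psi Psi_tr.
apply: (@differential_dichotomy (laurent C)
  (@expansion_morphism C) idfun (@laurent_deriv C) (Phi_morphism s0 s_lead nz_r) Psi) => //.
- exact: laurent_deriv_derivation.
- move=> x; rewrite PhiE (laurent_chain_rule s0 s_lead nz_r).
  by congr (_ * _); rewrite -derivR_expansion.
- move=> x phi_x; exact: (Phi_fixed_constant s0 s_lead nz_r char0 no_iter d_gt0 phi_x).
Qed.

Lemma logarithmic_dichotomy (u : fps C) (lambda : C) (Psi : loglaurent C) :
    (1 < d)%N -> u 0%N = 0 ->
    s = fps_const r * fps_t ^+ d * (1 + u) ->
    Phi_log s d (fps_const lambda + fps_log1p u) Psi
      = loglaurent_of (laurent_deriv (expansion R)) * Psi ->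
    diff_transcendental (fun f => loglaurent_of (expansion f)) (@loglaurent_deriv C) Psi ->
  ~ diff_transcendental (@expansion C) (@laurent_deriv C) z ->
  exists2 N : nat, (0 < N)%N & exists b, z ^+ N = expansion b.
Proof.
move=> d_gt1 u0 sE; rewrite laurent_deriv_expansion => Phi_Psi Psi_tr.
have nz_d : (d%:R : laurent C) != 0 by rewrite -(ltn_predK d_gt1) laurent_char0.
have nz_dC : (d%:R : C) != 0 by rewrite -(ltn_predK d_gt1) char0.
pose c := fps_const lambda + fps_log1p u.
pose phi := Phi_morphism s0 s_lead nz_r.
have nz_s : s != 0.
  by apply: contraNneq nz_r => s_0; case: s_lead => _ <-; rewrite s_0 coef_fps0.
have nz_t : (fps_t : fps C) != 0.
  by apply/eqP => t0; case: (leading_t C); rewrite t0 coef_fps0 => _ /esym/eqP; rewrite oner_eq0.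
have chain x : laurent_deriv (phi x) = (fps_deriv s)%:F * phi (laurent_deriv x).
  exact: (laurent_chain_rule s0 s_lead nz_r x).
have c'E : (1 + u) * fps_deriv c = fps_deriv u.
  by rewrite /c fps_derivD fps_deriv_const add0r; apply: fps_deriv_log1p.
(* The derivative of [log s = lambda + d log t + log(1 + u)]. *)
have compat : laurent_deriv c%:F + d%:R * (fps_t%:F)^-1 = (fps_deriv s)%:F * phi (fps_t%:F)^-1.
  have phi_t : phi (fps_t%:F)^-1 = (s%:F)^-1.
    by rewrite fmorphV PhiE (Phi_tofrac s0 s_lead nz_r) fps_comp_t.
  rewrite phi_t laurent_deriv_fps.
  have := fps_deriv_tangent r d c'E; rewrite -sE => /(congr1 (@tofrac (fps C))).
  rewrite !tofracM tofracD tofracM (rmorph_nat (@tofrac (fps C))).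
  by apply: log_compat_identity; rewrite ?tofrac_eq0.
have fps_constXn m : (d%:R ^+ m : laurent C) = (fps_const (d%:R ^+ m : C))%:F.
  rewrite (rmorphXn (@fps_const C)) tofracXn; congr (_ ^+ m).
  by rewrite -(rmorph_nat (@tofrac (fps C))) -(rmorph_nat (@fps_const C)).
(* [x] is an eigenvector of [Phi s] for [d ^ n / d ^ m], which must therefore be 1; as [d > 1], this
   gives [m = n]. *)
have eigen (x : laurent C) m n : x != 0 -> phi x * d%:R ^+ m = x * d%:R ^+ n -> m = n.
  move=> nz_x; rewrite PhiE => phi_x; pose kappa : C := d%:R ^+ n / d%:R ^+ m.
  have nz_k : kappa != 0 by rewrite mulf_neq0 ?invr_eq0 ?expf_neq0.
  have [|k1 _] := Phi_eigen_constant s0 s_lead nz_r d_gt1 nz_k nz_x.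
    apply: (mulIf (expf_neq0 m nz_d)); rewrite phi_x mulrC !fps_constXn mulrAC -tofracM.
    by rewrite -(rmorphM (@fps_const C)) divfK ?expf_neq0.
  move: k1 => /(canRL (mulfVK (expf_neq0 m nz_dC))); rewrite mul1r -!natrX => dn_dm.
  by apply: (expnI d_gt1); apply/esym/(natr_inj char0 dn_dm).
pose Phi' := log_frac_subst phi c%:F nz_d.
pose lift : {rmorphism laurent C -> loglaurent C} := @tofrac {poly laurent C} \o polyC.
apply: (@differential_dichotomy (loglaurent C)
  (lift \o expansion_morphism C) lift (@loglaurent_deriv C) Phi' Psi) => //.
- exact: log_frac_derivC (laurent_deriv_derivation C).
- exact: log_frac_substC.
- exact: log_frac_deriv_derivation (laurent_deriv_derivation C).
- move=> x; have := log_frac_chain_rule (laurent_deriv_derivation C) nz_d chain compat x.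
  by rewrite -derivR_expansion.
- move=> x /(log_frac_subst_fixed eigen)[y phi_y ->].
  have d_neq1 : d <> 1%N by move=> d1; rewrite d1 in d_gt1.
  have [||e ->] := Phi_fixed_constant s0 s_lead nz_r char0 _ _ phi_y; first by [].
    exact: ltnW.
  by exists e.
Qed.

End Dichotomy.

Theorem theoremF (K : realType) (R : ratfun K[i]) (s u : fps K[i]) (d : nat)
    (r lambda : K[i])
    (hRs : expansion R = s%:F) (hR0 : s 0%N = 0) (hRneq0 : R != 0)
    (hiter : forall n : nat, (0 < n)%N ->
       iter n (fun f => fps_comp f s) fps_t != fps_t)
    (hd : (1 <= d)%N) (hr : r != 0) (hu : u 0%N = 0)
    (hs : s = fps_const r * fps_t ^+ d * (1 + u))
    (hlambda : cexp lambda = r)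
    (hPsi : if d == 1%N then
        exists Psi : laurent K[i],
          Phi s Psi = laurent_deriv (expansion R) * Psi /\
          diff_transcendental (@expansion K[i]) (@laurent_deriv K[i]) Psi
      else
        exists Psi : loglaurent K[i],
          Phi_log s d (fps_const lambda + fps_log1p u) Psi
            = loglaurent_of (laurent_deriv (expansion R)) * Psi /\
          diff_transcendental (fun f => loglaurent_of (expansion f))
            (@loglaurent_deriv K[i]) Psi)
    (a : ratfun K[i]) (z : laurent K[i])
    (hz : Phi s z = expansion a * z) :
  (algebraicOver (@expansion K[i]) z /\
   exists2 N : nat, (0 < N)%N & exists b : ratfun K[i], z ^+ N = expansion b)
  \/ diff_transcendental (@expansion K[i]) (@laurent_deriv K[i]) z.
Proof.
have char0 n : n.+1%:R != 0 :> K[i] by rewrite Num.Theory.pnatr_eq0.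
have s_lead : leading s d r.
  have lead1u : leading (1 + u) 0 (1 + 0) by apply: leadingD (leading1 _) _; split.
  have := leadingM (leadingM (leading_const r) (leadingX d (leading_t _))) lead1u.
  by rewrite -hs mul1n add0n addn0 expr1n addr0 !mulr1.
have [|not_tr] := pselect (diff_transcendental (@expansion K[i]) (@laurent_deriv K[i]) z).
  by right.
(* The power alone remains to be found: [z] is then a root of ['X^N - b], hence algebraic. *)
left; suff [N N_gt0 [b zN]] :
    exists2 N : nat, (0 < N)%N & exists b : ratfun K[i], z ^+ N = expansion b.
  split; last by exists N => //; exists b.
  exists ('X^N - b%:P); first exact/monic_neq0/monicXnsubC.
  exact: (root_map_XnsubC (f := expansion_morphism K[i])).
(* The zero series has no logarithmic derivative; [N = 1] and [b = 0] settle it. *)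
have [->|nz_z] := eqVneq z 0.
  by exists 1%N => //; exists 0; rewrite expr1 -expansionE rmorph0.
case: eqP hPsi => [d1|/eqP d_neq1] [Psi [Phi_Psi Psi_tr]].
  exact: (tangent_dichotomy char0 hR0 s_lead hr hRs nz_z hz hd (fun _ => hiter)
    Phi_Psi Psi_tr not_tr).
have d_gt1 : (1 < d)%N by rewrite ltn_neqAle eq_sym d_neq1.
exact: (logarithmic_dichotomy char0 hR0 s_lead hr hRs nz_z hz d_gt1 hu hs
  Phi_Psi Psi_tr not_tr).
Qed.
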